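(* There exists an absolute positive constant $c$ such that the following holds. Let $d\geq 1$ and $n\geq 2$ be integers and let $H\geq 3$ be a real number. Then the number $\mathcal{N}(n,d,H)$ of complex numbers $z$ satisfying (1) $|z-(n-\tfrac12)|\leq \tfrac12$; (2) $[\mathbf{Q}(z,G(z)):\mathbf{Q}]\leq d$; (3) $H(z)\leq H$ and $H(G(z))\leq H$, is at most \[c\,n^2\log(n)\,\frac{\left(d^2\log(H)\right)^2}{\log(d\log(H))}.\]
   Context: $G(z)=1/\Gamma(z)$, where $\Gamma$ is Euler's Gamma function; $G$ is an entire function on $\mathbf{C}$. For an algebraic number $\alpha$ of degree $e$ with minimal polynomial $P(x)=a_e x^e+\cdots+a_0$ (with coprime integer coefficients and $a_e>0$), $H(\alpha)$ denotes the absolute non-logarithmic height \[H(\alpha)=\Bigl(a_e\prod_{P(\alpha')=0}\max(1,|\alpha'|)\Bigr)^{1/e},\] the product being over the complex roots of $P$; in particular $H(p/q)=\max(|p|,|q|)$ for a reduced fraction $p/q$. The symbol $H$ without argument is the given real number. Condition (2) implies that $z$ and $G(z)$ are algebraic, so the heights in (3) are defined. An absolute constant is one that does not depend on $n$, $d$ or $H$. *)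

(* Defs.v *)
From HB Require Import structures.
From mathcomp Require Import all_boot all_order all_algebra.
From mathcomp Require Import all_classical all_reals all_analysis.
From mathcomp Require Import finmap complex.

Set Implicit Arguments.
Unset Strict Implicit.
Unset Printing Implicit Defensive.

Import Order.TTheory GRing.Theory Num.Theory ComplexField.
Import numFieldNormedType.Exports.

Local Open Scope classical_set_scope.
Local Open Scope ring_scope.
Local Open Scope complex_scope.

(* [N ^ z = exp (z log N)] with the real logarithm; only N > 0 matters, since
   this is used under a limit N -> oo. *)
Definition cpow_nat (R : realType) (N : nat) (z : R[i]) : R[i] :=
  let: x +i* y := z in
  (expR (x * ln N%:R))%:C * (cos (y * ln N%:R) +i* sin (y * ln N%:R)).

Definition euler_seq (R : realType) (z : R[i]) (N : nat) : R[i] :=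
  N`!%:R * cpow_nat N z / \prod_(k < N.+1) (z + k%:R).

(* Euler's definition
     Gamma(z) = lim_N  N! N^z / (z (z + 1) ... (z + N)),
   where the limit exists for every complex z that is not a pole; the limit in
   C is taken on real and imaginary parts.  At a pole -m, the convention
   0^-1 = 0 makes the sequence vanish for N >= m, so that Gamma (- m) = 0 here
   and (Gamma (- m))^-1 = 0 is still the value of the entire function 1/Gamma. *)
Definition Gamma (R : realType) (z : R[i]) : R[i] :=
  lim (complex.Re (euler_seq z N) @[N --> \oo]) +i*
  lim (complex.Im (euler_seq z N) @[N --> \oo]).

Definition G (R : realType) (z : R[i]) : R[i] := (Gamma z)^-1.

(* Q(z, w), the smallest subfield of C containing z and w. *)
Definition Qadjoin2 (R : realType) (z w : R[i]) : set R[i] :=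
  [set x | forall S : {pred R[i]},
     GRing.divring_closed S -> z \in S -> w \in S -> x \in S].

(* [K : Q] <= d: the Q-vector space K has a generating family of d elements. *)
Definition degQ_le (R : realType) (K : set R[i]) (d : nat) : Prop :=
  exists2 v : 'I_d -> R[i], (forall i, K (v i)) &
    forall x, K x -> exists q : 'I_d -> rat, x = \sum_(i < d) ratr (q i) * v i.

Definition is_minpolyZ (R : realType) (a : R[i]) (P : {poly int}) : Prop :=
  [/\ 0 < lead_coef P, zcontents P = 1, root (map_poly intr P) a &
      forall Q : {poly int}, Q != 0 -> root (map_poly intr Q) a ->
        (size P <= size Q)%N].

(* The junk value 0 is only used when a is transcendental. *)
Definition minpolyZ (R : realType) (a : R[i]) : {poly int} :=
  xget 0 [set P | is_minpolyZ a P].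

Definition croots (R : realType) (P : {poly int}) : seq R[i] :=
  sval (closed_field_poly_normal (map_poly intr P : {poly R[i]})).

Definition height (R : realType) (a : R[i]) : R :=
  let P := minpolyZ a in
  ((lead_coef P)%:~R * \prod_(x <- croots R P) Num.max 1 (Normc.normc x))
    `^ ((size P).-1%:R^-1).

Definition points (R : realType) (n d : nat) (H : R) : set R[i] :=
  [set z | [/\ Normc.normc (z - (n%:R - 2^-1)) <= 2^-1,
               degQ_le (Qadjoin2 z (G z)) d,
               height z <= H & height (G z) <= H]].

(* Main.v *)
Require Import Defs.
From mathcomp Require Import all_boot all_order all_algebra.
From mathcomp Require Import all_classical all_reals all_analysis.
From mathcomp Require Import finmap complex ring lra zify.
Set Implicit Arguments.
Unset Strict Implicit.
Unset Printing Implicit Defensive.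
Import Order.TTheory GRing.Theory Num.Theory.
Import numFieldNormedType.Exports.
Import Normc.
Local Open Scope classical_set_scope.
Local Open Scope ring_scope.

(** The proof is the classical one of transcendence theory: an integer
polynomial [p(z, w)] that is very small along the graph of [G = 1/Gamma] must
vanish at every point counted, and a zero estimate bounds the number of zeros
of [p(z, G(z))].  Complex analysis is replaced by one norm on polynomials,
[l1 r f], the sum of [|f_k| r^k].  Multiplication by [X - a] multiplies it by
at least [|r - |a||], which is only the triangle inequality; this replaces both
the maximum principle and the Schwarz lemma, because dividing a polynomial by
[N] linear factors with small roots divides its norm by [(r - c)^N].

The function [G] is approximated, at any finite set of points, by polynomials
[Q] that are truncated Euler products [X \prod_m (1 + X/m) exp(- a_m X)], with
[exp] replaced by a power of a linear polynomial and
[a_m = ln m - ln (m - 1)].  They vanish at [0, -1, -2, ...], they satisfy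
[l1 r Q <= exp(A r ln r)], and multiplication by [Q] cannot shrink the norm by
more than the same factor when [r] is a half-integer
([G_polynomial_approximation]).  All constants are uniform in [Q], so every
estimate passes to [G].

Zero estimate.  Write [p(X, Q) = P_0 + Q F'].  As [Q] vanishes at [- m], the
values [P_0(- m)] are values of [p(X, Q)], so Lagrange interpolation bounds [P_0] by
[p(X, Q)]; then [Q F'], hence [F'], is bounded too, and one iterates over the
powers of [Q].  Thus [p(X, Q)] is not much smaller than the coefficients of [p]
([coef_lower_bound]), whereas [N] zeros in a disc make it smaller by a factor
[2^N] ([schwarz_lemma]).  With degrees less than [T1] in [z] and [T2] in [w], this
gives [N <= 4000 T1 T2 ln T1] ([zero_estimate]).

Construction.  By the pigeonhole principle some non-zero [p] with coefficients
at most [B] makes the first [S] Taylor coefficients of [p(X, Q)] tiny, and the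
rest is tiny on the disc [|z| <= n] because the norm is taken on a much larger
radius [rho] ([small_polynomial]).  The Liouville inequality ([liouville])
says that [p(z, G(z))] is zero or at least [(L H^(T1 + T2))^(- d)], with
[L = T1 T2 B].  It is proved
with the matrices of multiplication by [z] and [w] on [Q(z, w)]: their joint
eigenvalues are the conjugate pairs, the determinant of [p] of these matrices is
a non-zero rational number, and multiplied by the right powers of the leading
coefficients it is an algebraic integer.

With [X = d ln H], the choice [rho = 4 n sqrt X], [T1 = n T2],
[T2 ~ d X ln n / ln (4 sqrt X)] makes the two bounds contradictory unless
[p(z, G(z)) = 0] at all points ([parameter_choice], [auxiliary_vanishing]),
and the zero estimate then gives the theorem. *)

(** * Absolute value on complex numbers and the weighted l1 norm of polynomials *)

Section AbsoluteValue.
Local Open Scope complex_scope.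
Variable R : rcfType.
Implicit Types (x y z : R[i]).

Lemma normc_ge0 x : 0 <= normc x. Proof. by case: x => a b; rewrite sqrtr_ge0. Qed.
Lemma normcD x y : normc (x + y) <= normc x + normc y.
Proof. exact: ler_normD (x : Rcomplex R) y. Qed.
Lemma normcN x : normc (- x) = normc x.
Proof. exact: normrN (x : Rcomplex R). Qed.
Lemma normcB x y : normc (x - y) = normc (y - x).
Proof. by rewrite -normcN opprB. Qed.
Lemma normc_sum (I : Type) (s : seq I) (P : pred I) (F : I -> R[i]) :
  normc (\sum_(i <- s | P i) F i) <= \sum_(i <- s | P i) normc (F i).
Proof. exact: (ler_norm_sum s (F : I -> Rcomplex R) P). Qed.
Lemma normc_prod (I : Type) (s : seq I) (P : pred I) (F : I -> R[i]) :
  normc (\prod_(i <- s | P i) F i) = \prod_(i <- s | P i) normc (F i).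
Proof. exact: (big_morph _ (@normcM R) (normc1 R)). Qed.
Lemma normcX x n : normc (x ^+ n) = normc x ^+ n.
Proof. by elim: n => [|n IH]; rewrite ?expr0 ?normc1 // !exprS normcM IH. Qed.
Lemma normc_real (a : R) : normc a%:C = `|a|.
Proof. by rewrite /= expr0n addr0 sqrtr_sqr. Qed.
Lemma normc_nat n : normc (n%:R : R[i]) = n%:R.
Proof. by rewrite -(rmorph_nat (real_complex R)) normc_real ger0_norm ?ler0n. Qed.
Lemma normc_int (m : int) : normc (m%:~R : R[i]) = `|m|%:~R.
Proof. by rewrite -(rmorph_int (real_complex R)) normc_real intr_norm. Qed.
Lemma normc_dist x y : normc x - normc y <= normc (x - y).
Proof. by rewrite lerBlDr -{1}(subrK y x) normcD. Qed.
Lemma normc_Re x : `|complex.Re x| <= normc x.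
Proof. by case: x => a b /=; rewrite -sqrtr_sqr ler_wsqrtr // lerDl sqr_ge0. Qed.
Lemma normc_Im x : `|complex.Im x| <= normc x.
Proof. by case: x => a b /=; rewrite -sqrtr_sqr ler_wsqrtr // lerDr sqr_ge0. Qed.
Lemma normc_le_ReIm x : normc x <= `|complex.Re x| + `|complex.Im x|.
Proof.
rewrite [X in normc X]complexE (le_trans (normcD _ _)) // normcM !normc_real.
by rewrite /= expr0n expr1n add0r sqrtr1 mul1r.
Qed.
Lemma normc_eq0 x : (normc x == 0) = (x == 0).
Proof. by apply/eqP/eqP => [/eq0_normc //|->]; rewrite normc0. Qed.
Lemma normc_gt0 x : (0 < normc x) = (x != 0).
Proof. by rewrite lt_def normc_ge0 andbT normc_eq0. Qed.
Lemma normc_exprB (a b : R[i]) (M : R) n : normc a <= M -> normc b <= M -> 1 <= M ->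
  normc (a ^+ n - b ^+ n) <= n%:R * normc (a - b) * M ^+ n.
Proof.
move=> aM bM M1; elim: n => [|n IH]; first by rewrite !expr0 subrr normc0 !mul0r.
have -> : a ^+ n.+1 - b ^+ n.+1 = a * (a ^+ n - b ^+ n) + (a - b) * b ^+ n by rewrite !exprS; ring.
have M0 : 0 <= M by rewrite (le_trans ler01).
rewrite (le_trans (normcD _ _)) // !normcM -natr1 !mulrDl mul1r exprS.
apply: lerD.
  by rewrite [leRHS]mulrCA ler_pM ?normc_ge0.
rewrite ler_wpM2l ?normc_ge0 // normcX (le_trans (_ : _ <= M ^+ n)) //.
  by rewrite lerXn2r ?nnegrE ?normc_ge0.
by rewrite -exprS ler_weXn2l.
Qed.

End AbsoluteValue.

Section L1norm.
Local Open Scope complex_scope.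
Variable R : rcfType.
Implicit Types (p q f g : {poly R[i]}) (r : R) (z a : R[i]).

(** For a power series this is the norm of the Banach algebra of functions on the
closed disc of radius [r] whose Taylor series converges absolutely there: it is
submultiplicative and bounds the sup norm on the disc. *)
Definition l1 r p : R := \sum_(k < size p) normc p`_k * r ^+ k.

Lemma l1_wide r n p : (size p <= n)%N -> l1 r p = \sum_(k < n) normc p`_k * r ^+ k.
Proof.
move=> le_pn; rewrite /l1 (big_ord_widen _ (fun k => normc p`_k * r ^+ k) le_pn).
rewrite big_mkcond /=; apply: eq_bigr => k _; case: ltnP => // h.
by rewrite nth_default // normc0 mul0r.
Qed.

Lemma l1_ge0 r p : 0 <= r -> 0 <= l1 r p.
Proof. by move=> r0; apply: sumr_ge0 => k _; rewrite mulr_ge0 ?normc_ge0 ?exprn_ge0. Qed.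

Lemma l1_coef r p k : 0 <= r -> normc p`_k * r ^+ k <= l1 r p.
Proof.
move=> r0; have [h|h] := ltnP k (size p); last first.
  by rewrite nth_default // normc0 mul0r l1_ge0.
rewrite /l1 (bigD1 (Ordinal h)) //= lerDl.
by apply: sumr_ge0 => i _; rewrite mulr_ge0 ?normc_ge0 ?exprn_ge0.
Qed.

Lemma l1_0 r : l1 r 0 = 0. Proof. by rewrite /l1 size_poly0 big_ord0. Qed.

Lemma l1D r p q : 0 <= r -> l1 r (p + q) <= l1 r p + l1 r q.
Proof.
move=> r0; pose n := maxn (size p) (size q).
rewrite !(@l1_wide r n) ?leq_maxl ?leq_maxr ?size_polyD //.
rewrite -big_split /=; apply: ler_sum => k _.
by rewrite coefD -mulrDl ler_wpM2r ?exprn_ge0 ?normcD.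
Qed.

Lemma l1N r p : l1 r (- p) = l1 r p.
Proof. by rewrite /l1 size_polyN; apply: eq_bigr => k _; rewrite coefN normcN. Qed.

Lemma l1B r p q : 0 <= r -> l1 r (p - q) <= l1 r p + l1 r q.
Proof. by move=> r0; rewrite -(l1N r q); exact: l1D. Qed.

Lemma l1_sum r (I : Type) (s : seq I) (P : pred I) (F : I -> {poly R[i]}) : 0 <= r ->
  l1 r (\sum_(i <- s | P i) F i) <= \sum_(i <- s | P i) l1 r (F i).
Proof.
move=> r0; apply: (big_ind2 (fun x y => l1 r x <= y)) => //; first by rewrite l1_0.
by move=> x1 x2 y1 y2 h1 h2; apply: le_trans (l1D _ _ r0) _; apply: lerD.
Qed.

Lemma l1Z r c p : l1 r (c *: p) = normc c * l1 r p.
Proof.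
rewrite (@l1_wide r (size p)) ?size_scale_leq // mulr_sumr.
by apply: eq_bigr => k _; rewrite coefZ normcM mulrA.
Qed.

Lemma l1_mulX r p : l1 r ('X * p) = r * l1 r p.
Proof.
rewrite -commr_polyX (@l1_wide r (size p).+1); last first.
  by rewrite -['X]addr0 -[0]oppr0 -polyC0 (leq_trans (size_polyMleq _ _)) // size_XsubC addn2.
rewrite big_ord_recl coefMX eqxx normc0 mul0r add0r mulr_sumr.
by apply: eq_bigr => k _; rewrite coefMX /= exprS mulrCA.
Qed.

Lemma l1C r c : l1 r c%:P = normc c.
Proof.
rewrite (@l1_wide r 1) ?size_polyC_leq1 // big_ord_recl big_ord0 addr0.
by rewrite expr0 mulr1 coefC.
Qed.

Lemma l1_1 r : l1 r 1 = 1. Proof. by rewrite -polyC1 l1C normc1. Qed.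
Lemma l1X r : l1 r 'X = r. Proof. by rewrite -[X in l1 r X]mulr1 l1_mulX l1_1 mulr1. Qed.

Lemma l1M r p q : 0 <= r -> l1 r (p * q) <= l1 r p * l1 r q.
Proof.
move=> r0; elim/poly_ind: p => [|p c IH]; first by rewrite mul0r l1_0 mul0r.
have -> : l1 r (p * 'X + c%:P) = r * l1 r p + normc c.
  have [->|p0] := eqVneq p 0; first by rewrite mul0r add0r l1_0 mulr0 add0r l1C.
  rewrite (@l1_wide r (size p).+1); last first.
    by rewrite -cons_poly_def size_cons_poly; case: ifP.
  rewrite -cons_poly_def big_ord_recl coef_cons /= expr0 mulr1 addrC; congr (_ + _).
  by rewrite mulr_sumr; apply: eq_bigr => k _; rewrite coef_cons /= exprS mulrCA.
have -> : (p * 'X + c%:P) * q = 'X * (p * q) + c *: q.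
  by rewrite mulrDl mul_polyC [p * 'X]mulrC mulrA.
rewrite mulrDl -mulrA; apply: le_trans (l1D _ _ r0) _.
by rewrite l1_mulX l1Z lerD // ler_wpM2l.
Qed.

Lemma l1_exp r p n : 0 <= r -> l1 r (p ^+ n) <= l1 r p ^+ n.
Proof.
move=> r0; elim: n => [|n IH]; first by rewrite !expr0 l1_1.
by rewrite !exprS (le_trans (l1M _ _ r0)) // ler_wpM2l // l1_ge0.
Qed.

Lemma l1_prod r (I : Type) (s : seq I) (P : pred I) (F : I -> {poly R[i]}) : 0 <= r ->
  l1 r (\prod_(i <- s | P i) F i) <= \prod_(i <- s | P i) l1 r (F i).
Proof.
move=> r0; suff /andP[] : 0 <= l1 r (\prod_(i <- s | P i) F i) <= \prod_(i <- s | P i) l1 r (F i) by [].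
apply: (big_ind2 (fun x y => 0 <= l1 r x <= y)) => //; first by rewrite l1_1 ler01 lexx.
  move=> x1 x2 y1 y2 /andP[h0 h1] /andP[h2 h3].
  by rewrite l1_ge0 //= (le_trans (l1M _ _ r0)) // ler_pM.
by move=> i _; rewrite l1_ge0 //= lexx.
Qed.

Lemma l1_mono r s p : 0 <= r -> r <= s -> l1 r p <= l1 s p.
Proof.
move=> r0 rs; apply: ler_sum => k _; rewrite ler_wpM2l ?normc_ge0 //.
by rewrite lerXn2r ?nnegrE // (le_trans r0).
Qed.

Lemma normc_horner r p z : normc z <= r -> normc p.[z] <= l1 r p.
Proof.
move=> zr; rewrite horner_coef (le_trans (normc_sum _ _ _)) //.
apply: ler_sum => k _; rewrite normcM normcX ler_wpM2l ?normc_ge0 //.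
by rewrite lerXn2r ?nnegrE ?normc_ge0 // (le_trans _ zr) ?normc_ge0.
Qed.

Lemma l1_XsubC r a : 0 <= r -> l1 r ('X - a%:P) <= r + normc a.
Proof. by move=> r0; rewrite (le_trans (l1B _ _ r0)) // l1X l1C. Qed.

Lemma l1_dist r p q : 0 <= r -> l1 r p - l1 r q <= l1 r (p + q).
Proof. by move=> r0; rewrite lerBlDr -{1}(addrK q p) l1B. Qed.

(** The triangle inequality for [X f - a f], since [l1 r (X f) = r l1 r f].  This
is the substitute for the maximum principle applied to [f = F / (X - a)]:
it holds for a root inside the disc as well as for one outside. *)
Lemma l1_XsubC_mul r a f : 0 <= r -> `|r - normc a| * l1 r f <= l1 r (('X - a%:P) * f).
Proof.
move=> r0; rewrite mulrBl mul_polyC; have h1 := l1_dist ('X * f) (- (a *: f)) r0.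
have h2 := l1_dist (- (a *: f)) ('X * f) r0.
rewrite [- _ + _]addrC in h2; rewrite !l1N !l1Z !l1_mulX -!mulrBl in h1 h2.
by case: (ger0P (r - normc a)) => _; rewrite ?opprB.
Qed.

(** Factors close to [1] are almost isometric; in a long product only finitely many
factors need a cruder bound. *)
Lemma l1_near1_mul r u e f : 0 <= r -> l1 r (u - 1) <= e -> (1 - e) * l1 r f <= l1 r (u * f).
Proof.
move=> r0 ue; have -> : u * f = f + (u - 1) * f by rewrite mulrBl mul1r addrCA subrr addr0.
rewrite (le_trans _ (l1_dist _ _ r0)) // mulrBl mul1r lerD2l lerN2.
by rewrite (le_trans (l1M _ _ r0)) // ler_wpM2r // l1_ge0.
Qed.

Lemma l1_prod_XsubC_mul r (s : seq R[i]) f c : 0 <= r -> 0 <= c ->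
  (forall z, z \in s -> normc z <= c) -> c <= r ->
  (r - c) ^+ size s * l1 r f <= l1 r ((\prod_(z <- s) ('X - z%:P)) * f).
Proof.
move=> r0 c0 sc cr; elim: s sc f => [|z s IH] sc f; first by rewrite big_nil expr0 !mul1r.
rewrite big_cons -mulrA [size _]/= exprS -mulrA.
have zc := sc z (mem_head _ _).
apply: le_trans (l1_XsubC_mul _ _ r0).
rewrite ler_pM ?subr_ge0 //.
- by rewrite mulr_ge0 ?exprn_ge0 ?subr_ge0 // l1_ge0.
- by rewrite ger0_norm ?lerD2l ?lerN2 // subr_ge0 (le_trans zc).
- by apply: IH => y ys; rewrite sc // in_cons ys orbT.
Qed.

Lemma l1_prod_XsubC r (s : seq R[i]) c : 0 <= r ->
  (forall z, z \in s -> normc z <= c) ->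
  l1 r (\prod_(z <- s) ('X - z%:P)) <= (r + c) ^+ size s.
Proof.
move=> r0 sc; apply: le_trans (l1_prod _ _ _ r0) _.
elim: s sc => [|z s IH] sc; first by rewrite big_nil.
rewrite big_cons exprS ler_pM ?l1_ge0 ?prodr_ge0 //.
- by move=> i _; exact: l1_ge0.
- by rewrite (le_trans (l1_XsubC _ r0)) // lerD2l sc ?mem_head.
- by apply: IH => y ys; rewrite sc // in_cons ys orbT.
Qed.

Definition lagrange_interp (s : seq R[i]) (v : R[i] -> R[i]) : {poly R[i]} :=
  \sum_(x <- s) v x *: \prod_(y <- rem x s) ((x - y)^-1 *: ('X - y%:P)).

Lemma horner_lagrange_interp s v x : uniq s -> x \in s -> (lagrange_interp s v).[x] = v x.
Proof.
move=> us xs; rewrite /lagrange_interp horner_sum (bigD1_seq x) //= [X in _ + X]big1_seq.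
  rewrite addr0 hornerZ horner_prod big1_seq ?mulr1 // => y /andP[_].
  by rewrite mem_rem_uniq // !inE => /andP[yx _]; rewrite !hornerE mulVf // subr_eq0 eq_sym.
move=> t /andP[tx ts]; rewrite hornerZ horner_prod (big_rem x) /=.
  by rewrite hornerZ hornerXsubC subrr mulr0 mul0r mulr0.
by rewrite mem_rem_uniq // !inE eq_sym tx.
Qed.

Lemma size_lagrange_interp s v : (size (lagrange_interp s v) <= size s)%N.
Proof.
rewrite /lagrange_interp big_seq; elim/big_ind: _ => [|p q hp hq|x xs]; first by rewrite size_poly0.
  by rewrite (leq_trans (size_polyD _ _)) // geq_max hp.
rewrite (leq_trans (size_scale_leq _ _)) //.
have s0 : (0 < size s)%N by case: s xs.
rewrite -[leqRHS](prednK s0) -(size_rem xs); move: (rem x s) => t.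
elim: t => [|y t IH]; first by rewrite big_nil size_poly1.
rewrite big_cons (leq_trans (size_polyMleq _ _)) // -subn1 leq_subLR add1n.
apply: (@leq_add _ _ 2 (size t).+1) => //.
by rewrite (leq_trans (size_scale_leq _ _)) // size_XsubC.
Qed.

(** Two polynomials of size at most [n] that agree at [n] points are equal. *)
Lemma lagrange_interpE s p : uniq s -> (size p <= size s)%N -> p = lagrange_interp s (fun x => p.[x]).
Proof.
move=> us ps; apply/eqP; rewrite -subr_eq0; apply/eqP.
apply: (@roots_geq_poly_eq0 _ _ s) => //.
  by apply/allP => x xs; rewrite rootE hornerD hornerN horner_lagrange_interp // subrr.
by rewrite (leq_trans (size_polyD _ _)) // geq_max ps size_polyN size_lagrange_interp.
Qed.

Lemma l1_lagrange_interp r s v : 0 <= r ->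
  l1 r (lagrange_interp s v) <= \sum_(x <- s) normc (v x) *
     \prod_(y <- rem x s) (normc (x - y)^-1 * (r + normc y)).
Proof.
move=> r0; apply: le_trans (l1_sum _ _ _ r0) _; apply: ler_sum => x _.
rewrite l1Z ler_wpM2l ?normc_ge0 //; apply: le_trans (l1_prod _ _ _ r0) _.
apply: ler_prod => y _; rewrite l1_ge0 //= l1Z ler_wpM2l ?normc_ge0 //.
exact: l1_XsubC.
Qed.

End L1norm.

(** * Algebraic integers from roots of an integer polynomial *)

(** The value at [(x, y)] of the integer polynomial with coefficients [p i j],
of degree less than [T1] in [x] and [T2] in [y].  The ring is arbitrary because
[x] and [y] will be complex numbers, polynomials and matrices. *)
Definition bieval (K : pzRingType) (T1 T2 : nat) (p : nat -> nat -> int) (x y : K) : K :=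
  \sum_(i < T1) \sum_(j < T2) (x ^+ i * y ^+ j) *~ p i j.

Lemma rmorph_bieval (K L : pzRingType) (f : {rmorphism K -> L}) T1 T2 p x y :
  f (bieval T1 T2 p x y) = bieval T1 T2 p (f x) (f y).
Proof.
rewrite rmorph_sum; apply: eq_bigr => i _; rewrite rmorph_sum; apply: eq_bigr => j _.
by rewrite rmorphMz rmorphM !rmorphXn.
Qed.

Section IntegralRoots.
Local Open Scope complex_scope.
Variable C : fieldType.
Let algint := integralOver (intr : int -> C).
Implicit Types (f g : {poly C}) (a z : C).

Lemma algint_sum (I : Type) (s : seq I) (P : pred I) (F : I -> C) :
  (forall i, P i -> algint (F i)) -> algint (\sum_(i <- s | P i) F i).
Proof.
move=> FI; apply: (big_ind algint) => //; [exact: mxpoly.integral0|exact: integral_add].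
Qed.

Lemma algint_prod (I : Type) (s : seq I) (P : pred I) (F : I -> C) :
  (forall i, P i -> algint (F i)) -> algint (\prod_(i <- s | P i) F i).
Proof.
move=> FI; apply: (big_ind algint) => //; [exact: mxpoly.integral1|exact: integral_mul].
Qed.

Lemma algint_exp a n : algint a -> algint (a ^+ n).
Proof.
move=> aI; rewrite -(card_ord n) -prodr_const; apply: algint_prod => i _; exact: aI.
Qed.

Lemma algint_int (m : int) : algint m%:~R. Proof. exact: integral_id. Qed.

(** Kronecker's argument.  If [a] is the leading coefficient of [f], then [a z] is
a root of a monic polynomial with integral coefficients, so that subtracting
[a X^m (X - z)] from [f] lowers the degree of [g] and keeps the coefficients integral. *)
Lemma algint_coef_XsubC_div f g z : f = g * ('X - z%:P) ->
  (forall k, algint f`_k) -> forall k, algint g`_k.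
Proof.
have [m] := ubnP (size g); elim: m => // m IH in f g *; rewrite ltnS => sg fE fI.
have fmE k : f`_k.+1 = g`_k - z * g`_k.+1.
  by rewrite fE mulrBr coefB coefMX mulrC mul_polyC coefZ mulrC.
have [sm|sm] := ltnP (size g) m; first exact: IH sm fE fI.
case: m => [|m] in IH sg sm *.
  by move: sg; rewrite leqn0 size_poly_eq0 => /eqP -> k; rewrite coef0; exact: mxpoly.integral0.
pose a := g`_m.
have g0 k : (m < k)%N -> g`_k = 0 by move=> mk; rewrite nth_default // (leq_trans sg).
have f0 k : (m.+1 < k)%N -> f`_k = 0 by case: k => // k mk; rewrite fmE !g0 ?mulr0 ?subr0 // ltnW.
have aE : a = f`_m.+1 by rewrite fmE (g0 m.+1) // mulr0 subr0.
have sf : (size f <= m.+2)%N by apply/leq_sizeP => j; exact: f0.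
have azI : algint (a * z).
  (* [h] is monic and [h.[a * z] = a ^+ m * f.[z]]. *)
  pose h : {poly C} := 'X^(m.+1) + \poly_(k < m.+1) (f`_k * a ^+ (m - k)).
  have hI k : algint h`_k.
    rewrite coefD coefXn coef_poly; apply: integral_add; first exact: integral_nat.
    case: ltnP => _; last exact: mxpoly.integral0.
    apply: integral_mul; first exact: fI. apply: (@algint_exp a). by rewrite aE; exact: fI.
  have hm : h \is monic.
    rewrite monicE lead_coefDl ?lead_coefXn // size_polyXn ltnS; exact: size_poly.
  apply: (@integral_root_monic _ _ intr (a * z) h) => //; last exact/integral_poly.
  have fz : f.[z] = 0 by rewrite fE hornerM hornerXsubC subrr mulr0.
  rewrite rootE; apply/eqP; rewrite hornerD hornerXn horner_poly.
  transitivity (a ^+ m * f.[z]); last by rewrite fz mulr0.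
  rewrite (horner_coef_wide _ sf) [in RHS]big_ord_recr /= -aE mulrDr addrC; congr (_ + _).
    rewrite mulr_sumr; apply: eq_bigr => k _; rewrite exprMn [RHS]mulrCA -!mulrA; congr (_ * _).
    by rewrite mulrA -exprD subnK // -ltnS.
  by rewrite exprMn exprSr mulrA.
pose g' := g - a *: 'X^m.
have g'E k : g'`_k = g`_k - a * (k == m)%:R by rewrite coefB coefZ coefXn.
have sg' : (size g' <= m)%N.
  apply/leq_sizeP => j; rewrite leq_eqVlt g'E => /predU1P[<-|mj]; first by rewrite eqxx mulr1 subrr.
  by rewrite g0 // gtn_eqF // mulr0 subr0.
have g'I : forall k, algint g'`_k.
  apply: (IH (g' * ('X - z%:P)) g') => // k.
  have -> : g' * ('X - z%:P) = f - a *: 'X^(m.+1) + (a * z) *: 'X^m.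
    rewrite /g' mulrBl -fE -scalerAl mulrBr -exprSr ['X^m * _]mulrC mul_polyC.
    by rewrite scalerBr scalerA opprB addrA addrAC.
  rewrite coefD coefB !coefZ !coefXn.
  apply: integral_add; first apply: integral_sub; first exact: fI.
    by apply: integral_mul; [rewrite aE; exact: fI|exact: integral_nat].
  by apply: integral_mul; [exact: azI|exact: integral_nat].
move=> k; have -> : g`_k = g'`_k + a * (k == m)%:R by rewrite g'E subrK.
apply: integral_add; first exact: g'I.
by apply: integral_mul; [rewrite aE; exact: fI|exact: integral_nat].
Qed.

(** Divide the polynomial by the factors whose index is not in [A]: the constant
coefficient of what remains is the product up to sign. *)
Lemma algint_subprod (c : C) (n : nat) (z : 'I_n -> C) (A : pred 'I_n) :
  (forall k, algint (c *: \prod_(i < n) ('X - (z i)%:P))`_k) ->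
  algint (c * \prod_(i | A i) z i).
Proof.
move=> fI.
have subI (s t : seq C) : (forall k, algint (c *: \prod_(x <- s ++ t) ('X - x%:P))`_k) ->
    forall k, algint (c *: \prod_(x <- s) ('X - x%:P))`_k.
  elim: t s => [|x t IH] s; first by rewrite cats0.
  rewrite -cat_rcons => /IH /algint_coef_XsubC_div; apply.
  by rewrite -cats1 big_cat /= big_seq1 scalerAl.
pose s := [seq z i | i <- [seq i <- enum 'I_n | A i]].
pose t := [seq z i | i <- [seq i <- enum 'I_n | ~~ A i]].
have := subI s t.
have -> : \prod_(x <- s ++ t) ('X - x%:P) = \prod_(i < n) ('X - (z i)%:P).
  by rewrite big_cat /= !big_map !big_filter !big_enum_cond /= [RHS](bigID A).
move=> /(_ fI 0%N) /(integral_mul (algint_int ((-1) ^+ size s))).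
congr (algint _); rewrite coefZ mulrCA; congr (_ * _).
rewrite -horner_coef0 horner_prod /= big_map big_filter big_enum_cond /=.
rewrite (eq_bigr (fun i => (-1) * z i)) => [|i _]; last by rewrite hornerXsubC sub0r mulN1r.
rewrite big_split /= prodr_const mulrA rmorphXn /= rmorphN1.
suff -> : size s = #|A| by rewrite -exprD addnn -mul2n exprM sqrrN expr1n expr1n mul1r.
by rewrite size_map size_filter enumT cardE [in RHS]/enum_mem size_filter.
Qed.

(** Expand the product.  A term contains the monomial [\prod_i z_i ^ e_i] with all
[e_i < T1], and [a ^ T1] times this monomial is the product over [t < T1] of [a] times
the product of the [z_i] with [t < e_i].  Only [a ^ T1] is needed, and not one power
per conjugate; this is what keeps the Liouville exponent linear in the degree. *)
Lemma algint_prod_bieval (n T1 T2 : nat) (p : nat -> nat -> int) (a b : C) (z w : 'I_n -> C) :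
  (forall k, algint (a *: \prod_(i < n) ('X - (z i)%:P))`_k) ->
  (forall k, algint (b *: \prod_(i < n) ('X - (w i)%:P))`_k) ->
  algint (a ^+ T1 * b ^+ T2 * \prod_(i < n) bieval T1 T2 p (z i) (w i)).
Proof.
move=> zI wI.
have monI (c : C) (x : 'I_n -> C) T (e : 'I_n -> 'I_T) :
    (forall k, algint (c *: \prod_(i < n) ('X - (x i)%:P))`_k) ->
    algint (c ^+ T * \prod_i x i ^+ e i).
  move=> xI; suff -> : c ^+ T * \prod_i x i ^+ e i =
      \prod_(t < T) (c * \prod_(i | (t < e i)%N) x i).
    by apply: algint_prod => t _; exact: algint_subprod.
  rewrite big_split /= prodr_const card_ord; congr (_ * _).
  under [RHS]eq_bigr do rewrite big_mkcond.
  rewrite exchange_big /=; apply: eq_bigr => i _; rewrite -big_mkcond /=.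
  rewrite prodr_const; congr (_ ^+ _).
  transitivity #|'I_(e i)|; first by rewrite card_ord.
  have le : (e i <= T)%N by exact: ltnW.
  have injw : injective (widen_ord le) by move=> u v /(congr1 val) /= /val_inj.
  rewrite -(fintype.card_image injw).
  apply: fintype.eq_card => t; apply/idP/idP => [/fintype.imageP[j _ ->]|]; rewrite unfold_in /=.
    exact: ltn_ord.
  by move=> h; apply/fintype.imageP; exists (Ordinal h) => //; apply: val_inj.
under eq_bigr do rewrite /bieval pair_bigA /=.
rewrite bigA_distr_bigA /= mulr_sumr; apply: algint_sum => phi _.
have -> : a ^+ T1 * b ^+ T2 * \prod_i (z i ^+ (phi i).1 * w i ^+ (phi i).2 *~ p (phi i).1 (phi i).2) =
  (a ^+ T1 * \prod_i z i ^+ (phi i).1) * (b ^+ T2 * \prod_i w i ^+ (phi i).2) *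
  \prod_i (p (phi i).1 (phi i).2)%:~R.
  rewrite [X in _ = X * _]mulrACA -[RHS]mulrA; congr (_ * _).
  under eq_bigr do rewrite -mulrzr.
  by rewrite !big_split.
apply: integral_mul; last by apply: algint_prod => i _; exact: algint_int.
apply: integral_mul; first exact: (monI a z T1 (fun i => (phi i).1) zI).
exact: (monI b w T2 (fun i => (phi i).2) wI).
Qed.
End IntegralRoots.

(** * Joint eigenvalues of two commuting matrices *)

Section Triangular.
Local Open Scope complex_scope.
Variables (C : comNzRingType) (n : nat).
Implicit Types (A B : 'M[C]_n) (a b : 'I_n -> C).

(** Triangular with prescribed diagonal: this class is a ring, and evaluation at
the diagonal is a ring morphism on it. *)
Definition trig_diag A a := is_trig_mx A /\ forall i, A i i = a i.

Lemma trig_diagM A B a b : trig_diag A a -> trig_diag B b -> trig_diag (A * B) (fun i => a i * b i).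
Proof.
move=> [/is_trig_mxP tA dA] [/is_trig_mxP tB dB]; split.
  apply/is_trig_mxP => i j ij; rewrite mxE big1 // => k _.
  have [ik|ki] := ltnP i k; first by rewrite tA ?mul0r.
  by rewrite tB ?mulr0 // (leq_ltn_trans ki).
move=> i; rewrite mxE (bigD1 i) //= dA dB big1 ?addr0 // => k ki.
have [ik|{}ki'] := ltnP i k; first by rewrite tA ?mul0r.
by rewrite tB ?mulr0 // ltn_neqAle ki ki'.
Qed.

Lemma trig_diagD A B a b : trig_diag A a -> trig_diag B b -> trig_diag (A + B) (fun i => a i + b i).
Proof.
move=> [/is_trig_mxP tA dA] [/is_trig_mxP tB dB]; split; last by move=> i; rewrite mxE dA dB.
by apply/is_trig_mxP => i j ij; rewrite mxE tA // tB // addr0.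
Qed.

Lemma trig_diag1 : trig_diag 1 (fun _ => 1).
Proof.
split; last by move=> i; rewrite mxE eqxx.
by apply/is_trig_mxP => i j ij; rewrite mxE -val_eqE /= ltn_eqF.
Qed.

Lemma trig_diag0 : trig_diag 0 (fun _ => 0).
Proof. by split=> [|i]; [apply/is_trig_mxP => i j _|]; rewrite mxE. Qed.

Lemma trig_diagX A a k : trig_diag A a -> trig_diag (A ^+ k) (fun i => a i ^+ k).
Proof.
move=> tA; elim: k => [|k IH]; first exact: trig_diag1.
have [t d] := trig_diagM tA IH; rewrite exprS; split=> // i; by rewrite d exprS.
Qed.

Lemma trig_diagMz A a (m : int) : trig_diag A a -> trig_diag (A *~ m) (fun i => a i *~ m).
Proof.
move=> [/is_trig_mxP tA dA].
have E i j : (A *~ m) i j = A i j *~ m.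
  by case: m => k; rewrite ?NegzE ?mulrNz -?pmulrn ?mxE ?mulmxnE.
split=> [|i]; last by rewrite E dA.
by apply/is_trig_mxP => i j ij; rewrite E tA // mul0rz.
Qed.

Lemma trig_diag_bieval A B a b T1 T2 p : trig_diag A a -> trig_diag B b ->
  trig_diag (bieval T1 T2 p A B) (fun i => bieval T1 T2 p (a i) (b i)).
Proof.
move=> tA tB.
have sumT (I : Type) (s : seq I) (F : I -> 'M[C]_n) (f : I -> 'I_n -> C) :
    (forall i, trig_diag (F i) (f i)) ->
    trig_diag (\sum_(i <- s) F i) (fun k => \sum_(i <- s) f i k).
  move=> h; elim: s => [|x s IH].
    have [t d] := trig_diag0; rewrite big_nil; split=> // i; by rewrite big_nil d.
  have [t d] := trig_diagD (h x) IH; rewrite big_cons; split=> // i; by rewrite big_cons d.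
apply: (sumT _ _ _ (fun (i : 'I_T1) k => \sum_(j < T2) (a k ^+ i * b k ^+ j) *~ p i j)) => i.
apply: (sumT _ _ _ (fun (j : 'I_T2) k => (a k ^+ i * b k ^+ j) *~ p i j)) => j.
exact: (trig_diagMz (p i j) (trig_diagM (trig_diagX i tA) (trig_diagX j tB))).
Qed.
End Triangular.

Section Cotrigonalization.
Local Open Scope complex_scope.
Variables (C : numClosedFieldType) (n : nat).

(** Triangularise [A] and [B] simultaneously.  A common eigenvector has a first
non-zero coordinate in the new basis, and this coordinate selects a joint
diagonal entry. *)
Lemma joint_eigenvalues (A B : 'M[C]_n) : A *m B = B *m A ->
  exists a b : 'I_n -> C,
  [/\ char_poly A = \prod_i ('X - (a i)%:P), char_poly B = \prod_i ('X - (b i)%:P),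
      (forall T1 T2 p, \det (bieval T1 T2 p A B) = \prod_i bieval T1 T2 p (a i) (b i)) &
      forall (v : 'cV[C]_n) x y, v != 0 -> A *m v = x *: v -> B *m v = y *: v ->
        exists i, a i = x /\ b i = y].
Proof.
move=> AB; have [P Pu] := cotrigonalization2 AB.
have {}Pu : P \in unitmx by exact: unitarymx_unit.
rewrite /similar_to !conjumx // => /andP[tA tB].
set TA := P *m A *m _ in tA; set TB := P *m B *m _ in tB.
have PA : P *m A = TA *m P by rewrite /TA mulmxKV.
have PB : P *m B = TB *m P by rewrite /TB mulmxKV.
pose a i := TA i i; pose b i := TB i i.
have dP : \det P != 0 by rewrite -unitfE -unitmxE.
have charE M T : P *m M = T *m P -> is_trig_mx T -> char_poly M = \prod_i ('X - (T i i)%:P).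
  move=> PM tT; rewrite -char_poly_trig //.
  have dP' : \det (map_mx polyC P) != 0 by rewrite det_map_mx /= polyC_eq0.
  apply: (mulfI dP'); rewrite [RHS]mulrC /char_poly -!det_mulmx; congr (\det _).
  by rewrite /char_poly_mx mulmxBr mulmxBl -!map_mxM PM scalar_mxC.
have PX M T k : P *m M = T *m P -> P *m (M ^+ k) = T ^+ k *m P.
  move=> PM; elim: k => [|k IH]; first by rewrite !expr0 mulmx1 mul1mx.
  by rewrite !exprS -!mulmxE mulmxA PM -mulmxA IH mulmxA.
exists a, b; split; [exact: charE|exact: charE| |].
  move=> T1 T2 p; have [] := @trig_diag_bieval _ _ TA TB a b T1 T2 p _ _; [by split|by split|].
  move=> t d; have -> : \prod_i bieval T1 T2 p (a i) (b i) = \det (bieval T1 T2 p TA TB).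
    by rewrite det_trig //; apply: eq_bigr => i _; rewrite d.
  apply: (mulfI dP); rewrite [RHS]mulrC -!det_mulmx; congr (\det _).
  rewrite /bieval mulmx_sumr mulmx_suml; apply: eq_bigr => i _.
  rewrite mulmx_sumr mulmx_suml; apply: eq_bigr => j _.
  rewrite -[_ *~ _]scaler_int -[in RHS]scaler_int -scalemxAr -scalemxAl; congr (_ *: _).
  by rewrite -!mulmxE mulmxA (PX _ TA) // -mulmxA (PX _ TB) // mulmxA.
move=> v x y v0 Av Bv; pose u := P *m v.
have u0 : u != 0 by apply: contra v0 => /eqP u0; rewrite -(mulKmx Pu v) -/u u0 mulmx0.
have Au : TA *m u = x *: u by rewrite /u mulmxA -PA -mulmxA Av scalemxAr.
have Bu : TB *m u = y *: u by rewrite /u mulmxA -PB -mulmxA Bv scalemxAr.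
have /existsP[i0 ui0] : [exists i, u i 0 != 0].
  apply: contraR u0; rewrite negb_exists => /forallP h; apply/eqP/matrixP => i j.
  by rewrite ord1 [RHS]mxE; have := h i; rewrite negbK => /eqP.
have [i ui imin] := @arg_minnP _ i0 (fun i => u i 0 != 0) val ui0.
have diag T c : is_trig_mx T -> T *m u = c *: u -> T i i = c.
  move=> /is_trig_mxP tT /matrixP /(_ i 0); rewrite [LHS]mxE [RHS]mxE (bigD1 i) //= big1 ?addr0.
    by move/(mulIf ui).
  move=> k ki; have [ik|{}ki'] := ltnP i k; first by rewrite tT ?mul0r.
  have [->|/imin /= h] := eqVneq (u k 0) 0; first by rewrite mulr0.
  by case/eqP: ki; apply/val_inj/eqP; rewrite eqn_leq ki'.
by exists i; split; exact: diag.
Qed.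
End Cotrigonalization.

(** * The field Q(z, w) and minimal polynomials *)

Section Liouville.
Local Open Scope complex_scope.
Variable R : realType.
Notation C := R[i].
Notation ratC := (@ratr C).
Implicit Types (z w : C) (P : {poly int}) (q : {poly rat}).

Lemma Qadjoin2_closed z w x y : Qadjoin2 z w x -> Qadjoin2 z w y ->
  Qadjoin2 z w (x * y).
Proof.
move=> Kx Ky S cS zS wS; have [S1 SB SV] := cS.
by rewrite -[y]invrK SV // ?Kx // -[y^-1]div1r SV // Ky.
Qed.

Lemma Qadjoin2_1 z w : Qadjoin2 z w 1. Proof. by move=> S [S1 _ _]. Qed.

(** A generating family of minimal length is a basis; [A] and [B] are the matrices
of multiplication by [z] and [w] in this basis [v]. *)
Lemma Qadjoin2_mult_matrices z w d : degQ_le (Qadjoin2 z w) d ->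
  exists m (A B : 'M[rat]_m.+1) (v : 'cV[C]_m.+1),
  [/\ (m < d)%N, map_mx ratC A *m v = z *: v, map_mx ratC B *m v = w *: v &
      forall u : 'rV[rat]_m.+1, map_mx ratC u *m v = 0 -> u = 0].
Proof.
set K := Qadjoin2 z w => Kd.
have exK : exists m, `[< degQ_le K m >] by exists d; apply/asboolP.
case: (ex_minnP exK) => m /asboolP[v vK gen] mmin {exK}.
have md : (m <= d)%N by apply: mmin; apply/asboolP.
case: m => [|m] in v vK gen mmin md *.
  have [q] := gen _ (@Qadjoin2_1 z w).
  by rewrite big_ord0 => /eqP; rewrite oner_eq0.
have free (u : 'I_m.+1 -> rat) : \sum_i ratC (u i) * v i = 0 -> forall i, u i = 0.
  move=> u0 i0; apply/eqP; apply: contraT => ui0.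
  suff : (m.+1 <= m)%N by rewrite ltnn.
  apply: mmin; apply/asboolP; exists (fun j => v (lift i0 j)) => [j|x Kx]; first exact: vK.
  have [q xE] := gen x Kx.
  exists (fun j => q (lift i0 j) - q i0 / u i0 * u (lift i0 j)).
  have /eqP := u0; rewrite (bigD1_ord i0) //= addr_eq0 => /eqP u0'.
  rewrite xE (bigD1_ord i0) //=.
  have -> : ratC (q i0) * v i0 = ratC (q i0 / u i0) * (ratC (u i0) * v i0).
    by rewrite mulrA -rmorphM divfK.
  rewrite u0' mulrN mulr_sumr addrC -sumrB.
  by apply: eq_bigr => j _; rewrite mulrA -rmorphM -mulrBl -rmorphB.
have zK : K z by move=> S _ zS _.
have wK : K w by move=> S _ _ wS.
have mat x : K x -> exists A : 'M[rat]_m.+1, map_mx ratC A *m \col_i v i = x *: \col_i v i.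
  move=> Kx; have [f fE] := choice (fun i => gen _ (Qadjoin2_closed Kx (vK i))).
  exists (\matrix_(i, j) f i j); apply/matrixP => i j.
  by rewrite !mxE fE; apply: eq_bigr => k _; rewrite !mxE.
have [A Av] := mat _ zK; have [B Bv] := mat _ wK.
exists m, A, B, (\col_i v i); split=> // u /matrixP /(_ 0 0).
rewrite [LHS]mxE [RHS]mxE => u0; apply/rowP => i; rewrite [RHS]mxE; apply: free i.
by rewrite -[RHS]u0; apply: eq_bigr => k _; rewrite !mxE.
Qed.

Lemma map_ratr_intr P : map_poly ratC (map_poly intr P) = map_poly intr P.
Proof. by rewrite -map_poly_comp; apply: eq_map_poly => x /=; rewrite ratr_int. Qed.

Lemma ratr_root_int z q : q != 0 -> root (map_poly ratC q) z ->
  exists2 P : {poly int}, size P = size q & P != 0 /\ root (map_poly intr P) z.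
Proof.
move=> q0 qz; have [P [a a0 qE]] := rat_poly_scale q; exists P.
  by rewrite qE size_scale ?size_rat_int_poly // invr_eq0 intr_eq0.
split; first by apply: contra q0 => /eqP P0; rewrite qE P0 map_poly0 scaler0.
move: qz; rewrite qE map_polyZ /= map_ratr_intr rootZ //.
by rewrite fmorph_eq0 invr_eq0 intr_eq0.
Qed.

(** A non-zero integer polynomial of minimal size with root [z], divided by its content. *)
Lemma is_minpolyZ_minpolyZ z q : q != 0 -> root (map_poly ratC q) z ->
  is_minpolyZ z (minpolyZ z).
Proof.
move=> q0 qz; suff [P mP] : exists P, is_minpolyZ z P by rewrite /minpolyZ; apply: (xgetPex 0); exists P.
have ex : exists k, `[< exists P : {poly int}, [/\ size P = k, P != 0 & root (map_poly intr P) z] >].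
  have [P _ [P0 Pz]] := ratr_root_int q0 qz; exists (size P); apply/asboolP; by exists P.
case: (ex_minnP ex) => k /asboolP[P [sP P0 Pz]] kmin {ex}.
have zc0 : zcontents P != 0 by rewrite zcontents_eq0.
have zP0 : zprimitive P != 0 by rewrite zprimitive_eq0.
have zc1 : zcontents (zprimitive P) = 1 by rewrite zcontents_primitive P0.
exists (zprimitive P); split => //.
- by rewrite -sgz_gt0 -sgz_contents zc1.
- move: Pz; rewrite {1}(zpolyEprim P) map_polyZ /= rootZ // intr_eq0 //.
- move=> Q Q0 Qz; rewrite size_zprimitive sP; apply: kmin; apply/asboolP; by exists Q.
Qed.

Lemma minpolyZ_irreducible z P : is_minpolyZ z P ->
  irreducible_poly (map_poly intr P : {poly rat}).
Proof.
move=> [lP _ Pz Pmin]; have P0 : P != 0 by rewrite -lead_coef_eq0 gt_eqF.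
split.
  rewrite size_rat_int_poly ltnNge; apply/negP => /size1_polyC PE.
  move: Pz P0; rewrite PE map_polyC /= rootC intr_eq0 => /eqP ->.
  by rewrite polyC0 eqxx.
move=> q sq /dvdpP[r rE].
have /andP[r0 q0] : (r != 0) && (q != 0).
  by rewrite -negb_or -mulf_eq0 -rE -size_poly_gt0 size_rat_int_poly size_poly_gt0.
have sP : size P = (size r + size q).-1 by rewrite -size_rat_int_poly rE size_mul.
have : root (map_poly ratC (r * q)) z by rewrite -rE map_ratr_intr.
rewrite rmorphM rootM => /orP[] h.
  have [Q sQ [Q0 Qz]] := ratr_root_int r0 h; have := Pmin Q Q0 Qz.
  rewrite sP sQ; have : (1 < size q)%N by rewrite ltn_neqAle eq_sym sq size_poly_gt0.
  by case: (size q) => [|[|k]] // _; rewrite !addnS /= -ltn_subRL subnn.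
have [Q sQ [Q0 Qz]] := ratr_root_int q0 h; have := Pmin Q Q0 Qz.
have dv : q %| map_poly intr P by rewrite rE dvdp_mulIr.
rewrite -(dvdp_size_eqp dv) size_rat_int_poly sP sQ => le; rewrite eqn_leq le andbT.
have : (0 < size r)%N by rewrite size_poly_gt0.
by case: (size r) => // k _; rewrite addSn /= leq_addl.
Qed.

(** As long as [q] is not constant it shares a complex root with [p], hence is
divisible by the irreducible polynomial [p]. *)
Lemma irreducible_power (p q : {poly rat}) : irreducible_poly p -> q != 0 ->
  (forall x : C, root (map_poly ratC q) x -> root (map_poly ratC p) x) ->
  exists c k, c != 0 /\ q = c *: p ^+ k.
Proof.
move=> irr; have [n] := ubnP (size q); elim: n => // n IH in q *; rewrite ltnS => sq q0 sub.
have [/size1_polyC qE|q1] := leqP (size q) 1.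
  exists q`_0, 0%N; rewrite expr0 alg_polyC -qE; split=> //.
  by apply: contra q0 => /eqP h; rewrite qE h polyC0.
have /closed_rootP[x qx] : size (map_poly ratC q) != 1%N by rewrite size_map_poly gtn_eqF.
have px := sub _ qx.
have sg : size (gcdp q p) != 1%N.
  apply/negP => /eqP; rewrite -(size_map_poly ratC) gcdp_map /= => h.
  have : root (gcdp (map_poly ratC q) (map_poly ratC p)) x by rewrite root_gcd qx px.
  by move/eqP: h; rewrite size_poly_eq1 => /eqp_root ->; rewrite (negPf (root1 x)).
have pq : p %| q.
  by rewrite -(eqp_dvdl _ (irr _ sg (dvdp_gcdr _ _))) dvdp_gcdl.
move/dvdpP: pq => [r rE].
have [r0 p0] : r != 0 /\ p != 0 by apply/andP; move: q0; rewrite rE mulf_eq0 negb_or.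
have sr : (size r < n)%N.
  apply: leq_trans sq; rewrite rE size_mul //; have [sp _] := irr.
  by case: (size p) sp => [|[|k]] // _; rewrite !addnS /= ltnS leq_addr.
have [|c [k [c0 rE']]] := IH r sr r0.
  by move=> y ry; apply: sub; rewrite rE rmorphM rootM ry.
by exists c, k.+1; split=> //; rewrite rE rE' exprSr scalerAl.
Qed.

End Liouville.

(** * Heights and the Liouville inequality *)

Section Liouville2.
Local Open Scope complex_scope.
Variable R : realType.
Notation C := R[i].
Notation ratC := (@ratr C).
Implicit Types (z w : C) (P : {poly int}) (q : {poly rat}).

Lemma crootsE P : map_poly intr P = (lead_coef P)%:~R *: \prod_(x <- croots R P) ('X - x%:P) :> {poly C}.
Proof.
rewrite /croots; case: closed_field_poly_normal => s /= ->.
rewrite lead_coef_map_inj ?rmorph0 //; first exact: intr_inj.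
Qed.

Lemma mahler_le_height z (H : R) : is_minpolyZ z (minpolyZ z) -> height z <= H ->
  (lead_coef (minpolyZ z))%:~R * \prod_(x <- croots R (minpolyZ z)) Num.max 1 (normc x)
    <= H ^+ (size (minpolyZ z)).-1.
Proof.
set P := minpolyZ z => mP; rewrite /height -/P; set M := (X in X `^ _).
have [lP _ Pz _] := mP.
have M0 : 0 <= M.
  apply: mulr_ge0; first by rewrite ler0z ltW.
  by apply: prodr_ge0 => x _; rewrite le_max ler01.
have e0 : (size P).-1%:R != 0 :> R.
  have [sP _] := minpolyZ_irreducible mP; rewrite size_rat_int_poly in sP.
  by rewrite pnatr_eq0 -lt0n -subn1 subn_gt0.
move=> MH; apply: le_trans (_ : (M `^ ((size P).-1%:R^-1)) ^+ (size P).-1 <= _).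
  by rewrite -powR_mulrn ?powR_ge0 // -powRrM mulVf // powRr1.
by rewrite lerXn2r ?nnegrE ?powR_ge0 // (le_trans _ MH) ?powR_ge0.
Qed.

Lemma rational_mulmx_eq0 (m n : nat) (v : 'cV[C]_m) (M : 'M[rat]_(n, m)) :
  (forall u : 'rV[rat]_m, map_mx ratC u *m v = 0 -> u = 0) ->
  map_mx ratC M *m v = 0 -> M = 0.
Proof.
move=> free Mv; apply/row_matrixP => i; rewrite row0; apply: free.
by rewrite map_row -row_mul Mv row0.
Qed.

(** The characteristic polynomial of [A] has the same complex roots as the minimal
polynomial [P] of [z], so it is a power [P^k] up to a scalar.  With [c = lead_coef P ^ k]
both claims follow from [P], the Mahler measure being multiplicative. *)
Lemma height_conjugates z (H : R) m (A : 'M[rat]_m.+1) (v : 'cV[C]_m.+1) (a : 'I_m.+1 -> C) :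
  (forall u : 'rV[rat]_m.+1, map_mx ratC u *m v = 0 -> u = 0) ->
  map_mx ratC A *m v = z *: v -> height z <= H ->
  char_poly (map_mx ratC A) = \prod_i ('X - (a i)%:P) ->
  exists c : int, [/\ c != 0,
    forall k, integralOver (intr : int -> C) (c%:~R *: \prod_i ('X - (a i)%:P))`_k &
    `|c|%:~R * \prod_i Num.max 1 (normc (a i)) <= H ^+ m.+1].
Proof.
move=> free Av zH charA.
have v0 : v != 0.
  apply/negP => /eqP v0; have := free (const_mx 1); rewrite v0 mulmx0 => /(_ erefl).
  by move/rowP/(_ 0)/eqP; rewrite !mxE oner_eq0.
have hornerAv (p : {poly C}) : horner_mx (map_mx ratC A) p *m v = p.[z] *: v.
  elim/poly_ind: p => [|p c IH]; first by rewrite rmorph0 mul0mx horner0 scale0r.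
  rewrite rmorphD rmorphM /= horner_mx_X horner_mx_C mulmxDl -mulmxE -mulmxA Av.
  by rewrite -scalemxAr IH mul_scalar_mx scalerA hornerMXaddC scalerDl mulrC.
have cz : root (map_poly ratC (char_poly A)) z.
  rewrite map_char_poly rootE; have := hornerAv (char_poly (map_mx ratC A)).
  by rewrite Cayley_Hamilton mul0mx => /esym/eqP; rewrite scaler_eq0 (negPf v0) orbF.
have cA0 : char_poly A != 0 by rewrite monic_neq0 ?char_poly_monic.
have mP := is_minpolyZ_minpolyZ cA0 cz.
set P := minpolyZ z in mP.
have mah := mahler_le_height mP zH; rewrite -/P in mah.
have irr := minpolyZ_irreducible mP.
have [lP _ Pz _] := mP.
have PA : horner_mx A (map_poly intr P) = 0.
  apply: (rational_mulmx_eq0 free).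
  by rewrite map_horner_mx map_ratr_intr hornerAv (rootP Pz) scale0r.
have sub (x : C) : root (map_poly ratC (char_poly A)) x -> root (map_poly ratC (map_poly intr P)) x.
  rewrite map_char_poly -root_mxminpoly => h.
  have /dvdpP[r ->] : mxminpoly (map_mx ratC A) %| map_poly ratC (map_poly intr P).
    by apply: mxminpoly_min; rewrite -map_horner_mx PA map_mx0.
  by rewrite rootM h orbT.
have [c [k [c0 qE]]] := irreducible_power irr cA0 sub.
have lc : c * (lead_coef P)%:~R ^+ k = 1.
  have := char_poly_monic A; rewrite monicE qE lead_coefZ lead_coef_exp => /eqP.
  by rewrite lead_coef_map_inj ?rmorph0 //; exact: intr_inj.
have sk : (k * (size P).-1 = m.+1)%N.
  have := size_char_poly A; rewrite qE size_scale // -(prednK (_ : 0 < size _)%N).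
    by rewrite size_exp size_rat_int_poly => -[<-]; rewrite mulnC.
  by rewrite size_poly_gt0 expf_neq0 // irredp_neq0.
pose b : C := (lead_coef P)%:~R.
have b0 : b != 0 by rewrite intr_eq0 gt_eqF.
have lcC : b ^+ k * ratC c = 1.
  by rewrite -[RHS](rmorph1 ratC) -lc rmorphM rmorphXn /= ratr_int mulrC.
have qC : b ^+ k *: \prod_i ('X - (a i)%:P) = map_poly intr P ^+ k.
  by rewrite -charA -map_char_poly qE map_polyZ rmorphXn /= map_ratr_intr scalerA lcC scale1r.
exists (lead_coef P ^+ k); split; first by rewrite expf_neq0 // gt_eqF.
  by move=> j; rewrite rmorphXn /= qC -rmorphXn coef_map; exact: integral_id.
pose rs := flatten (nseq k (croots R P)).
have rsE (T : comPzRingType) (f : C -> T) : \prod_(x <- rs) f x = (\prod_(x <- croots R P) f x) ^+ k.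
  rewrite /rs; elim: k {sk qE lc lcC qC rs} => [|k IH]; first by rewrite big_nil.
  by rewrite /= big_cat IH exprS.
have peq : perm_eq [seq a i | i : 'I_m.+1] rs.
  apply: prod_XsubC_eq; rewrite rsE big_map big_enum /=.
  apply: (scalerI (expf_neq0 k b0)).
  by rewrite qC crootsE exprZn.
have -> : \prod_i Num.max 1 (normc (a i)) = (\prod_(x <- croots R P) Num.max 1 (normc x)) ^+ k.
  by rewrite -rsE -(perm_big _ peq) big_map big_enum.
rewrite normrX (ger0_norm (ltW lP)) rmorphXn /= -exprMn -sk mulnC exprM.
have M0 : 0 <= (lead_coef P)%:~R * \prod_(x <- croots R P) Num.max 1 (normc x) :> R.
  apply: mulr_ge0; first by rewrite ler0z ltW.
  by apply: prodr_ge0 => x _; rewrite le_max ler01.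
by rewrite lerXn2r ?nnegrE // (le_trans M0).
Qed.

(** If [x] is a root of a monic integer polynomial, then by the lemma of Gauss [X - x] is
proportional to an integer polynomial that divides it, whose leading coefficient is
a unit; so [x] is an integer. *)
Lemma rational_integral (x : rat) : integralOver (intr : int -> C) (ratC x) -> x != 0 ->
  1 <= normc (ratC x).
Proof.
move=> [p pm /=]; rewrite -map_ratr_intr => px x0.
have {}px : root (map_poly intr p : {poly rat}) x.
  by rewrite rootE -(fmorph_eq0 ratC) -horner_map.
have dv : ('X - x%:P) %| (map_poly intr p : {poly rat}) by rewrite dvdp_XsubCl.
have [p1 [a a0 p1E] [r pE]] := dvdpP_rat_int dv.
have [e0 e1] : - x = a * (p1`_0)%:~R /\ 1 = a * (p1`_1)%:~R.
  move: p1E => /(congr1 (fun q : {poly rat} => (q`_0, q`_1))).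
  by rewrite !coefB !coefX !coefC !coefZ !coef_map /= sub0r subr0 => -[].
have sp1 : size p1 = 2%N by rewrite -size_rat_int_poly -(size_scale _ a0) -p1E size_XsubC.
have u1 : p1`_1 \is a GRing.unit.
  move: pm; rewrite monicE pE lead_coefM /lead_coef sp1 => /eqP h.
  by apply/unitrPr; exists r`_(size r).-1.
have xE : x = (- p1`_0 * p1`_1)%:~R.
  have -> : x = x * (p1`_1)%:~R ^+ 2.
    have : (p1`_1 == 1) || (p1`_1 == -1) by exact: u1.
    by case/orP => /eqP ->; rewrite ?rmorphN ?rmorph1 ?sqrrN expr1n mulr1.
  by rewrite rmorphM rmorphN /= -[x]opprK e0 !mulNr expr2 [a * _]mulrC -mulrA [a * _]mulrA -e1 mul1r.
rewrite xE ratr_int normc_int -[1]/(1%:~R) ler_int -gtz0_ge1 normr_gt0.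
by apply: contra x0 => /eqP h; rewrite xE h.
Qed.

Lemma normc_bieval T1 T2 (p : nat -> nat -> int) (L : R) (x y : C) :
  \sum_(i < T1) \sum_(j < T2) `|p i j|%:~R <= L ->
  normc (bieval T1 T2 p x y) <= L * (Num.max 1 (normc x) ^+ T1 * Num.max 1 (normc y) ^+ T2).
Proof.
have m1 (t : C) (i : nat) T : (i < T)%N -> normc t ^+ i <= Num.max 1 (normc t) ^+ T.
  move=> iT; apply: le_trans (_ : Num.max 1 (normc t) ^+ i <= _).
    by rewrite lerXn2r ?nnegrE ?normc_ge0 ?le_max ?lexx ?ler01 ?orbT.
  by rewrite ler_weXn2l ?le_max ?lexx // ltnW.
move=> pL; apply: le_trans (ler_wpM2r _ pL); last first.
  by rewrite mulr_ge0 ?exprn_ge0 // le_max ler01.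
rewrite /bieval mulr_suml (le_trans (normc_sum _ _ _)) //; apply: ler_sum => i _.
rewrite mulr_suml (le_trans (normc_sum _ _ _)) //; apply: ler_sum => j _.
rewrite -mulrzr normcM normc_int mulrC ler_wpM2l ?ler0z // normcM !normcX.
by rewrite ler_pM ?exprn_ge0 ?normc_ge0 ?m1.
Qed.

(** Let [(a_i, b_i)] be the joint eigenvalues of the multiplication matrices; one of
them is [(z, w)].  The product of the [p(a_i, b_i)] is the determinant of [p(A, B)],
a rational number, non-zero because [p(A, B)] is multiplication by [p(z, w)].
Times [c ^ T1 * c' ^ T2] it is an algebraic integer, so its absolute value is
at least [1]; all factors except [p(z, w)] are bounded by the heights. *)
Lemma liouville z w d (H L : R) T1 T2 (p : nat -> nat -> int) :
  degQ_le (Qadjoin2 z w) d -> height z <= H -> height w <= H -> 1 <= H -> 1 <= L ->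
  \sum_(i < T1) \sum_(j < T2) `|p i j|%:~R <= L ->
  bieval T1 T2 p z w != 0 ->
  1 <= normc (bieval T1 T2 p z w) * (L * H ^+ (T1 + T2)) ^+ d.
Proof.
move=> Kd zH wH H1 L1 pL e0.
have [m [A [B [v [md Av Bv free]]]]] := Qadjoin2_mult_matrices Kd.
set A' := map_mx ratC A in Av; set B' := map_mx ratC B in Bv.
have AB : A *m B = B *m A.
  apply/eqP; rewrite -subr_eq0; apply/eqP; apply: (rational_mulmx_eq0 free).
  rewrite map_mxB !map_mxM -/A' -/B' mulmxBl -!mulmxA Av Bv -!scalemxAr Av Bv.
  by rewrite !scalerA mulrC subrr.
have AB' : A' *m B' = B' *m A' by rewrite -!map_mxM AB.
have [a [b [cA cB dE ev]]] := joint_eigenvalues AB'.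
have v0 : v != 0.
  apply/negP => /eqP v0; have := free (const_mx 1); rewrite v0 mulmx0 => /(_ erefl).
  by move/rowP/(_ 0)/eqP; rewrite !mxE oner_eq0.
have [i0 [ai0 bi0]] := ev v z w v0 Av Bv.
have [c [c0 cI cH]] := height_conjugates free Av zH cA.
have [c' [c'0 c'I c'H]] := height_conjugates free Bv wH cB.
pose M := bieval T1 T2 p A B.
have ME : map_mx ratC M = bieval T1 T2 p A' B' by exact: (rmorph_bieval (map_mx ratC)).
have evv : bieval T1 T2 p A' B' *m v = bieval T1 T2 p z w *: v.
  have pw (X : 'M[C]_m.+1) x k : X *m v = x *: v -> X ^+ k *m v = x ^+ k *: v.
    move=> Xv; elim: k => [|k IH]; first by rewrite !expr0 mul1mx scale1r.
    by rewrite !exprS -mulmxE -mulmxA IH -scalemxAr Xv scalerA mulrC.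
  rewrite /bieval mulmx_suml scaler_suml; apply: eq_bigr => i _.
  rewrite mulmx_suml scaler_suml; apply: eq_bigr => j _.
  rewrite -[in LHS]scaler_int -scalemxAl -mulmxE -mulmxA (pw B' w) // -scalemxAr (pw A' z) //.
  rewrite !scalerA -[in RHS]mulrzr; congr (_ *: _).
  by rewrite [RHS]mulrC [z ^+ _ * _]mulrC mulrA.
have dM : \det M != 0.
  apply/negP => /det0P[u u0 uM]; move/eqP: u0; apply; apply: free.
  have : map_mx ratC (u *m M) *m v = 0 by rewrite uM map_mx0 mul0mx.
  rewrite map_mxM ME -mulmxA evv -scalemxAr => /eqP.
  by rewrite scaler_eq0 (negPf e0) => /eqP.
pose X i := Num.max 1 (normc (a i)); pose Y i := Num.max 1 (normc (b i)).
have X1 i : 1 <= X i by rewrite le_max lexx.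
have Y1 i : 1 <= Y i by rewrite le_max lexx.
pose N i := normc (bieval T1 T2 p (a i) (b i)).
have NXY i : N i <= L * (X i ^+ T1 * Y i ^+ T2) by exact: normc_bieval.
pose D := (c%:~R : C) ^+ T1 * c'%:~R ^+ T2 * \prod_i bieval T1 T2 p (a i) (b i).
have DE : D = ratC (c%:~R ^+ T1 * c'%:~R ^+ T2 * \det M).
  by rewrite !rmorphM !rmorphXn /= !ratr_int -det_map_mx ME dE.
have D1 : 1 <= normc D.
  rewrite DE; apply: rational_integral; first by rewrite -DE; exact: algint_prod_bieval.
  by rewrite !mulf_neq0 ?expf_neq0 ?intr_eq0.
have L0 : 0 <= L by rewrite (le_trans _ L1).
have H0 : 0 <= H by rewrite (le_trans _ H1).
have prodE : \prod_(i | i != i0) N i <= L ^+ m * ((\prod_i X i) ^+ T1 * (\prod_i Y i) ^+ T2).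
  apply: le_trans (_ : \prod_(i | i != i0) (L * (X i ^+ T1 * Y i ^+ T2)) <= _).
    by apply: ler_prod => i _; rewrite normc_ge0 NXY.
  rewrite big_split /= prodr_const cardC1 card_ord /= ler_wpM2l ?exprn_ge0 //.
  rewrite -!prodrXl -big_split /= [leRHS](bigD1 i0) //= ler_peMl //.
    by apply: prodr_ge0 => i _; rewrite mulr_ge0 ?exprn_ge0 // (le_trans ler01).
  by rewrite mulr_ege1 ?exprn_ege1.
have ccH : `|c|%:~R ^+ T1 * `|c'|%:~R ^+ T2 * ((\prod_i X i) ^+ T1 * (\prod_i Y i) ^+ T2)
    <= H ^+ (m.+1 * (T1 + T2)) :> R.
  rewrite mulrACA -!exprMn exprM exprD.
  have ge0 (e : int) (x : 'I_m.+1 -> R) : (forall i, 1 <= x i) -> 0 <= `|e|%:~R * \prod_i x i.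
    by move=> x1; rewrite mulr_ge0 ?ler0z ?prodr_ge0 // => i _; rewrite (le_trans ler01).
  by rewrite ler_pM ?exprn_ge0 ?lerXn2r ?nnegrE ?ge0 ?exprn_ge0.
move: D1; rewrite /D (normcM (_ * _)) (normcM (_ ^+ _)) !normcX !normc_int normc_prod (bigD1 i0) //=.
have -> : bieval T1 T2 p z w = bieval T1 T2 p (a i0) (b i0) by rewrite ai0 bi0.
move=> D1; apply: le_trans D1 _; rewrite mulrCA ler_wpM2l ?normc_ge0 //.
apply: le_trans (_ : L ^+ m * H ^+ (m.+1 * (T1 + T2)) <= _); last first.
  rewrite exprMn -exprM ler_pM ?exprn_ge0 ?ler_weXn2l //; first exact: ltnW.
  by rewrite mulnC leq_mul2l md orbT.
apply: le_trans (ler_wpM2l _ prodE) _; first by rewrite mulr_ge0 ?exprn_ge0 ?ler0z.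
by rewrite mulrCA ler_wpM2l ?exprn_ge0.
Qed.
End Liouville2.

(** * Lower bound for p(X, Q) and counting of zeros *)

Section Zero.
Local Open Scope complex_scope.
Variable R : rcfType.
Notation C := R[i].
Implicit Types (z w : C) (f g h Q F : {poly C}) (r : R) (s : seq C).

(** The modulus of continuity has to be uniform in [p]: the auxiliary polynomial is
chosen after the approximation of [G]. *)
Lemma bieval_continuity T1 T2 (B : int) z w (e : R) : 0 < e ->
  exists2 eta : R, 0 < eta & forall (p : nat -> nat -> int) w',
    (forall i j, (i < T1)%N -> (j < T2)%N -> `|p i j| <= B) ->
    normc (w' - w) <= eta -> normc (bieval T1 T2 p z w' - bieval T1 T2 p z w) <= e.
Proof.
move=> e0; pose M := normc w + 1; have M1 : 1 <= M by rewrite lerDr normc_ge0.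
have M0 : 0 <= M by rewrite (le_trans ler01).
pose D : R := \sum_(i < T1) \sum_(j < T2) `|B|%:~R * (normc z ^+ i * (j%:R * M ^+ j)).
have D0 : 0 <= D.
  apply: sumr_ge0 => i _; apply: sumr_ge0 => j _.
  by rewrite mulr_ge0 ?ler0z ?mulr_ge0 ?exprn_ge0 ?normc_ge0.
have D10 : 0 < D + 1 by rewrite ltr_wpDl.
exists (Num.min 1 (e / (D + 1))); first by rewrite lt_min ltr01 divr_gt0.
move=> p w' pB; rewrite le_min => /andP[d1 d2].
have wM : normc w <= M by rewrite lerDl ler01.
have w'M : normc w' <= M by rewrite -[w'](subrK w) (le_trans (normcD _ _)) // addrC lerD2l.
apply: le_trans (_ : D * normc (w' - w) <= _); last first.
  rewrite (le_trans (ler_wpM2l D0 d2)) // mulrCA -[leRHS]mulr1 ler_wpM2l ?(ltW e0) //.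
  by rewrite ler_pdivrMr // mul1r lerDl ler01.
rewrite /D /bieval mulr_suml -sumrB (le_trans (normc_sum _ _ _)) //; apply: ler_sum => i _.
rewrite mulr_suml -sumrB (le_trans (normc_sum _ _ _)) //; apply: ler_sum => j _.
rewrite -mulrzBl -mulrBr -mulrzr !normcM normcX normc_int mulrC -!mulrA.
have le0B : 0 <= B by rewrite (le_trans _ (pB i j (ltn_ord i) (ltn_ord j))).
rewrite ler_pM ?ler0z ?mulr_ge0 ?exprn_ge0 ?normc_ge0 //.
  by rewrite ler_int (ger0_norm le0B) pB.
rewrite ler_wpM2l ?exprn_ge0 ?normc_ge0 // (le_trans (normc_exprB _ w'M wM M1)) //.
by rewrite -mulrA [normc _ * _]mulrC.
Qed.

Lemma bieval_continuity_seq T1 T2 (B : int) s (g : C -> C) (e : R) : 0 < e ->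
  exists2 eta : R, 0 < eta & forall (p : nat -> nat -> int) (w' : C -> C),
    (forall i j, (i < T1)%N -> (j < T2)%N -> `|p i j| <= B) ->
    (forall z, z \in s -> normc (w' z - g z) <= eta) ->
    forall z, z \in s -> normc (bieval T1 T2 p z (w' z) - bieval T1 T2 p z (g z)) <= e.
Proof.
move=> e0; elim: s => [|x s [eta eta0 IH]]; first by exists 1.
have [eta' eta'0 h] := bieval_continuity T1 T2 B x (g x) e0.
exists (Num.min eta eta'); first by rewrite lt_min eta0.
move=> p w' pB w'P z; rewrite inE => /predU1P[->|zs].
  by rewrite h // (le_trans (w'P _ (mem_head _ _))) // ge_min lexx orbT.
apply: IH zs => // y ys; apply: le_trans (w'P y _) _; first by rewrite inE ys orbT.
by rewrite ge_min lexx.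
Qed.

(** The first [T] common zeros of [G] and of its approximations. *)
Definition nodes T : seq C := [seq - (m%:R) | m <- iota 0 T].

(** Lagrange interpolation at [0, -1, ..., 1 - T]: the nodes are at mutual distance
at least [1] and in the disc of radius [r]. *)
Lemma l1_nodes T r f (e : R) : 1 <= r -> T%:R <= r + 1 -> (size f <= T)%N -> 0 <= e ->
  (forall m, (m < T)%N -> normc f.[- m%:R] <= e) ->
  l1 r f <= (T%:R * (2 * r) ^+ T) * e.
Proof.
move=> r1 Tr sf e0 fe; have r0 : 0 <= r by rewrite (le_trans ler01).
have us : uniq (nodes T).
  by rewrite map_inj_uniq ?iota_uniq // => i j /oppr_inj /eqP; rewrite eqr_nat => /eqP.
have ss : size (nodes T) = T by rewrite size_map size_iota.
have nodesP x : x \in nodes T -> exists2 m, (m < T)%N & x = - m%:R.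
  by move=> /mapP[m]; rewrite mem_iota add0n => /andP[_ mT] ->; exists m.
have -> : l1 r f = l1 r (lagrange_interp (nodes T) (fun x => f.[x])) by rewrite -lagrange_interpE // ss.
apply: le_trans (l1_lagrange_interp _ _ r0) _; rewrite big_seq.
apply: le_trans (_ : \sum_(x <- nodes T | x \in nodes T) e * (2 * r) ^+ T <= _); last first.
  by rewrite -big_seq big_const_seq count_predT ss iter_addr_0 -[leLHS]mulr_natl [e * _]mulrC mulrA.
apply: ler_sum => x xs; have [m mT xE] := nodesP _ xs.
rewrite ler_pM ?normc_ge0 //.
- by apply: prodr_ge0 => y _; rewrite mulr_ge0 ?invr_ge0 ?normc_ge0 // addr_ge0 ?normc_ge0.
- by rewrite xE fe.
rewrite big_seq; apply: le_trans (_ : \prod_(y <- rem x (nodes T) | y \in rem x (nodes T)) (2 * r) <= _).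
  apply: ler_prod => y; rewrite mem_rem_uniq // !inE => /andP[yx /nodesP[k kT yE]].
  rewrite mulr_ge0 ?invr_ge0 ?normc_ge0 ?addr_ge0 ?normc_ge0 //=.
  rewrite -[leRHS]mul1r ler_pM ?invr_ge0 ?normc_ge0 ?addr_ge0 ?normc_ge0 //.
    rewrite normcV invf_le1 ?normc_gt0 ?subr_eq0 1?eq_sym // xE yE opprK addrC.
    have kmE : (k%:R - m%:R : C) = (k%:Z - m%:Z)%:~R by rewrite rmorphB.
    rewrite kmE normc_int -[1]/(1%:~R) ler_int -gtz0_ge1 normr_gt0 subr_eq0.
    by apply: contra yx; rewrite xE yE => /eqP[->].
  rewrite yE normcN normc_nat mulr_natl mulr2n lerD2l.
  by rewrite -(lerD2r 1) (le_trans _ Tr) // natr1 ler_nat.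
rewrite -big_seq big_const_seq count_predT iter_mulr_1 size_rem // ss ler_weXn2l ?leq_pred //.
by rewrite mulr_ege1 // ler1n.
Qed.

(** Induction on [T2].  With [F = P_0 + Q F'], the values of [P_0] at the zeros
of [Q] are those of [F], which bounds [P_0], then [Q F'], then [F']. *)
Lemma coef_lower_bound T T2 r Q (K : R) (P : nat -> {poly C}) :
  1 <= r -> T%:R <= r + 1 -> 1 <= K -> (0 < T)%N ->
  (forall m, (m < T)%N -> Q.[- m%:R] = 0) ->
  (forall f, l1 r f <= K * l1 r (Q * f)) ->
  (forall j, (size (P j) <= T)%N) ->
  forall j, (j < T2)%N ->
  l1 r (P j) <= (K * (1 + T%:R * (2 * r) ^+ T)) ^+ T2 * l1 r (\sum_(k < T2) P k * Q ^+ k).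
Proof.
move=> r1 Tr K1 T0 Q0 QK sP; set E := T%:R * _; have r0 : 0 <= r by rewrite (le_trans ler01).
have E0 : 0 <= E by rewrite mulr_ge0 ?exprn_ge0 ?mulr_ge0.
have K0 : 0 <= K by rewrite (le_trans ler01).
set E1 := K * _; have EE1 : E <= E1.
  by rewrite -[leLHS]mul1r ler_pM // lerDr ler01.
have E11 : 1 <= E1 by rewrite mulr_ege1 // lerDl.
elim: T2 P sP => // T2 IH P sP j jT; set F := \sum_(k < _) _.
pose F' := \sum_(k < T2) P k.+1 * Q ^+ k.
have FE : F = P 0%N + Q * F'.
  rewrite /F big_ord_recl expr0 mulr1; congr (_ + _).
  by rewrite mulr_sumr; apply: eq_bigr => k _; rewrite exprS mulrCA.
have P0F : l1 r (P 0%N) <= E * l1 r F.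
  apply: l1_nodes => //; first exact: l1_ge0.
  move=> m mT; have -> : (P 0%N).[- m%:R] = F.[- m%:R].
    by rewrite FE hornerD hornerM Q0 // mul0r addr0.
  apply: normc_horner; rewrite normcN normc_nat.
  by rewrite -(lerD2r 1) (le_trans _ Tr) // natr1 ler_nat.
have F'F : l1 r F' <= E1 * l1 r F.
  rewrite (le_trans (QK F')) // -mulrA ler_wpM2l //.
  have -> : Q * F' = F - P 0%N by rewrite FE addrC addKr.
  by rewrite (le_trans (l1B _ _ r0)) // mulrDl mul1r lerD2l.
case: j jT => [|j] jT.
  rewrite (le_trans P0F) // ler_wpM2r ?l1_ge0 // (le_trans EE1) //.
  by rewrite exprS ler_peMr ?exprn_ege1 // (le_trans ler01).
have := IH (fun k => P k.+1) (fun k => sP k.+1) j jT; rewrite -/F' => h.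
rewrite (le_trans h) // exprSr -mulrA ler_wpM2l // exprn_ge0 // (le_trans ler01) //.
Qed.

(** Subtract the interpolation polynomial of the small values, then divide by the
product of the [X - z]; the norm of the quotient grows with the radius.  The
constant [D] depends on the points but is multiplied by [e], which will tend to [0]. *)
Lemma schwarz_lemma s r r' c : uniq s -> 0 <= c -> c <= r -> r <= r' -> c < r' ->
  (forall z, z \in s -> normc z <= c) ->
  exists2 D : R, 0 <= D & forall F e, 0 <= e -> (forall z, z \in s -> normc F.[z] <= e) ->
    l1 r F <= ((r + c) / (r' - c)) ^+ size s * l1 r' F + D * e.
Proof.
move=> us c0 cr rr' cr' sc; have r0 : 0 <= r by rewrite (le_trans c0).
have r'0 : 0 <= r' by rewrite (le_trans r0).
pose W := \prod_(z <- s) ('X - z%:P).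
pose D0 t := \sum_(x <- s) \prod_(y <- rem x s) (normc (x - y)^-1 * (t + normc y)).
have D00 t : 0 <= t -> 0 <= D0 t.
  move=> t0; apply: sumr_ge0 => x _; apply: prodr_ge0 => y _.
  by rewrite mulr_ge0 ?normc_ge0 ?addr_ge0 ?normc_ge0.
set ra := _ / _; have ra0 : 0 <= ra by apply: divr_ge0; [apply: addr_ge0|rewrite subr_ge0 ltW].
exists (D0 r + ra ^+ size s * D0 r'); first by rewrite addr_ge0 ?mulr_ge0 ?exprn_ge0 ?D00.
move=> F e e0 Fe; pose I := lagrange_interp s (fun x => F.[x]).
have Ie t : 0 <= t -> l1 t I <= D0 t * e.
  move=> t0; apply: le_trans (l1_lagrange_interp _ _ t0) _; rewrite mulr_suml big_seq [leRHS]big_seq.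
  apply: ler_sum => x xs; rewrite mulrC ler_wpM2l ?Fe //.
  by apply: prodr_ge0 => y _; rewrite mulr_ge0 ?normc_ge0 ?addr_ge0 ?normc_ge0.
have /dvdpP[h hE] : W %| F - I.
  apply: uniq_roots_dvdp; last by rewrite uniq_rootsE.
  by apply/allP => x xs; rewrite rootE hornerD hornerN horner_lagrange_interp // subrr.
have FE : F = I + W * h by rewrite [W * h]mulrC -hE addrC subrK.
have hr : l1 r h <= l1 r' h by exact: l1_mono.
have Wh : (r' - c) ^+ size s * l1 r' h <= l1 r' (F - I).
  by rewrite hE [h * _]mulrC; apply: l1_prod_XsubC_mul => //; exact: ltW.
have p0 : 0 < (r' - c) ^+ size s by rewrite exprn_gt0 // subr_gt0.
have h' : l1 r' h <= (r' - c) ^- size s * (l1 r' F + D0 r' * e).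
  rewrite ler_pdivlMl // (le_trans Wh) // (le_trans (l1B _ _ r'0)) // lerD2l; exact: Ie.
rewrite {1}FE (le_trans (l1D _ _ r0)) //.
apply: le_trans (lerD (Ie r r0) (l1M _ _ r0)) _.
apply: le_trans (_ : D0 r * e + (r + c) ^+ size s * ((r' - c) ^- size s * (l1 r' F + D0 r' * e)) <= _).
  rewrite lerD2l ler_pM ?l1_ge0 ?l1_prod_XsubC //; exact: le_trans hr h'.
have -> : ra ^+ size s = (r + c) ^+ size s * (r' - c) ^- size s by rewrite /ra exprMn exprVn.
by rewrite le_eqVlt; apply/orP; left; apply/eqP; ring.
Qed.

Lemma bieval_X T T2 (p : nat -> nat -> int) (Q : {poly C}) :
  bieval T T2 p 'X Q = \sum_(j < T2) (\poly_(i < T) (p i j)%:~R) * Q ^+ j.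
Proof.
rewrite /bieval exchange_big /=; apply: eq_bigr => j _.
rewrite poly_def mulr_suml; apply: eq_bigr => i _.
by rewrite -scalerAl scaler_int.
Qed.

Lemma l1_bieval T T2 (p : nat -> nat -> int) Q (B : int) r (U : R) : 1 <= r -> 1 <= U -> l1 r Q <= U ->
  (forall i j, (i < T)%N -> (j < T2)%N -> `|p i j| <= B) ->
  l1 r (bieval T T2 p 'X Q) <= (T%:R * T2%:R * B%:~R) * (r ^+ T * U ^+ T2).
Proof.
move=> r1 U1 QU pB; have r0 : 0 <= r by rewrite (le_trans ler01).
have U0 : 0 <= U by rewrite (le_trans ler01).
apply: le_trans (_ : \sum_(i < T) \sum_(j < T2) B%:~R * (r ^+ T * U ^+ T2) <= _).
  rewrite (le_trans (l1_sum _ _ _ r0)) //; apply: ler_sum => i _.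
  rewrite (le_trans (l1_sum _ _ _ r0)) //; apply: ler_sum => j _.
  rewrite -scaler_int l1Z normc_int ler_pM ?ler0z ?l1_ge0 //; first by rewrite ler_int pB.
  rewrite (le_trans (l1M _ _ r0)) // ler_pM ?l1_ge0 //.
    by rewrite (le_trans (l1_exp _ _ r0)) // l1X ler_weXn2l // ltnW.
  rewrite (le_trans (l1_exp _ _ r0)) // (le_trans (_ : _ <= U ^+ j)) //.
    by rewrite lerXn2r ?nnegrE ?l1_ge0.
  by rewrite ler_weXn2l // ltnW.
rewrite sumr_const card_ord sumr_const card_ord -mulrnA -[leLHS]mulr_natl natrM.
by rewrite -!mulrA [T2%:R * (T%:R * _)]mulrCA.
Qed.

(** Compare the lower bound [coef_lower_bound] on the radius [r] with the upper bound
given by the zeros on the radius [r'].  Both are proportional to the largest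
coefficient of [p], which therefore disappears from the inequality. *)
Lemma zero_count T T2 r r' c (K U : R) (p : nat -> nat -> int) s (g : C -> C) :
  1 <= r -> T%:R <= r + 1 -> r <= r' -> 0 <= c -> c <= r -> c < r' -> 1 <= K -> 1 <= U ->
  (forall e : R, 0 < e -> exists Q, [/\ forall m, (m < T)%N -> Q.[- m%:R] = 0,
     forall f, l1 r f <= K * l1 r (Q * f), l1 r' Q <= U &
     forall z, z \in s -> normc (Q.[z] - g z) <= e]) ->
  uniq s -> (forall z, z \in s -> normc z <= c) ->
  (forall z, z \in s -> bieval T T2 p z (g z) = 0) ->
  (exists i j, [/\ (i < T)%N, (j < T2)%N & p i j != 0]) ->
  1 <= (K * (1 + T%:R * (2 * r) ^+ T)) ^+ T2 *
       (((r + c) / (r' - c)) ^+ size s * (T%:R * T2%:R * (r' ^+ T * U ^+ T2))).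
Proof.
move=> r1 Tr rr' c0 cr cr' K1 U1 approx us sc szero [i1 [j1 [iT jT pij]]].
have r'1 : 1 <= r' by rewrite (le_trans r1).
(* Everything is normalised by the largest coefficient [p i0 j0]. *)
have [[i0 j0] _ pmax] := @arg_maxnP ('I_T * 'I_T2)%type (Ordinal iT, Ordinal jT) predT
  (fun ij => `|p ij.1 ij.2|%N) isT.
rewrite /= in pmax; pose B := `|p i0 j0|.
have pB i j : (i < T)%N -> (j < T2)%N -> `|p i j| <= B.
  move=> h1 h2; have /= := pmax (Ordinal h1, Ordinal h2) isT.
  by rewrite /B -!abszE lez_nat.
have B0 : 0 < (B%:~R : R).
  by rewrite ltr0z (lt_le_trans _ (pB _ _ iT jT)) // normr_gt0 pij.
set E1 := K * _; set ra := _ / _; set Z := T%:R * T2%:R * _.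
have r0 : 0 <= r by rewrite (le_trans ler01).
have r'0 : 0 <= r' by rewrite (le_trans ler01).
have E10 : 0 <= E1 by rewrite mulr_ge0 ?addr_ge0 ?mulr_ge0 ?exprn_ge0 ?mulr_ge0 // (le_trans ler01).
have T0 : (0 < T)%N by exact: leq_ltn_trans iT.
rewrite -(ler_pM2l B0) mulr1.
have [D D0 sch] := schwarz_lemma us c0 cr rr' cr' sc.
apply/ler_addgt0Pr => e e0.
have k0 : 0 < E1 ^+ T2 * D + 1 by rewrite ltr_wpDl // mulr_ge0 ?exprn_ge0.
have d0 : 0 < e / (E1 ^+ T2 * D + 1) by rewrite divr_gt0.
have [eta eta0 cont] := bieval_continuity_seq T T2 B s g d0.
have [Q [Q0 QK QU Qg]] := approx _ eta0.
have Fval z : z \in s -> normc (bieval T T2 p 'X Q).[z] <= e / (E1 ^+ T2 * D + 1).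
  move=> zs; have := rmorph_bieval (horner_eval z) T T2 p 'X Q.
  rewrite /= /horner_eval hornerX => ->.
  by have := cont p (fun z => Q.[z]) pB Qg z zs; rewrite szero // subr0.
have low : B%:~R <= E1 ^+ T2 * l1 r (bieval T T2 p 'X Q).
  rewrite bieval_X; apply: le_trans (coef_lower_bound (P := fun j => \poly_(i < T) (p i j)%:~R) r1 Tr K1 T0 Q0 QK _ (ltn_ord j0)).
    apply: le_trans (l1_coef (\poly_(i < T) (p i j0)%:~R) i0 r0).
    by rewrite coef_poly ltn_ord normc_int -/B ler_peMr ?exprn_ege1 // ltW.
  by move=> j; exact: size_poly.
apply: le_trans low _.
have := sch _ _ (ltW d0) Fval; rewrite -/ra => h.
apply: le_trans (ler_wpM2l (exprn_ge0 _ E10) h) _.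
rewrite mulrDr lerD //.
  rewrite [leRHS]mulrCA ler_wpM2l ?exprn_ge0 // [leRHS]mulrCA ler_wpM2l ?exprn_ge0 //.
    by apply: divr_ge0; [apply: addr_ge0|rewrite subr_ge0 ltW].
  by rewrite (le_trans (l1_bieval r'1 U1 QU pB)) // /Z [_ * B%:~R]mulrC -!mulrA.
rewrite mulrA mulrCA -[leRHS]mulr1 ler_wpM2l ?(ltW e0) //.
by rewrite ler_pdivrMr // mul1r lerDl ler01.
Qed.

End Zero.

(** * Small values by the pigeonhole principle *)

Section Auxiliary.
Local Open Scope complex_scope.
Variable R : realType.
Notation C := R[i].

(** Each form takes its values on integer points [0 <= x i <= B] in an interval of
length [2 A B], cut into [K] cells of length [w]; the answer is the difference
of two points with the same cells. *)
Lemma pigeonhole_forms (I J : finType) (l : J -> I -> R) (A w : R) (B K : nat) :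
  0 <= A -> 0 < w -> 2 * (A * B%:R) < w * K%:R ->
  (forall j, \sum_i `|l j i| <= A) -> (K ^ #|J| < B.+1 ^ #|I|)%N ->
  exists x : I -> int, [/\ exists i, x i != 0, forall i, `|x i| <= B%:Z &
     forall j, `|\sum_i (x i)%:~R * l j i| <= w].
Proof.
move=> A0 w0 ABw lA KB.
(* The shift by [A * B] makes all values non-negative. *)
pose v (j : J) (x : {ffun I -> 'I_B.+1}) : R := \sum_i (x i : nat)%:R * l j i + A * B%:R.
have vbd j x : 0 <= v j x <= 2 * (A * B%:R).
  suff : `|\sum_i (x i : nat)%:R * l j i| <= A * B%:R by rewrite /v ler_norml => /andP[]; lra.
  rewrite (le_trans (ler_norm_sum _ _ _)) //.
  apply: le_trans (_ : \sum_i `|l j i| * B%:R <= _); last by rewrite -mulr_suml ler_wpM2r.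
  apply: ler_sum => i _; rewrite normrM mulrC ler_wpM2l // ger0_norm // ler_nat.
  by rewrite -ltnS.
have cell j x : (Num.truncn (v j x / w) < K)%N.
  have /andP[v0 vu] := vbd j x.
  rewrite -(ltr_nat R) (le_lt_trans (_ : _ <= v j x / w)) //.
    by rewrite truncn_le // divr_ge0 // ltW.
  by rewrite ltr_pdivrMr // mulrC (le_lt_trans vu).
pose f (x : {ffun I -> 'I_B.+1}) : {ffun J -> 'I_K} := [ffun j => Ordinal (cell j x)].
have /injectivePn[x [y xy fxy]] : ~~ injectiveb f.
  apply: contraL KB => /injectiveP /leq_card.
  by rewrite !card_ffun !card_ord -leqNgt.
exists (fun i => (x i : nat)%:Z - (y i : nat)%:Z); split.
- apply/existsP; apply: contraR xy; rewrite negb_exists => /forallP h.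
  apply/eqP/ffunP => i; apply: val_inj; have := h i; rewrite negbK subr_eq0 eqz_nat => /eqP //.
- move=> i; have := ltn_ord (x i); have := ltn_ord (y i); rewrite !ltnS => yB xB.
  by rewrite ler_norml; apply/andP; split; lia.
move=> j; have -> : \sum_i (((x i : nat)%:Z - (y i : nat)%:Z)%:~R * l j i) = v j x - v j y.
  rewrite /v opprD addrACA subrr addr0 -sumrB; apply: eq_bigr => i _.
  by rewrite rmorphB mulrBl.
have e : Num.truncn (v j x / w) = Num.truncn (v j y / w).
  by have /ffunP /(_ j) := fxy; rewrite !ffunE => /(congr1 val).
have /andP[x0 _] := vbd j x; have /andP[y0 _] := vbd j y.
have t1 t : 0 <= t -> (Num.truncn (t / w))%:R <= t / w by move=> t0; rewrite truncn_le // divr_ge0 // ltW.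
have t2 t : t / w < (Num.truncn (t / w))%:R + 1 by rewrite natr1; exact: truncnS_gt.
have := t1 _ x0; have := t1 _ y0; have := t2 (v j x); have := t2 (v j y); rewrite e => a1 a2 a3 a4.
have : `|(v j x - v j y) / w| <= 1 by rewrite mulrBl ler_norml; apply/andP; split; lra.
by rewrite normrM normfV (gtr0_norm w0) ler_pdivrMr // mul1r.
Qed.

Lemma l1_tail (F : {poly C}) (n r : R) S : 0 <= n -> n <= r -> 0 < r ->
  l1 n F <= \sum_(k < S) normc F`_k * n ^+ k + (n / r) ^+ S * l1 r F.
Proof.
move=> n0 nr r0; pose N := maxn (size F) S.
rewrite !(@l1_wide _ _ N) ?leq_maxl // mulr_sumr.
rewrite [X in _ <= X + _](big_ord_widen N (fun k => normc F`_k * n ^+ k)) ?leq_maxr // [X in _ <= X + _]big_mkcond /= -[leRHS]big_split /=.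
apply: ler_sum => k _; case: ltnP => kS.
  by rewrite lerDl mulr_ge0 ?exprn_ge0 ?mulr_ge0 ?normc_ge0 ?invr_ge0 ?exprn_ge0 // ltW.
rewrite add0r mulrCA ler_wpM2l ?normc_ge0 //.
have q0 : 0 <= n / r by rewrite divr_ge0 // ltW.
have q1 : n / r <= 1 by rewrite ler_pdivrMr // mul1r.
rewrite -[n in leLHS](divfK (lt0r_neq0 r0)) exprMn ler_wpM2r ?exprn_ge0 ?(ltW r0) //.
by rewrite ler_wiXn2l.
Qed.

Lemma coef_bieval T1 T2 (p : nat -> nat -> int) (Q : {poly C}) k :
  (bieval T1 T2 p 'X Q)`_k = \sum_(ij : 'I_T1 * 'I_T2) (p ij.1 ij.2)%:~R * ('X^(ij.1) * Q ^+ ij.2)`_k.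
Proof.
rewrite /bieval pair_bigA /= coef_sum; apply: eq_bigr => ij _.
by rewrite -scaler_int coefZ.
Qed.

(** The forms are the real and imaginary parts of the coefficients of
[X^k], [k < S], of [p(X, Q)], scaled by [n ^ k].  The other coefficients contribute
at most [(n / r) ^ S] times the norm on the radius [r]. *)
Lemma small_polynomial T1 T2 S B K (Q : {poly C}) (n r U w : R) :
  0 <= n -> n <= r -> 1 <= r -> 1 <= U -> l1 r Q <= U -> 0 < w ->
  2 * (T1%:R * T2%:R * (r ^+ T1 * U ^+ T2) * B%:R) < w * K%:R ->
  (K ^ (2 * S) < B.+1 ^ (T1 * T2))%N ->
  exists p : nat -> nat -> int,
  [/\ exists i j, [/\ (i < T1)%N, (j < T2)%N & p i j != 0],
      forall i j, (i < T1)%N -> (j < T2)%N -> `|p i j| <= B%:Z &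
      forall z, normc z <= n -> normc (bieval T1 T2 p z Q.[z]) <=
        S%:R * (2 * w) + (n / r) ^+ S * (T1%:R * T2%:R * B%:R * (r ^+ T1 * U ^+ T2))].
Proof.
move=> n0 nr r1 U1 QU w0 hw hK.
have r0 : 0 <= r by rewrite (le_trans ler01).
have U0 : 0 <= U by rewrite (le_trans ler01).
pose m (ij : 'I_T1 * 'I_T2) : {poly C} := 'X^(ij.1) * Q ^+ ij.2.
have mM ij k : normc (m ij)`_k * n ^+ k <= r ^+ T1 * U ^+ T2.
  apply: le_trans (l1_coef _ _ n0) _; apply: le_trans (l1_mono _ n0 nr) _.
  rewrite (le_trans (l1M _ _ r0)) // ler_pM ?l1_ge0 //.
    by rewrite (le_trans (l1_exp _ _ r0)) // l1X ler_weXn2l // ltnW.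
  rewrite (le_trans (l1_exp _ _ r0)) // (le_trans (_ : _ <= U ^+ ij.2)) //.
    by rewrite lerXn2r ?nnegrE ?l1_ge0.
  by rewrite ler_weXn2l // ltnW.
pose l (kb : 'I_S * bool) (ij : 'I_T1 * 'I_T2) : R :=
  (if kb.2 then complex.Re (m ij)`_kb.1 else complex.Im (m ij)`_kb.1) * n ^+ kb.1.
have lM kb ij : `|l kb ij| <= r ^+ T1 * U ^+ T2.
  apply: le_trans (mM ij kb.1); rewrite /l normrM (ger0_norm (exprn_ge0 _ n0)).
  by rewrite ler_wpM2r ?exprn_ge0 //; case: ifP => _; [exact: normc_Re|exact: normc_Im].
pose A : R := T1%:R * T2%:R * (r ^+ T1 * U ^+ T2).
have A0 : 0 <= A by rewrite mulr_ge0 ?mulr_ge0 ?exprn_ge0.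
have lA kb : \sum_ij `|l kb ij| <= A.
  apply: le_trans (ler_sum _ (fun ij _ => lM kb ij)) _.
  by rewrite sumr_const card_prod !card_ord -[leLHS]mulr_natl natrM.
have [|x [[ij xij] xB xl]] := @pigeonhole_forms _ _ l A w B K A0 w0 hw lA.
  by rewrite !card_prod !card_ord card_bool mulnC.
(* Extension by zero outside the range of exponents. *)
pose p (i j : nat) : int :=
  if insub i is Some i' then if insub j is Some j' then x (i' : 'I_T1, j' : 'I_T2) else 0 else 0.
have pE (i : 'I_T1) (j : 'I_T2) : p i j = x (i, j) by rewrite /p !valK.
exists p; split.
- by exists ij.1, ij.2; split; rewrite ?ltn_ord // pE -surjective_pairing.
- by move=> i j iT jT; rewrite (pE (Ordinal iT) (Ordinal jT)).
move=> z zn; have := rmorph_bieval (horner_eval z) T1 T2 p 'X Q.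
rewrite /= /horner_eval hornerX => <-; set F := bieval _ _ _ _ _.
rewrite (le_trans (normc_horner F zn)) // (le_trans (l1_tail F S n0 nr _)) ?(lt_le_trans ltr01) //.
apply: lerD; last first.
  rewrite ler_wpM2l ?exprn_ge0 ?divr_ge0 //.
  apply: (l1_bieval (B := B%:Z)) => // i j iT jT.
  by rewrite (pE (Ordinal iT) (Ordinal jT)).
have ReZ (c : int) (u : C) : complex.Re (c%:~R * u) = c%:~R * complex.Re u.
  by rewrite -(rmorph_int (real_complex R)); case: u => a b /=; rewrite mul0r subr0.
have ImZ (c : int) (u : C) : complex.Im (c%:~R * u) = c%:~R * complex.Im u.
  by rewrite -(rmorph_int (real_complex R)); case: u => a b /=; rewrite mul0r addr0.
have ReD : {morph (@complex.Re R) : u v / u + v} by case=> a b [].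
have ImD : {morph (@complex.Im R) : u v / u + v} by case=> a b [].
have Fk (k : 'I_S) : normc F`_k * n ^+ k <= 2 * w.
  have FE : F`_k = \sum_ij (x ij)%:~R * (m ij)`_k.
    by rewrite coef_bieval; apply: eq_bigr => -[i j] _ /=; rewrite pE.
  apply: le_trans (ler_wpM2r _ (normc_le_ReIm _)) _; first exact: exprn_ge0.
  rewrite mulrDl -{1 2}[n ^+ k]ger0_norm ?exprn_ge0 // -!normrM.
  have -> : 2 * w = w + w by ring.
  apply: lerD.
    apply: le_trans (xl (k, true)); rewrite /l /= FE (big_morph _ ReD (erefl : complex.Re (0 : C) = 0)).
    rewrite mulr_suml le_eqVlt; apply/orP; left; apply/eqP; congr (`|_|).
    by apply: eq_bigr => ij2 _; rewrite ReZ mulrA.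
  apply: le_trans (xl (k, false)); rewrite /l /= FE (big_morph _ ImD (erefl : complex.Im (0 : C) = 0)).
  rewrite mulr_suml le_eqVlt; apply/orP; left; apply/eqP; congr (`|_|).
  by apply: eq_bigr => ij2 _; rewrite ImZ mulrA.
apply: le_trans (ler_sum _ (fun k _ => Fk k)) _.
by rewrite sumr_const card_ord -[leLHS]mulr_natl.
Qed.
End Auxiliary.

(** * The complex exponential as a limit of powers *)

Section ComplexExp.
Local Open Scope complex_scope.
Variable R : realType.
Notation C := R[i].
Implicit Types (x y : R) (z w : C).

Lemma norm_sin_le y : 0 <= y -> `|sin y| <= y.
Proof.
move=> y0; have [|c _] := @MVT_segment R sin cos 0 y y0.
  by apply: continuous_subspaceT => x; exact: continuous_sin.
rewrite sin0 !subr0 => ->; rewrite normrM (ger0_norm y0) ler_piMl //; exact: cos_max.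
Qed.

Lemma norm_cosB1_ge0 y : 0 <= y -> `|cos y - 1| <= y ^+ 2.
Proof.
move=> y0; have [|c] := @MVT_segment R cos (fun x => - sin x) 0 y y0.
  by apply: continuous_subspaceT => x; exact: continuous_cos.
rewrite in_itv /= => /andP[c0 cy]; rewrite cos0 !subr0 => ->.
rewrite normrM normrN (ger0_norm y0) expr2 ler_wpM2r // (le_trans (norm_sin_le c0)) //.
Qed.

Lemma norm_sinB_ge0 y : 0 <= y <= 1 -> `|sin y - y| <= y ^+ 2.
Proof.
move=> /andP[y0 y1]; have [|c] := @MVT_segment R (fun x => sin x - x) (fun x => cos x - 1) 0 y y0.
  apply: continuous_subspaceT => x; apply: cvgB; [exact: continuous_sin|exact: cvg_id].
rewrite in_itv /= => /andP[c0 cy]; rewrite sin0 !subr0 => ->.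
rewrite normrM (ger0_norm y0) expr2 ler_wpM2r // (le_trans (norm_cosB1_ge0 c0)) //.
by rewrite expr2 (le_trans _ cy) // ler_piMl // (le_trans cy).
Qed.

(** From [1 + x <= expR x] and the same inequality for [- x]. *)
Lemma norm_expRB x : `|x| <= 2^-1 -> `|expR x - 1 - x| <= 2 * x ^+ 2.
Proof.
move=> hx; have [h1 h2] : - 2^-1 <= x /\ x <= 2^-1 by apply/andP; rewrite -ler_norml.
have e1 := expR_ge1Dx x; have e2 := expR_ge1Dx (- x).
have e0 := expR_gt0 x.
rewrite ger0_norm; last lra.
have : expR x * (1 - x) <= 1.
  by rewrite -[leRHS](expRxMexpNx_1 x) ler_wpM2l ?expR_ge0.
have x20 : 0 <= x ^+ 2 by rewrite sqr_ge0.
have q1 : x ^+ 2 * (1 - 2 * x) >= 0 by rewrite mulr_ge0 //; lra.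
move=> e3; have : (1 - x) * (1 + x + 2 * x ^+ 2 - expR x) >= 0.
  have -> : (1 - x) * (1 + x + 2 * x ^+ 2 - expR x) = (1 - expR x * (1 - x)) + x ^+ 2 * (1 - 2 * x) by ring.
  by apply: addr_ge0 => //; rewrite subr_ge0.
rewrite pmulr_rge0; lra.
Qed.

Definition cexp w : C := (expR (complex.Re w))%:C * (cos (complex.Im w) +i* sin (complex.Im w)).

Lemma cexpD z w : cexp (z + w) = cexp z * cexp w.
Proof.
case: z w => [a b] [c d]; rewrite /cexp /= expRD cosD sinD rmorphM /=.
rewrite [RHS]mulrACA; congr (_ * _); simpc.
by congr (_ +i* _); ring.
Qed.

Lemma cexp0 : cexp 0 = 1.
Proof. by rewrite /cexp /= expR0 cos0 sin0 mul1r. Qed.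

Lemma cexpN z : cexp (- z) = (cexp z)^-1.
Proof.
have h : cexp z * cexp (- z) = 1 by rewrite -cexpD subrr cexp0.
have z0 : cexp z != 0 by apply: contra_eq_neq h => ->; rewrite mul0r eq_sym oner_neq0.
by apply: (mulfI z0); rewrite h divff.
Qed.

Lemma cexpMn z n : cexp (z *+ n) = cexp z ^+ n.
Proof. by elim: n => [|n IH]; rewrite ?mulr0n ?cexp0 ?expr0 // mulrS cexpD IH exprS. Qed.

Lemma normc_cexp z : normc (cexp z) = expR (complex.Re z).
Proof.
rewrite normcM normc_real ger0_norm ?expR_ge0 //= cos2Dsin2.
by rewrite sqrtr1 mulr1.
Qed.

Lemma cexp_neq0 z : cexp z != 0.
Proof. by rewrite -normc_gt0 normc_cexp expR_gt0. Qed.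

Lemma norm_cosB1 y : `|cos y - 1| <= y ^+ 2.
Proof.
have [y0|y0] := leP 0 y; first exact: norm_cosB1_ge0.
by rewrite -cosN -sqrrN norm_cosB1_ge0 // oppr_ge0 ltW.
Qed.

Lemma norm_sinB y : `|y| <= 1 -> `|sin y - y| <= y ^+ 2.
Proof.
move=> h; have [h1 h2] : - 1 <= y /\ y <= 1 by apply/andP; rewrite -ler_norml.
have [y0|y0] := leP 0 y; first by rewrite norm_sinB_ge0 // y0.
have -> : `|sin y - y| = `|sin (- y) - (- y)| by rewrite sinN -normrN opprB opprK addrC.
by rewrite -[y ^+ 2]sqrrN norm_sinB_ge0 //; apply/andP; split; lra.
Qed.

Lemma normc_cexpB w : normc w <= 2^-1 -> normc (cexp w - 1 - w) <= 20 * normc w ^+ 2.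
Proof.
move=> h; apply: le_trans (normc_le_ReIm _) _.
have := normc_Re w; have := normc_Im w; set n := normc w in h *.
case: w @n h => x y /= h; set n := Num.sqrt _ in h * => yn xn.
have x2 : `|x| <= 2^-1 by apply: le_trans xn h.
have y1 : `|y| <= 1 by apply: le_trans yn _; lra.
have n0 : 0 <= n by rewrite sqrtr_ge0.
rewrite !mul0r !subr0 addr0.
have ex := norm_expRB x2; have cy := norm_cosB1 y; have sy := norm_sinB y1.
have xx : x ^+ 2 <= n ^+ 2 by rewrite -(real_normK (num_real x)) lerXn2r ?nnegrE.
have yy : y ^+ 2 <= n ^+ 2 by rewrite -(real_normK (num_real y)) lerXn2r ?nnegrE.
have e3 : expR x <= 3.
  have := ler_norm (expR x - 1 - x); have := ler_norm x; have : x ^+ 2 <= 2^-1.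
    rewrite -(real_normK (num_real x)) expr2 (le_trans (ler_pM _ _ x2 x2)) //; lra.
  lra.
have e0 := expR_gt0 x.
have p1 : `|expR x * cos y - 1 - x| <= 5 * n ^+ 2.
  have -> : expR x * cos y - 1 - x = expR x * (cos y - 1) + (expR x - 1 - x) by ring.
  rewrite (le_trans (ler_normD _ _)) // normrM (ger0_norm (ltW e0)).
  have : expR x * `|cos y - 1| <= 3 * y ^+ 2 by rewrite ler_pM // ltW.
  lra.
have p2 : `|expR x * sin y - y| <= 6 * n ^+ 2.
  have -> : expR x * sin y - y = expR x * (sin y - y) + (expR x - 1 - x) * y + x * y by ring.
  rewrite (le_trans (ler_normD _ _)) // (le_trans (lerD (ler_normD _ _) (lexx _))) // !normrM (ger0_norm (ltW e0)).
  have : expR x * `|sin y - y| <= 3 * y ^+ 2 by rewrite ler_pM // ltW.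
  have : `|expR x - 1 - x| * `|y| <= (2 * x ^+ 2) * 1 by rewrite ler_pM.
  have : `|x| * `|y| <= n ^+ 2 by rewrite expr2 ler_pM.
  move=> a1 a2 a3. lra.
rewrite ?add0r; have := sqr_ge0 n; have := lerD p1 p2; lra.
Qed.

(** Convergence in the complex plane with real tolerances. *)
Definition cvgC (x : nat -> C) (l : C) := forall e : R, 0 < e ->
  exists N, forall n, (N <= n)%N -> normc (x n - l) <= e.

Lemma cvgC_cst c : cvgC (fun=> c) c.
Proof. by move=> e e0; exists 0%N => n _; rewrite subrr normc0 ltW. Qed.

Lemma cvgC_unique (x : nat -> C) l l' : cvgC x l -> cvgC x l' -> l = l'.
Proof.
move=> h h'; apply/eqP; rewrite -subr_eq0 -normc_eq0 eq_le normc_ge0 andbT.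
apply/ler_addgt0Pr => e e0; rewrite add0r.
have e2 : 0 < e / 2 by lra.
have [N hN] := h _ e2; have [N' hN'] := h' _ e2; pose n := maxn N N'.
have -> : l - l' = (x n - l') - (x n - l) by ring.
rewrite (le_trans (normcD _ _)) // normcN.
have := hN n (leq_maxl _ _); have := hN' n (leq_maxr _ _); lra.
Qed.

Lemma cvgCM (x x' : nat -> C) l l' : cvgC x l -> cvgC x' l' -> cvgC (fun n => x n * x' n) (l * l').
Proof.
move=> h h' e e0; pose B := normc l' + 1; pose B' := normc l + 1.
have B0 : 0 < B by rewrite ltr_wpDl ?normc_ge0.
have B'0 : 0 < B' by rewrite ltr_wpDl ?normc_ge0.
have d0 : 0 < Num.min 1 (e / (B + B')) by rewrite lt_min ltr01 divr_gt0 // addr_gt0.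
have [N hN] := h _ d0; have [N' hN'] := h' _ d0; exists (maxn N N') => n.
rewrite geq_max => /andP[/hN + /hN']; rewrite !le_min => /andP[_ a2] /andP[b1 b2].
have -> : x n * x' n - l * l' = (x n - l) * x' n + l * (x' n - l') by ring.
have xB : normc (x' n) <= B by rewrite -[x' n](subrK l') (le_trans (normcD _ _)) // addrC lerD2l.
rewrite (le_trans (normcD _ _)) // !normcM.
apply: le_trans (_ : (e / (B + B')) * B + B' * (e / (B + B')) <= _).
  by rewrite lerD // ler_pM ?normc_ge0 // lerDl ler01.
by rewrite [B' * _]mulrC -mulrDr divfK // gt_eqF // addr_gt0.
Qed.

Lemma cvgC_prod (I : Type) (s : seq I) (x : I -> nat -> C) l :
  (forall i, cvgC (x i) (l i)) ->
  cvgC (fun n => \prod_(i <- s) x i n) (\prod_(i <- s) l i).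
Proof.
move=> h; elim: s => [|i s IH].
  by rewrite big_nil; under [X in cvgC X]funext do rewrite big_nil; exact: cvgC_cst.
by rewrite big_cons; under [X in cvgC X]funext do rewrite big_cons; exact: cvgCM.
Qed.

Lemma cvgC_ReIm (x : nat -> C) (a b : R) :
  (complex.Re (x n) @[n --> \oo] --> a)%classic ->
  (complex.Im (x n) @[n --> \oo] --> b)%classic -> cvgC x (a +i* b).
Proof.
move=> /cvgrPdist_le ha /cvgrPdist_le hb e e0.
have e2 : 0 < e / 2 by lra.
have [N _ hN] := ha _ e2; have [N' _ hN'] := hb _ e2.
exists (maxn N N') => n; rewrite geq_max => /andP[/hN /= h1 /hN' /= h2].
rewrite (le_trans (normc_le_ReIm _)) //; move: h1 h2; case: (x n) => u v /=.
rewrite (distrC a) (distrC b); lra.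
Qed.

Lemma nat_archi (B : R) : exists N, forall n, (N <= n)%N -> B <= n%:R.
Proof.
exists (Num.truncn `|B|).+1 => n h; apply: le_trans (ler_norm B) _.
by rewrite ltW // (lt_le_trans (truncnS_gt _)) // ler_nat.
Qed.

(** [cexp (- w)] is the [K]-th power of [cexp (- w / K)], which differs from
[1 - w / K] by [O(1 / K^2)]. *)
Lemma cvgC_cexp w : cvgC (fun K => (1 - w / K%:R) ^+ K) (cexp (- w)).
Proof.
move=> e e0; set c := normc w; have c0 : 0 <= c by exact: normc_ge0.
have [N hN] := nat_archi (Num.max (2 * c + 1) (20 * c ^+ 2 * expR c / e)).
exists N => K /hN; rewrite ge_max => /andP[h1 h2].
have K0 : 0 < K%:R :> R by apply: lt_le_trans h1; lra.
have KC : (K%:R : C) != 0 by rewrite -normc_gt0 normc_nat.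
pose v := - w / K%:R; have nv : normc v = c / K%:R.
  by rewrite /v normcM normcN normcV normc_nat.
have v2 : normc v <= 2^-1 by rewrite nv ler_pdivrMr //; lra.
have -> : cexp (- w) = cexp v ^+ K by rewrite -cexpMn -mulr_natr divfK.
have -> : 1 - w / K%:R = 1 + v by rewrite /v mulNr.
have M1 : 1 <= expR (normc v) by rewrite -expR0 ler_expR normc_ge0.
rewrite (le_trans (@normc_exprB _ _ _ (expR (normc v)) _ _ _ M1)) //.
- rewrite (le_trans (normcD _ _)) // normc1; exact: expR_ge1Dx.
- by rewrite normc_cexp ler_expR (le_trans (ler_norm _)) // normc_Re.
rewrite -expRM_natl nv [K%:R * (c / _)]mulrC divfK ?gt_eqF //.
have := normc_cexpB v2; rewrite -normcN nv => h3.
have -> : 1 + v - cexp v = - (cexp v - 1 - v) by ring.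
apply: le_trans (_ : K%:R * (20 * (c / K%:R) ^+ 2) * expR c <= _).
  by rewrite ler_wpM2r ?expR_ge0 // ler_wpM2l.
have -> : K%:R * (20 * (c / K%:R) ^+ 2) * expR c = 20 * c ^+ 2 * expR c / K%:R.
  by field; rewrite gt_eqF.
by rewrite ler_pdivrMr // [e * _]mulrC -ler_pdivrMr.
Qed.

End ComplexExp.

(** * Convergence of the Euler product to 1/Gamma *)

Section Euler.
Local Open Scope complex_scope.
Variable R : realType.
Notation C := R[i].
Implicit Types (z w : C) (x : nat -> C).

(** Its sum up to [N] is [ln N] because [ln 0 = 0]; the term [m = 1] vanishes.  It is
attached to the factor [1 + z / m] so that the product of [N] factors contains [N ^ (- z)]
and each of them is [1 + O(1 / m ^ 2)]. *)
Definition lndiff (m : nat) : R := ln m%:R - ln m.-1%:R.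

Lemma lndiff1 : lndiff 1 = 0. Proof. by rewrite /lndiff ln1 ln0 // subrr. Qed.

Lemma sum_lndiff N : \sum_(1 <= m < N.+1) lndiff m = ln N%:R.
Proof.
rewrite /lndiff (@telescope_sumr_eq _ 1 N.+1 (fun k => ln k.-1%:R)) //=. by rewrite [ln 0%:R]ln0 ?subr0.
Qed.

Lemma lndiff_bounds m : (2 <= m)%N -> m%:R^-1 <= lndiff m /\ lndiff m <= m.-1%:R^-1.
Proof.
case: m => [|[|m]] // _; rewrite /lndiff /=.
have m1 : 0 < m.+1%:R :> R by rewrite ltr0n.
have m2 : 0 < m.+2%:R :> R by rewrite ltr0n.
have E : m.+2%:R = m.+1%:R + 1 :> R by rewrite natr1.
rewrite -ln_div ?posrE //; split; last first.
  have -> : m.+2%:R / m.+1%:R = 1 + m.+1%:R^-1 :> R by rewrite E mulrDl divff ?gt_eqF // mul1r.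
  by apply: le_ln1Dx; rewrite (lt_trans (ltrN10 _)) // invr_gt0.
rewrite -[m.+2%:R / _]invrK lnV ?posrE ?invr_gt0 ?divr_gt0 // lerNr.
have -> : (m.+2%:R / m.+1%:R)^-1 = 1 + - m.+2%:R^-1 :> R 
  by rewrite E; set t := m.+1%:R in m1 *; field; apply/andP; split; rewrite gt_eqF //; lra.
by apply: le_ln1Dx; rewrite ltrN2 invf_lt1 // ltr1n.
Qed.

Lemma lndiff_le2 m : (1 <= m)%N -> lndiff m <= 2 / m%:R.
Proof.
case: m => [|[|m]] // _; first by rewrite lndiff1 divr_ge0.
have [_ /le_trans->//] := @lndiff_bounds m.+2 isT.
rewrite ler_pdivlMr ?ltr0n // mulrC ler_pdivrMr ?ltr0n // -natrM ler_nat.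
by rewrite mul2n -addnn !addSn addnS !ltnS leq_addr.
Qed.

Lemma lndiff_ge0 m : (1 <= m)%N -> 0 <= lndiff m.
Proof.
case: m => [|[|m]] // _; first by rewrite lndiff1.
by have [/(le_trans _)-> //] := @lndiff_bounds m.+2 isT; rewrite invr_ge0.
Qed.

Lemma lndiff_near_inv m : (1 <= m)%N -> `|lndiff m - m%:R^-1| <= 2 / m%:R ^+ 2.
Proof.
case: m => [|[|m]] // _; first by rewrite lndiff1 sub0r normrN invr1 normr1 expr1n divr1; lra.
have [h1 h2] := @lndiff_bounds m.+2 isT; rewrite ger0_norm ?subr_ge0 //.
apply: le_trans (lerB h2 (lexx _)) _; rewrite /=.
have E : m.+2%:R = m.+1%:R + 1 :> R by rewrite natr1.
have t1 : 1 <= m.+1%:R :> R by rewrite ler1n.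
rewrite E; set t := m.+1%:R in t1 *.
have t0 : t != 0 by rewrite gt_eqF //; lra.
have t10 : t + 1 != 0 by rewrite gt_eqF //; lra.
have -> : t^-1 - (t + 1)^-1 = (t + 1) / (t * (t + 1) ^+ 2) by field; apply/andP; split.
rewrite ler_pdivlMr ?exprn_gt0 //; last lra.
rewrite [_ / _ * _](_ : _ = (t + 1) / t); last by field; apply/andP; split.
by rewrite ler_pdivrMr; lra.
Qed.

Definition euler_factor z m : C := (1 + z / m%:R) * cexp (- (z * (lndiff m)%:C)).
Definition euler_product z N : C := z * \prod_(1 <= m < N.+1) euler_factor z m.

Lemma euler_seqE z N : (1 <= N)%N -> euler_seq z N = (euler_product z N)^-1.
Proof.
move=> N1; have -> : euler_product z N = (\prod_(k < N.+1) (z + k%:R)) / N`!%:R * cexp (- (z * (ln N%:R)%:C)).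
  rewrite /euler_product /euler_factor big_split /= mulrA; congr (_ * _).
    rewrite -(big_mkord xpredT (fun k => z + k%:R)) [in RHS]big_ltn // mulr0n addr0 -mulrA; congr (_ * _).
    rewrite fact_prod natr_prod -prodf_div; apply: eq_big_nat => m /andP[m1 _].
    have mC : (m%:R : C) != 0 by rewrite -normc_gt0 normc_nat ltr0n.
    by rewrite mulrDl (divff mC) addrC.
  rewrite -sum_lndiff rmorph_sum mulr_sumr -sumrN.
  by elim/big_rec2: _ => [|m y1 y2 _ ->]; rewrite ?cexp0 ?cexpD.
have -> : cexp (- (z * (ln N%:R)%:C)) = (cpow_nat N z)^-1.
  rewrite cexpN; congr (_^-1); case: z => a b; rewrite /cexp /=.
  by rewrite !mulr0 subr0 add0r.
by rewrite !invfM !invrK /euler_seq mulrC mulrA.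
Qed.

Lemma inv_sqr_telescope m : (1 <= m)%N -> m.+1%:R ^- 2 <= m%:R^-1 - m.+1%:R^-1 :> R.
Proof.
move=> m1; have t1 : 1 <= m%:R :> R by rewrite ler1n.
rewrite -natr1; set t := m%:R in t1 *.
have t0 : t != 0 by rewrite gt_eqF //; lra.
have t10 : t + 1 != 0 by rewrite gt_eqF //; lra.
have -> : t^-1 - (t + 1)^-1 = (t * (t + 1))^-1 by field; apply/andP; split.
rewrite lef_pV2 ?posrE ?exprn_gt0 ?mulr_gt0 //; lra.
Qed.

(** Since [1 / (m + 1) ^ 2 <= 1 / m - 1 / (m + 1)], the sequence [y m - b / m] is
non-decreasing and bounded above. *)
Lemma slow_cvg (y : nat -> R) (b : R) m0 : 0 <= b -> (1 <= m0)%N ->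
  (forall m, (m0 <= m)%N -> `|y m.+1 - y m| <= b / m.+1%:R ^+ 2) -> cvgn y.
Proof.
move=> b0; case: m0 => // m0 _ hy.
(* [t] increases, [t'] decreases and [t <= t']. *)
pose h k : R := b / (k + m0).+1%:R; pose t k := y (k + m0.+1)%N - h k.
pose t' k := y (k + m0.+1)%N + h k.
have step k : `|y (k.+1 + m0.+1)%N - y (k + m0.+1)%N| <= h k - h k.+1.
  rewrite addSn (le_trans (hy _ (leq_addl _ _))) // /h -mulrBr ler_wpM2l //.
  by rewrite addnS (le_trans (inv_sqr_telescope _)).
have ht k : t k <= t k.+1.
  by have := step k; rewrite ler_norml => /andP[h1 _]; rewrite /t; lra.
have ht' k : t' k.+1 <= t' k.
  by have := step k; rewrite ler_norml => /andP[_ h2]; rewrite /t'; lra.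
have h0 k : 0 <= h k by rewrite divr_ge0.
have t'0 k : t' k <= t' 0%N by elim: k => // k IH; exact: le_trans IH.
have ct : cvgn t.
  apply: nondecreasing_is_cvgn; first by apply/nondecreasing_seqP.
  exists (t' 0%N) => _ [k _ <-]; apply: le_trans (t'0 k).
  by rewrite /t /t'; have := h0 k; lra.
have ch : (h k @[k --> \oo] --> b * 0)%classic.
  by apply: cvgMr; have := @cvg_harmonic R; rewrite -(cvg_shiftn m0).
have H : ((fun k => y (k + m0.+1)%N) @ \oo --> lim (t k @[k --> \oo])%classic + b * 0)%classic.
  have -> : (fun k => y (k + m0.+1)%N) = (t \+ h) by apply/funext => k; rewrite /t /= subrK.
  exact: cvgD.
apply/cvg_ex; exists (lim (t k @[k --> \oo])%classic + b * 0).
by rewrite -(cvg_shiftn m0.+1); exact: H.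
Qed.

Lemma ratio_cvg x (b : R) m0 : 0 <= b -> (1 <= m0)%N ->
  (forall m, (m0 <= m)%N -> normc (x m.+1 - x m) <= normc (x m) * (b / m.+1%:R ^+ 2)) ->
  cvgC x (lim (complex.Re (x n) @[n --> \oo])%classic +i* lim (complex.Im (x n) @[n --> \oo])%classic).
Proof.
move=> b0 m01 hx; pose B := normc (x m0) * expR (b / m0%:R).
have xB m : (m0 <= m)%N -> normc (x m) <= normc (x m0) * expR (b * (m0%:R^-1 - m%:R^-1)).
  elim: m => [|m IH]; first by rewrite leqn0 => /eqP m00; rewrite m00 in m01.
  rewrite leq_eqVlt => /predU1P[<-|]; first by rewrite subrr mulr0 expR0 mulr1.
  rewrite ltnS => mm; have m1 := leq_trans m01 mm.
  have -> : x m.+1 = x m + (x m.+1 - x m) by rewrite addrC subrK.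
  rewrite (le_trans (normcD _ _)) // (le_trans (lerD (lexx _) (hx _ mm))) //.
  rewrite -[X in X + _]mulr1 -mulrDr.
  have -> : b * (m0%:R^-1 - m.+1%:R^-1) = b * (m0%:R^-1 - m%:R^-1) + b * (m%:R^-1 - m.+1%:R^-1) by ring.
  rewrite expRD mulrA ler_pM ?normc_ge0 ?IH ?addr_ge0 ?divr_ge0 ?exprn_ge0 //.
  rewrite (le_trans (expR_ge1Dx _)) // ler_expR ler_wpM2l // inv_sqr_telescope //.
have xB' m : (m0 <= m)%N -> normc (x m) <= B.
  move=> mm; rewrite (le_trans (xB _ mm)) // ler_wpM2l ?normc_ge0 // ler_expR ler_wpM2l //.
  by rewrite gerBl invr_ge0.
have B0 : 0 <= B by rewrite mulr_ge0 ?normc_ge0 ?expR_ge0.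
have inc m : (m0 <= m)%N -> normc (x m.+1 - x m) <= (B * b) / m.+1%:R ^+ 2.
  by move=> mm; rewrite (le_trans (hx _ mm)) // -mulrA ler_wpM2r ?xB' // divr_ge0 ?exprn_ge0.
have ReB (u v : C) : complex.Re u - complex.Re v = complex.Re (u - v) by case: u; case: v.
have ImB (u v : C) : complex.Im u - complex.Im v = complex.Im (u - v) by case: u; case: v.
have Bb0 : 0 <= B * b by exact: mulr_ge0.
apply: cvgC_ReIm; apply: (slow_cvg Bb0 m01) => m /inc; apply: le_trans.
  by rewrite ReB normc_Re.
by rewrite ImB normc_Im.
Qed.

Lemma euler_factor_near1 z : exists b m0, [/\ 0 <= b, (1 <= m0)%N & forall m, (m0 <= m)%N ->
  normc (euler_factor z m.+1 - 1) <= b / m.+1%:R ^+ 2 /\ normc ((euler_factor z m.+1)^-1 - 1) <= b / m.+1%:R ^+ 2].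
Proof.
set c := normc z; have c0 : 0 <= c by exact: normc_ge0.
have [N hN] := nat_archi (4 * c).
exists (110 * c ^+ 2 + 3 * c), N.+1; split=> // [|m mN].
  by rewrite addr_ge0 // mulr_ge0 // sqr_ge0.
have M4 : 4 * c <= m.+1%:R by apply: hN; rewrite ltnW // ltnS ltnW.
rewrite /euler_factor; set M : R := m.+1%:R in M4 *; set w := z * (lndiff m.+1)%:C.
have M0 : 0 < M by rewrite ltr0n.
have nw : normc w <= 2 * c / M.
  rewrite normcM normc_real ger0_norm ?lndiff_ge0 // [2 * c]mulrC -mulrA ler_wpM2l //.
  exact: lndiff_le2.
pose v := z / m.+1%:R; rewrite -/v.
have nv : normc v = c / M by rewrite normcM normcV normc_nat.
have v4 : normc v <= 4^-1 by rewrite nv ler_pdivrMr //; lra.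
have w2 : normc w <= 2^-1 by rewrite (le_trans nw) // ler_pdivrMr //; lra.
pose P := c ^+ 2 / M ^+ 2; pose S := c / M ^+ 2.
have P0 : 0 <= P by rewrite divr_ge0 ?sqr_ge0.
have S0 : 0 <= S by rewrite divr_ge0 ?sqr_ge0.
have -> : (110 * c ^+ 2 + 3 * c) / M ^+ 2 = 110 * P + 3 * S by rewrite /P /S; field; rewrite gt_eqF.
have ww : 20 * normc w ^+ 2 <= 80 * P.
  have -> : 80 * P = 20 * (2 * c / M) ^+ 2 by rewrite /P; field; rewrite gt_eqF.
  by rewrite ler_wpM2l // lerXn2r ?nnegrE ?normc_ge0 // (le_trans (normc_ge0 w)).
have dvw : normc (v - w) <= 2 * S.
  have -> : v - w = z * (M^-1 - lndiff m.+1)%:C.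
    by rewrite rmorphB mulrBr fmorphV rmorph_nat.
  rewrite normcM normc_real distrC /S mulrCA ler_wpM2l //; exact: lndiff_near_inv.
have e1 : normc (cexp (- w) - 1 + w) <= 80 * P.
  have := @normc_cexpB _ (- w); rewrite normcN opprK => /(_ w2) h; exact: le_trans h ww.
have e2 : normc (cexp w - 1 - w) <= 80 * P by exact: le_trans (normc_cexpB w2) ww.
split.
  have -> : (1 + v) * cexp (- w) - 1 = (1 + v) * (cexp (- w) - 1 + w) + (v - w) - v * w by ring.
  rewrite (le_trans (normcD _ _)) // normcN.
  rewrite (le_trans (lerD (normcD _ _) (lexx _))) // (normcM (1 + v)) (normcM v).
  have h1 : normc (1 + v) * normc (cexp (- w) - 1 + w) <= (5 / 4) * (80 * P).
    rewrite ler_pM ?normc_ge0 // (le_trans (normcD _ _)) // normc1; lra.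
  have h2 : normc v * normc w <= 2 * P.
    have -> : 2 * P = (c / M) * (2 * c / M) by rewrite /P; field; rewrite gt_eqF.
    by rewrite ler_pM ?normc_ge0 // nv.
  lra.
have n1v : 3 / 4 <= normc (1 + v).
  have := normc_dist 1 (- v); rewrite normc1 normcN opprK; lra.
have n0 : 0 < normc (1 + v) by apply: lt_le_trans n1v; lra.
have v0 : 1 + v != 0 by rewrite -normc_gt0.
have -> : ((1 + v) * cexp (- w))^-1 - 1 = (1 + v)^-1 * ((cexp w - 1 - w) - (v - w)).
  by rewrite cexpN invfM invrK; field.
rewrite normcM normcV ler_pdivrMl //.
apply: le_trans (_ : 80 * P + 2 * S <= _).
  by rewrite (le_trans (normcD _ _)) // normcN lerD.
apply: le_trans (_ : (3 / 4) * (110 * P + 3 * S) <= _); first lra.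
by apply: ler_wpM2r n1v; lra.
Qed.

(** The Euler sequence converges and so does its inverse, because their relative
increments are [O(1 / m ^ 2)]; the product of the limits is [1], so the limit of the
Euler sequence is not zero. *)
Lemma G_limit z : (forall m, z + m%:R != 0) -> cvgC (euler_product z) (G z).
Proof.
move=> zm; have [b [m0 [b0 m01 fb]]] := euler_factor_near1 z.
have fnz m : (1 <= m)%N -> euler_factor z m != 0.
  move=> m1; rewrite mulf_neq0 ?cexp_neq0 //.
  have mC : (m%:R : C) != 0 by rewrite -normc_gt0 normc_nat ltr0n.
  by apply: contra (zm m) => /eqP h; rewrite -[z](divfK mC) -[X in _ + X]mul1r -mulrDl addrC h mul0r.
have gnz N : euler_product z N != 0.
  rewrite mulf_neq0 //; first by have := zm 0%N; rewrite addr0.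
  by rewrite prodf_seq_neq0; apply/allP => m; rewrite mem_index_iota => /andP[m1 _]; rewrite fnz.
have gS m : euler_product z m.+1 = euler_product z m * euler_factor z m.+1.
  by rewrite /euler_product big_nat_recr //= mulrA.
have [l c1] : exists l, cvgC (euler_product z) l.
  eexists; apply: (@ratio_cvg _ b m0) => // m mm; rewrite gS -{2}[euler_product z m]mulr1 -mulrBr normcM.
  by rewrite ler_wpM2l ?normc_ge0 //; case: (fb m mm).
have c2 : cvgC (euler_seq z) (Gamma z).
  apply: (@ratio_cvg _ b m0) => // m mm; have m1 := leq_trans m01 mm.
  rewrite !euler_seqE ?(leqW m1) // gS invfM -{2}[(euler_product z m)^-1]mulr1 -mulrBr normcM.
  by rewrite ler_wpM2l ?normc_ge0 //; case: (fb m mm).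
have e1 : l * Gamma z = 1.
  apply: (cvgC_unique (cvgCM c1 c2)) => e e0; exists 1%N => n n1.
  by rewrite euler_seqE // divff // subrr normc0 ltW.
suff -> : G z = l by [].
have G0 : Gamma z != 0 by apply: contra_eq_neq e1 => ->; rewrite mulr0 eq_sym oner_neq0.
by apply: (mulIf G0); rewrite e1 /G mulVf.
Qed.

(** The Euler factor with [cexp (- lndiff m z)] replaced by its polynomial approximation. *)
Definition factor_poly (K m : nat) : {poly C} :=
  (1 + (m%:R^-1)%:C *: 'X) * (1 - (lndiff m / K%:R)%:C *: 'X) ^+ K.
Definition euler_poly (N K : nat) : {poly C} := 'X * \prod_(1 <= m < N.+1) factor_poly K m.

Lemma euler_poly_cvg N z : cvgC (fun K => (euler_poly N K).[z]) (euler_product z N).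
Proof.
have -> : (fun K => (euler_poly N K).[z]) = (fun K => z * \prod_(1 <= m < N.+1) (factor_poly K m).[z]).
  by apply/funext => K; rewrite hornerM hornerX horner_prod.
apply: cvgCM; first exact: cvgC_cst.
apply: cvgC_prod => m.
have -> : (fun K => (factor_poly K m).[z]) = (fun K => (1 + z / m%:R) * (1 - (z * (lndiff m)%:C) / K%:R) ^+ K).
  apply/funext => K; rewrite /factor_poly hornerM horner_exp !hornerE.
  rewrite fmorphV rmorph_nat [_^-1 * z]mulrC rmorphM fmorphV rmorph_nat.
  by congr (_ * (1 - _) ^+ _); rewrite mulrC mulrA.
apply: cvgCM; first exact: cvgC_cst.
exact: cvgC_cexp.
Qed.

(** First choose the number [N] of factors, then the exponent [K], which may be
taken arbitrarily large. *)
Lemma euler_poly_approximates_G (s : seq C) (e : R) N0 : 0 < e ->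
  (forall z, z \in s -> forall m, z + m%:R != 0) ->
  exists2 N, (N0 <= N)%N & exists K0, forall K, (K0 <= K)%N ->
    forall z, z \in s -> normc ((euler_poly N K).[z] - G z) <= e.
Proof.
move=> e0 sm; have e2 : 0 < e / 2 by lra.
have [N hN] : exists N, forall n, (N <= n)%N -> forall z, z \in s -> normc (euler_product z n - G z) <= e / 2.
  elim: s sm => [|z s IH] sm; first by exists 0%N.
  have [|N hN] := IH; first by move=> y ys; apply: sm; rewrite inE ys orbT.
  have [N' hN'] := G_limit (sm z (mem_head _ _)) e2.
  exists (maxn N N') => n; rewrite geq_max => /andP[h h'] y; rewrite inE => /predU1P[->|]; first exact: hN'.
  exact: hN.
exists (maxn N0 N); first exact: leq_maxl.
set n := maxn N0 N; have {}hN := hN n (leq_maxr _ _).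
have [K0 hK] : exists K0, forall K, (K0 <= K)%N -> forall z, z \in s -> normc ((euler_poly n K).[z] - euler_product z n) <= e / 2.
  elim: s {sm hN} => [|z s [K0 IH]]; first by exists 0%N.
  have [K1 hK1] := euler_poly_cvg n z e2.
  exists (maxn K0 K1) => K; rewrite geq_max => /andP[h h'] y; rewrite inE => /predU1P[->|]; first exact: hK1.
  exact: IH.
exists K0 => K /hK{}hK z zs.
have -> : (euler_poly n K).[z] - G z = ((euler_poly n K).[z] - euler_product z n) + (euler_product z n - G z) by ring.
rewrite (le_trans (normcD _ _)) //; have := hK z zs; have := hN z zs; lra.
Qed.
End Euler.

(** * Norms of the Euler factors *)

Section Bounds.
Local Open Scope complex_scope.
Variable R : realType.
Notation C := R[i].
Implicit Types (r a : R) (f : {poly C}).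

Lemma l1Mn r (p : {poly C}) k : l1 r (p *+ k) = k%:R * l1 r p.
Proof. by rewrite -scaler_nat l1Z normc_nat. Qed.

Lemma l1_scaleX r a : 0 <= a -> l1 r (a%:C *: 'X) = a * r.
Proof. by move=> a0; rewrite l1Z l1X normc_real ger0_norm. Qed.

(** Induction on the exponent: the error [E_k] of [(1 - t) ^ k] against [1 - k t] satisfies
[E_(k+1) = (1 - t) E_k + k t ^ 2]. *)
Lemma l1_pow_near1 r a K : 0 <= r -> 0 <= a -> (0 < K)%N -> r * a <= 1 ->
  l1 r ((1 - (a / K%:R)%:C *: 'X) ^+ K - 1 + a%:C *: 'X) <= (r * a) ^+ 2.
Proof.
move=> r0 a0 K0 ra; have KR : 0 < K%:R :> R by rewrite ltr0n.
set t : {poly C} := (a / K%:R)%:C *: 'X; pose q := r * a / K%:R.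
have q0 : 0 <= q by rewrite divr_ge0 ?mulr_ge0.
have tq : l1 r t = q by rewrite l1_scaleX ?divr_ge0 // /q mulrC mulrA.
have -> : a%:C *: 'X = t *+ K.
  rewrite -scaler_nat scalerA; congr (_ *: _).
  by rewrite -(rmorph_nat (real_complex R)) -rmorphM [K%:R * _]mulrC divfK // gt_eqF.
have -> : (r * a) ^+ 2 = K%:R ^+ 2 * q ^+ 2 by rewrite /q; field; rewrite gt_eqF.
suff : forall k, (k <= K)%N -> l1 r ((1 - t) ^+ k - 1 + t *+ k) <= k%:R ^+ 2 * q ^+ 2 by apply.
elim=> [|k IH] kK; first by rewrite expr0 subrr mulr0n addr0 l1_0 expr0n mul0r.
have -> : (1 - t) ^+ k.+1 - 1 + t *+ k.+1 = (1 - t) * ((1 - t) ^+ k - 1 + t *+ k) + (t * t) *+ k.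
  have ident (A : comPzRingType) (u g c : A) :
    (1 - u) * g - 1 + (u * c + u) = (1 - u) * (g - 1 + u * c) + u * u * c by ring.
  by rewrite exprS mulrSr -[t *+ k]mulr_natr -[(t * t) *+ k]mulr_natr ident.
rewrite (le_trans (l1D _ _ r0)) // l1Mn.
have h1 := l1M (1 - t) ((1 - t) ^+ k - 1 + t *+ k) r0.
have h2 : l1 r (1 - t) <= 1 + q by rewrite (le_trans (l1B _ _ r0)) // l1_1 tq.
have h3 := l1M t t r0; rewrite tq -expr2 in h3.
have kq : k%:R * q <= 1.
  rewrite (le_trans _ ra) // -[leRHS](divfK (lt0r_neq0 KR)) -/q mulrC ler_wpM2l // ler_nat ltnW //.
have h4 : l1 r (1 - t) * l1 r ((1 - t) ^+ k - 1 + t *+ k) <= (1 + q) * (k%:R ^+ 2 * q ^+ 2).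
  by rewrite ler_pM ?l1_ge0 ?IH // ltnW.
have h5 : k%:R * l1 r (t * t) <= k%:R * q ^+ 2 by rewrite ler_wpM2l.
apply: le_trans (lerD (le_trans h1 h4) h5) _.
have : (k%:R * q) * (k%:R * q ^+ 2) <= 1 * (k%:R * q ^+ 2) by rewrite ler_wpM2r // mulr_ge0 // sqr_ge0.
have : 0 <= q ^+ 2 by exact: sqr_ge0.
by rewrite -natr1; nra.
Qed.

(** The linear terms [1 / m] and [- lndiff m] cancel up to [2 / m ^ 2]. *)
Lemma factor_poly_near1 r K m : 1 <= r -> (0 < K)%N -> 2 * r <= m%:R ->
  l1 r (factor_poly R K m - 1) <= 12 * (r / m%:R) ^+ 2.
Proof.
move=> r1 K0 rm; have r0 : 0 <= r by lra.
have m0 : 0 < m%:R :> R by lra.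
have m1 : (1 <= m)%N by rewrite -(ltr0n R).
have a0 := lndiff_ge0 R m1; have a2 := lndiff_le2 R m1; have ad := lndiff_near_inv R m1.
rewrite /factor_poly; set a := lndiff R m in a0 a2 ad *; set E1 := _ ^+ K.
have ram : r * a <= 2 * (r / m%:R).
  by rewrite (le_trans (ler_wpM2l r0 a2)) // mulrCA.
have rm2 : r / m%:R <= 2^-1 by rewrite ler_pdivrMr //; lra.
have rm0 : 0 <= r / m%:R by rewrite divr_ge0.
have ra1 : r * a <= 1 by lra.
have := l1_pow_near1 r0 a0 K0 ra1; rewrite -/E1; set E := (X in l1 r X) => hE.
set b : {poly C} := (m%:R^-1)%:C *: 'X.
have lb : l1 r b = r / m%:R by rewrite l1_scaleX ?invr_ge0 // mulrC.
have -> : (1 + b) * E1 - 1 = (b - a%:C *: 'X) - b * (a%:C *: 'X) + (1 + b) * E by rewrite /E; ring.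
have h1 : l1 r (b - a%:C *: 'X) <= 2 * (r / m%:R) ^+ 2.
  rewrite /b -scalerBl -rmorphB l1Z l1X normc_real distrC.
  rewrite (le_trans (ler_wpM2r r0 ad)) //.
  have -> : 2 * (r / m%:R) ^+ 2 = 2 / m%:R ^+ 2 * (r * r) by field; rewrite gt_eqF.
  by rewrite ler_wpM2l ?divr_ge0 ?sqr_ge0 // ler_peMr.
have h2 : l1 r (b * (a%:C *: 'X)) <= 2 * (r / m%:R) ^+ 2.
  rewrite (le_trans (l1M _ _ r0)) // lb l1_scaleX // [a * r]mulrC.
  by rewrite (le_trans (ler_wpM2l rm0 ram)) // expr2 mulrCA.
have h3 : l1 r ((1 + b) * E) <= (3 / 2) * (2 * (r / m%:R)) ^+ 2.
  rewrite (le_trans (l1M _ _ r0)) // ler_pM ?l1_ge0 //.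
    by rewrite (le_trans (l1D _ _ r0)) // l1_1 lb; lra.
  by rewrite (le_trans hE) // lerXn2r ?nnegrE ?mulr_ge0.
rewrite (le_trans (l1D _ _ r0)) // (le_trans (lerD (l1B _ _ r0) (lexx _))) //.
have := lerD (lerD h1 h2) h3; rewrite exprMn; have := sqr_ge0 (r / m%:R); lra.
Qed.

Lemma l1_factor_poly_le r K m : 0 <= r -> (0 < K)%N -> (1 <= m)%N ->
  l1 r (factor_poly R K m) <= (1 + r) * expR (r * lndiff R m).
Proof.
move=> r0 K0 m1; have m0 : 1 <= m%:R :> R by rewrite ler1n.
have a0 := lndiff_ge0 R m1; have KR : 0 < K%:R :> R by rewrite ltr0n.
rewrite (le_trans (l1M _ _ r0)) // ler_pM ?l1_ge0 //.
  rewrite (le_trans (l1D _ _ r0)) // l1_1 l1_scaleX ?invr_ge0 // lerD2l ler_piMl //.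
  by rewrite invf_le1 // (lt_le_trans ltr01).
rewrite (le_trans (l1_exp _ _ r0)) //.
have -> : r * lndiff R m = K%:R * (r * lndiff R m / K%:R) by rewrite [RHS]mulrC divfK // gt_eqF.
rewrite expRM_natl lerXn2r ?nnegrE ?l1_ge0 ?expR_ge0 //.
rewrite (le_trans (l1B _ _ r0)) // l1_1 l1_scaleX ?divr_ge0 //.
by rewrite (le_trans _ (expR_ge1Dx _)) // lerD2l mulrC mulrA.
Qed.

Lemma expRN2_le (x : R) : 0 <= x <= 2^-1 -> expR (- (2 * x)) <= 1 - x.
Proof.
move=> /andP[x0 x1]; rewrite expRN; have h := expR_ge1Dx (2 * x).
have p : 0 < 1 + 2 * x by lra.
apply: le_trans (_ : (1 + 2 * x)^-1 <= _).
  by rewrite lef_pV2 ?posrE ?expR_gt0.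
rewrite -[_^-1]mul1r ler_pdivrMr //; nra.
Qed.

Lemma l1_pow_lower r t K f : 0 <= r -> 0 <= t -> t * r <= 1 ->
  (1 - t * r) ^+ K * l1 r f <= l1 r ((1 - t%:C *: 'X) ^+ K * f).
Proof.
move=> r0 t0 tr; elim: K f => [|K IH] f; first by rewrite !expr0 !mul1r.
rewrite !exprS -!mulrA.
have h : l1 r ((1 - t%:C *: 'X : {poly C}) - 1) <= t * r.
  by rewrite addrAC subrr add0r l1N l1_scaleX.
apply: le_trans (l1_near1_mul ((1 - t%:C *: 'X) ^+ K * f) r0 h).
by rewrite ler_wpM2l // subr_ge0.
Qed.

(** The factor [1 + X / m] is [(X + m) / m], so [l1_XsubC_mul] applies as long as [r] is
not close to [m]. *)
Lemma l1_factor_poly_mul r K m f : 0 <= r -> 2 * r <= K%:R -> (0 < K)%N -> (1 <= m)%N -> 2^-1 <= `|r - m%:R| ->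
  (2 * m%:R)^-1 * expR (- (2 * (r * lndiff R m))) * l1 r f <= l1 r (factor_poly R K m * f).
Proof.
move=> r0 rK K0 m1 hm; have m0 : 1 <= m%:R :> R by rewrite ler1n.
have mR : 0 < m%:R :> R by lra.
have a0 := lndiff_ge0 R m1; have KR : 0 < K%:R :> R by rewrite ltr0n.
have a1 : lndiff R m <= 1.
  case: m m1 {hm m0 mR a0} => [|[|m]] // _; first by rewrite lndiff1.
  by have [_ /le_trans->//] := @lndiff_bounds R m.+2 isT; rewrite invf_le1 ?ler1n.
pose g := (1 - (lndiff R m / K%:R)%:C *: 'X) ^+ K * f.
have -> : factor_poly R K m * f = (m%:R^-1)%:C *: (('X - (- m%:R)%:P) * g).
  rewrite /factor_poly -mulrA -/g scalerAl; congr (_ * _); rewrite rmorphN opprK scalerDr addrC; congr (_ + _).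
  rewrite -mul_polyC -polyCM fmorphV rmorph_nat mulVf ?polyC1 //.
  by rewrite -normc_gt0 normc_nat.
rewrite l1Z normc_real ger0_norm ?invr_ge0 //.
rewrite invfM [2^-1 * _]mulrC -!mulrA ler_wpM2l ?invr_ge0 //.
apply: le_trans (l1_XsubC_mul _ _ r0).
rewrite normcN normc_nat ler_pM ?mulr_ge0 ?expR_ge0 ?l1_ge0 //.
have q1 : r * lndiff R m / K%:R <= 2^-1.
  rewrite ler_pdivrMr //; have : r * lndiff R m <= r * 1 by rewrite ler_wpM2l.
  lra.
have q0 : 0 <= r * lndiff R m / K%:R by rewrite divr_ge0 ?mulr_ge0.
have E : lndiff R m / K%:R * r = r * lndiff R m / K%:R by rewrite mulrC mulrA.
apply: le_trans (l1_pow_lower K f r0 _ _); rewrite ?divr_ge0 ?E //; last by lra.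
rewrite ler_wpM2r ?l1_ge0 //.
have -> : - (2 * (r * lndiff R m)) = K%:R * - (2 * (r * lndiff R m / K%:R)) by field; rewrite gt_eqF.
rewrite expRM_natl lerXn2r ?nnegrE ?expR_ge0 //; first by lra.
by apply: expRN2_le; rewrite q0.
Qed.

Lemma l1_factor_poly_mul_far r K m f : 1 <= r -> (0 < K)%N -> 8 * r <= m%:R ->
  expR (- (24 * (r / m%:R) ^+ 2)) * l1 r f <= l1 r (factor_poly R K m * f).
Proof.
move=> r1 K0 rm; have r0 : 0 <= r by lra.
have m0 : 0 < m%:R :> R by lra.
have rm0 : 0 <= r / m%:R by rewrite divr_ge0.
have rm8 : r / m%:R <= 8^-1 by rewrite ler_pdivrMr //; lra.
have h : 2 * r <= m%:R by lra.
apply: le_trans (l1_near1_mul f r0 (factor_poly_near1 r1 K0 h)); rewrite ler_wpM2r ?l1_ge0 //.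
have -> : 24 * (r / m%:R) ^+ 2 = 2 * (12 * (r / m%:R) ^+ 2) by ring.
apply: expRN2_le; have : (r / m%:R) ^+ 2 <= 8^-1 ^+ 2 by rewrite lerXn2r ?nnegrE.
have := sqr_ge0 (r / m%:R); rewrite [8^-1 ^+ 2]expr2; lra.
Qed.

Lemma sum_inv_sqr M N : (1 <= M)%N -> \sum_(M.+1 <= m < N) m%:R ^- 2 <= M%:R^-1 :> R.
Proof.
move=> M1; have [NM|MN] := leqP N M.+1; first by rewrite big_geq // invr_ge0.
apply: le_trans (_ : \sum_(M.+1 <= m < N) (m.-1%:R^-1 - m%:R^-1) <= _).
  rewrite big_nat [leRHS]big_nat; apply: ler_sum => -[|m] // /andP[Mm _].
  by rewrite ltnS in Mm; exact: inv_sqr_telescope (leq_trans M1 Mm).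
rewrite (@telescope_sumr_eq _ M.+1 N (fun k => - k.-1%:R^-1)) 1?ltnW //; last first.
  by move=> k _ /=; rewrite opprK addrC.
by rewrite /= opprK addrC gerBl invr_ge0.
Qed.

End Bounds.

(** * Uniform polynomial approximation of 1/Gamma *)

Section Bounds2.
Local Open Scope complex_scope.
Variable R : realType.
Notation C := R[i].
Implicit Types (r a : R) (f : {poly C}).

Lemma prod_expR (a b : nat) (F : nat -> R) :
  \prod_(a <= m < b) expR (F m) = expR (\sum_(a <= m < b) F m).
Proof. by rewrite (big_morph expR (@expRD R) (@expR0 R)). Qed.

Lemma ln_ge_half (x : R) : 2 <= x -> 2^-1 <= ln x.
Proof.
move=> x2; have x0 : 0 < x by lra.
rewrite -[x]invrK lnV ?posrE ?invr_gt0 // lerNr.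
have -> : x^-1 = 1 + (x^-1 - 1) by ring.
have xi : x^-1 <= 2^-1 by rewrite lef_pV2 ?posrE.
have xi0 : 0 < x^-1 by rewrite invr_gt0.
have : -1 < x^-1 - 1 by lra.
by move/le_ln1Dx; lra.
Qed.

Lemma ln_le_pow r (x : R) k : 0 < r -> 0 < x -> x <= r ^+ k -> ln x <= k%:R * ln r.
Proof.
move=> r0 x0 xr; apply: le_trans (_ : ln (r ^+ k) <= _); first by rewrite ler_ln ?posrE ?exprn_gt0.
by rewrite lnXn // mulr_natl.
Qed.

(** [M] separates the factors [m <= M], estimated one by one, from the factors
[m > M >= 7 r], which are close to [1]. *)
Lemma truncation_index r : 2 <= r -> exists M : nat,
  [/\ (1 <= M)%N, M%:R <= 8 * r, 8 * r <= M.+1%:R, 7 * r <= M%:R & ln M%:R <= 4 * ln r].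
Proof.
move=> r2; have r0 : 0 <= 8 * r by lra.
have h1 : (Num.truncn (8 * r))%:R <= 8 * r by rewrite truncn_le.
have h2 : 8 * r < (Num.truncn (8 * r)).+1%:R by exact: truncnS_gt.
exists (Num.truncn (8 * r)); set M := Num.truncn _ in h1 h2 *.
have h3 : 7 * r <= M%:R by rewrite -natr1 in h2; lra.
have M0 : 0 < M%:R :> R by lra.
split=> //; [by rewrite -(ltr0n R)|by exact: ltW|].
apply: ln_le_pow => //; first lra.
apply: le_trans h1 _; have -> : r ^+ 4 = r ^+ 3 * r by rewrite exprSr.
rewrite ler_wpM2r //; first lra.
have -> : 8 = 2 ^+ 3 :> R by ring.
by rewrite lerXn2r ?nnegrE //; lra.
Qed.

(** The factors [m <= M <= 8 r] contribute [(1 + r) ^ M exp(r ln M)], the others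
[exp(12 r ^ 2 / M)]. *)
Lemma l1_euler_poly_le r N K : 2 <= r -> 8 * r <= N%:R -> (0 < K)%N ->
  l1 r (euler_poly R N K) <= expR (56 * (r * ln r)).
Proof.
move=> r2 rN K0; have [M [M1 M8 M8' M7 lnMl]] := truncation_index r2.
have r0 : 0 <= r by lra.
have L := ln_ge_half r2; set l := ln r in lnMl L *.
have MN : (M <= N)%N by rewrite -(ler_nat R) (le_trans M8).
have p1 : \prod_(1 <= m < M.+1) l1 r (factor_poly R K m) <= expR (16 * (r * l) + 4 * (r * l)).
  apply: le_trans (_ : \prod_(1 <= m < M.+1) ((1 + r) * expR (r * lndiff R m)) <= _).
    rewrite big_nat [leRHS]big_nat; apply: ler_prod => m /andP[m1 _].
    by rewrite l1_ge0 //= l1_factor_poly_le.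
  rewrite big_split /= prodr_const_nat subn1 /= prod_expR -mulr_sumr sum_lndiff expRD.
  rewrite ler_pM ?exprn_ge0 ?expR_ge0 ?addr_ge0 //.
    have -> : 1 + r = expR (ln (1 + r)) by rewrite lnK // posrE; lra.
    rewrite -expRM_natl ler_expR.
    have l1r : ln (1 + r) <= 2%:R * l by apply: ln_le_pow; rewrite ?expr2; nra.
    have : M%:R * ln (1 + r) <= (8 * r) * (2 * l).
      by rewrite ler_pM // ln_ge0; lra.
    lra.
  by rewrite ler_expR mulrCA ler_wpM2l.
have p2 : \prod_(M.+1 <= m < N.+1) l1 r (factor_poly R K m) <= expR (4 * (r * l)).
  apply: le_trans (_ : \prod_(M.+1 <= m < N.+1) expR (12 * r ^+ 2 * m%:R ^- 2) <= _).
    rewrite big_nat [leRHS]big_nat; apply: ler_prod => m /andP[Mm _]; rewrite l1_ge0 //=.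
    have rm : 8 * r <= m%:R by rewrite (le_trans M8') // ler_nat.
    have -> : factor_poly R K m = 1 + (factor_poly R K m - 1) by rewrite addrC subrK.
    rewrite (le_trans (l1D _ _ r0)) // l1_1 (le_trans _ (expR_ge1Dx _)) // lerD2l.
    rewrite (le_trans (factor_poly_near1 _ K0 _)) //; [lra|lra|].
    by rewrite expr_div_n mulrA.
  rewrite prod_expR ler_expR -mulr_sumr.
  rewrite (le_trans (ler_wpM2l _ (sum_inv_sqr R _ M1))) //; first by rewrite mulr_ge0 ?sqr_ge0.
  rewrite ler_pdivrMr; last lra.
  have : 4 * (r * l) * (7 * r) <= 4 * (r * l) * M%:R by rewrite ler_wpM2l // mulr_ge0 //; nra.
  by rewrite expr2; nra.
rewrite /euler_poly l1_mulX (le_trans (ler_wpM2l r0 (l1_prod _ _ _ r0))) //.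
rewrite (@big_cat_nat _ _ _ M.+1) //=.
have -> : 56 * (r * l) = l + (16 * (r * l) + 4 * (r * l) + (36 * (r * l) - l)) by ring.
rewrite expRD; have -> : expR l = r by rewrite lnK // posrE; lra.
rewrite ler_wpM2l // expRD ler_pM //.
- by apply: prodr_ge0 => m _; exact: l1_ge0.
- by apply: prodr_ge0 => m _; exact: l1_ge0.
- by rewrite (le_trans p2) // ler_expR; nra.
Qed.

Lemma l1_prod_lower r (a b : nat) (u : nat -> {poly C}) (be : nat -> R) f : 0 <= r ->
  (forall m, (a <= m < b)%N -> 0 <= be m) ->
  (forall m g, (a <= m < b)%N -> be m * l1 r g <= l1 r (u m * g)) ->
  (\prod_(a <= m < b) be m) * l1 r f <= l1 r ((\prod_(a <= m < b) u m) * f).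
Proof.
move=> r0; rewrite /index_iota; set s := iota _ _.
have sP m : m \in s -> (a <= m < b)%N.
  by rewrite -[s]/(index_iota a b) mem_index_iota.
elim: s sP => [|m s IH] sP be0 hu; first by rewrite !big_nil !mul1r.
rewrite !big_cons -!mulrA; have ms := sP m (mem_head _ _).
apply: le_trans (hu _ _ ms); rewrite ler_wpM2l ?be0 // IH // => y ys.
by apply: sP; rewrite inE ys orbT.
Qed.

(** A half-integer radius keeps the distance [1 / 2] from all the roots [- m]. *)
Lemma l1_euler_poly_mul r N K T f : 2 <= r -> r = T%:R + 2^-1 -> 8 * r <= N%:R -> 2 * r <= K%:R -> (0 < K)%N ->
  l1 r f <= expR (56 * (r * ln r)) * l1 r (euler_poly R N K * f).
Proof.
move=> r2 rT rN rK K0; have [M [M1 M8 M8' M7 lnMl]] := truncation_index r2.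
have r0 : 0 <= r by lra.
have L := ln_ge_half r2; set l := ln r in lnMl L *.
have MN : (M <= N)%N by rewrite -(ler_nat R) (le_trans M8).
rewrite -ler_pdivrMl ?expR_gt0 // -expRN.
have half m : 2^-1 <= `|r - m%:R|.
  rewrite rT; have [mT|Tm] := leqP m T.
    by have : m%:R <= T%:R :> R by [rewrite ler_nat]; move=> h; rewrite ger0_norm; lra.
  by have : T%:R + 1 <= m%:R :> R by [rewrite natr1 ler_nat]; move=> h; rewrite ler0_norm; lra.
pose b1 m := (2 * m%:R)^-1 * expR (- (2 * (r * lndiff R m))).
pose b2 m := expR (- (24 * (r / m%:R) ^+ 2)).
have B1 : expR (- (40 * (r * l)) - 8 * (r * l)) <= \prod_(1 <= m < M.+1) b1 m.
  rewrite /b1 big_split /= prod_expR sumrN -!mulr_sumr sum_lndiff expRD.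
  rewrite ler_pM ?expR_ge0 //.
    apply: le_trans (_ : \prod_(1 <= m < M.+1) (2 * M%:R)^-1 <= _); last first.
      rewrite big_nat [leRHS]big_nat; apply: ler_prod => m /andP[m1 mM].
      have m0 : 0 < m%:R :> R by rewrite ltr0n.
      rewrite invr_ge0 mulr_ge0 //= lef_pV2 ?posrE ?mulr_gt0 //; last lra.
      by rewrite ler_pM2l // ler_nat -ltnS.
    rewrite prodr_const_nat subn1 /= -{1}[(2 * M%:R)^-1]lnK ?posrE ?invr_gt0 ?mulr_gt0 //; try lra.
    rewrite -expRM_natl ler_expR lnV ?posrE ?mulr_gt0 //; try lra.
    rewrite mulrN lerN2 lnM ?posrE //; try lra.
    have ln2 : ln 2 <= 1%:R * l by apply: ln_le_pow; rewrite ?expr1; lra.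
    have : M%:R * (ln 2 + ln M%:R) <= (8 * r) * (5 * l).
      rewrite ler_pM //; last lra.
      by rewrite addr_ge0 ?ln_ge0 //; [lra|rewrite ler1n].
    lra.
  rewrite ler_expR; have : r * ln M%:R <= r * (4 * l) by rewrite ler_wpM2l.
  lra.
have B2 : expR (- (8 * (r * l))) <= \prod_(M.+1 <= m < N.+1) b2 m.
  rewrite /b2 prod_expR ler_expR sumrN lerN2 -mulr_sumr.
  under eq_bigr do rewrite expr_div_n.
  rewrite -mulr_sumr.
  rewrite (le_trans (ler_wpM2l _ (ler_wpM2l _ (sum_inv_sqr R _ M1)))) ?sqr_ge0 //.
  rewrite mulrA ler_pdivrMr; last lra.
  have : 8 * (r * l) * (7 * r) <= 8 * (r * l) * M%:R by rewrite ler_wpM2l // mulr_ge0 //; nra.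
  by rewrite expr2; nra.
have b10 m : 0 <= b1 m by rewrite mulr_ge0 ?expR_ge0 ?invr_ge0 ?mulr_ge0.
have b20 m : 0 <= b2 m by rewrite expR_ge0.
rewrite /euler_poly -mulrA l1_mulX (@big_cat_nat _ _ _ M.+1) //= -mulrA.
pose f2 := \prod_(M.+1 <= m < N.+1) factor_poly R K m * f.
pose f1 := \prod_(1 <= m < M.+1) factor_poly R K m * f2; rewrite -/f2 -/f1.
have h1 : (\prod_(1 <= m < M.+1) b1 m) * l1 r f2 <= l1 r f1.
  by apply: l1_prod_lower => // m g /andP[m1 _]; apply: l1_factor_poly_mul.
have h2 : (\prod_(M.+1 <= m < N.+1) b2 m) * l1 r f <= l1 r f2.
  apply: l1_prod_lower => // m g /andP[Mm _]; apply: l1_factor_poly_mul_far => //; first lra.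
  by rewrite (le_trans M8') // ler_nat.
have -> : - (56 * (r * l)) = (- (40 * (r * l)) - 8 * (r * l)) + - (8 * (r * l)) by ring.
apply: le_trans (_ : l1 r f1 <= _); last by rewrite ler_peMl ?l1_ge0 //; lra.
apply: le_trans h1; rewrite expRD -mulrA ler_pM ?mulr_ge0 ?expR_ge0 ?l1_ge0 //.
by apply: le_trans h2; rewrite ler_wpM2r ?l1_ge0.
Qed.

Lemma euler_poly_root N K m : (m <= N)%N -> (euler_poly R N K).[- m%:R] = 0.
Proof.
case: m => [|m] mN; first by rewrite hornerM hornerX oppr0 mul0r.
rewrite hornerM horner_prod (bigD1_seq m.+1) ?mem_index_iota ?iota_uniq //=.
have mC : (m.+1%:R : C) != 0 by rewrite -normc_gt0 normc_nat ltr0n.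
have -> : (factor_poly R K m.+1).[- m.+1%:R] = 0; last by rewrite mul0r mulr0.
rewrite /factor_poly hornerM hornerD hornerZ hornerX -polyC1 hornerC fmorphV rmorph_nat.
by rewrite mulrN mulVf // subrr mul0r.
Qed.

Lemma G_polynomial_approximation (s : seq C) (B e : R) : 0 < e ->
  (forall z, z \in s -> forall m, z + m%:R != 0) ->
  exists Q : {poly C},
  [/\ forall z, z \in s -> normc (Q.[z] - G z) <= e,
      forall m : nat, m%:R <= B -> Q.[- m%:R] = 0,
      forall r, 2 <= r -> r <= B -> l1 r Q <= expR (56 * (r * ln r)) &
      forall T f, let r := T%:R + 2^-1 in 2 <= r -> r <= B ->
        l1 r f <= expR (56 * (r * ln r)) * l1 r (Q * f)].
Proof.
move=> e0 sm; have [N0 hN0] := nat_archi (8 * B).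
have [N1 hN1] := nat_archi B.
have [N NN [K0 hK]] := euler_poly_approximates_G (maxn N0 N1) e0 sm.
have [K1 hK1] := nat_archi (2 * B); pose K := maxn 1 (maxn K0 K1).
have [NN0 NN1] : (N0 <= N)%N /\ (N1 <= N)%N by apply/andP; rewrite -geq_max.
have K10 : (0 < K)%N by rewrite leq_max.
have KK0 : (K0 <= K)%N by rewrite !leq_max leqnn !orbT.
have KK1 : 2 * B <= K%:R by apply: hK1; rewrite !leq_max leqnn !orbT.
have B8 := hN0 _ NN0.
exists (euler_poly R N K); split.
- exact: hK.
- by move=> m mB; apply: euler_poly_root; rewrite -(ler_nat R) (le_trans mB) // hN1.
- by move=> r r2 rB; apply: l1_euler_poly_le => //; lra.
- by move=> T f r r2 rB; apply: (l1_euler_poly_mul (T := T)) => //; lra.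
Qed.

End Bounds2.

(** * Zero estimate for p(z, G(z)) *)

Section Final1.
Local Open Scope complex_scope.
Variable R : realType.
Notation C := R[i].

Lemma expR_ge_id (x : R) : x <= expR x.
Proof. by apply: le_trans (expR_ge1Dx x); rewrite lerDr ler01. Qed.

Lemma expR_geq1 (x : R) : (1 <= expR x) = (0 <= x).
Proof. by rewrite -[X in X <= _]expR0 ler_expR. Qed.

Lemma exprn_expR (x : R) n : expR x ^+ n = expR (n%:R * x).
Proof. by rewrite expRM_natl. Qed.

(** Apply [zero_count] with [r = T1 + 1 / 2] and [r' = 6 r]: as the zeros have modulus at
most [n <= T1], each of them gains a factor [2], and all other quantities are
[exp(O(T1 T2 ln T1))]. *)
Lemma zero_estimate T1 T2 n (p : nat -> nat -> int) (s : seq C) :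
  (2 <= T1)%N -> (0 < T2)%N -> (n <= T1)%N -> uniq s ->
  (forall z, z \in s -> normc z <= n%:R) ->
  (forall z, z \in s -> forall m, z + m%:R != 0) ->
  (forall z, z \in s -> bieval T1 T2 p z (G z) = 0) ->
  (exists i j, [/\ (i < T1)%N, (j < T2)%N & p i j != 0]) ->
  (size s)%:R <= 4000 * (T1%:R * T2%:R * ln T1%:R) :> R.
Proof.
move=> T12 T20 nT us sn sm szero pn0.
pose t : R := T1%:R; pose r : R := t + 2^-1; pose r' := 6 * r.
have t2 : 2 <= t by rewrite ler_nat.
have u1 : 1 <= T2%:R :> R by rewrite ler1n.
have nt : n%:R <= t by rewrite ler_nat.
have L := ln_ge_half t2; set la := ln t in L.
have ela : expR la = t by rewrite /la lnK // posrE; lra.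
have r2 : 2 <= r by rewrite /r; lra.
have rr : r <= 5 / 4 * t by rewrite /r; lra.
have lnr : ln r <= 2%:R * la by apply: ln_le_pow; rewrite ?expr2; nra.
have lnr' : ln r' <= 4%:R * la.
  apply: ln_le_pow; rewrite /r'; [lra|lra|].
  have -> : t ^+ 4 = t ^+ 3 * t by rewrite exprSr.
  have : 2 ^+ 3 <= t ^+ 3 by rewrite lerXn2r ?nnegrE //; lra.
  have -> : 2 ^+ 3 = 8 :> R by ring.
  nra.
have ln0 : 0 <= ln r by rewrite ln_ge0 //; lra.
have ln0' : 0 <= ln r' by rewrite ln_ge0 // /r'; lra.
pose K := expR (56 * (r * ln r)); pose U := expR (56 * (r' * ln r')).
have K1 : 1 <= K by rewrite expR_geq1 !mulr_ge0 //; lra.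
have U1 : 1 <= U by rewrite expR_geq1 !mulr_ge0 // /r'; lra.
have := @zero_count R T1 T2 r r' n%:R K U p s (@G R) _ _ _ _ _ _ K1 U1 _ us sn szero pn0.
have c1 : 1 <= r by lra.
have c2 : T1%:R <= r + 1 by rewrite -/t /r; lra.
have c3 : r <= r' by rewrite /r'; lra.
have c4 : 0 <= n%:R :> R by [].
have c5 : n%:R <= r by rewrite /r; lra.
have c6 : n%:R < r' by rewrite /r' /r; lra.
move=> /(_ c1 c2 c3 c4 c5 c6) zc.
have {}zc := zc _.
have approx (e : R) : 0 < e -> exists Q, [/\ forall m, (m < T1)%N -> Q.[- m%:R] = 0,
     forall f, l1 r f <= K * l1 r (Q * f), l1 r' Q <= U &
     forall z, z \in s -> normc (Q.[z] - G z) <= e].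
  move=> e0; have [Q [q1 q2 q3 q4]] := G_polynomial_approximation r' e0 sm.
  exists Q; split=> //.
  - move=> m mT; apply: q2; have : m%:R <= t by rewrite ler_nat ltnW.
    by rewrite /r' /r; lra.
  - by move=> f; apply: (q4 T1).
  - by apply: q3; rewrite // /r'; lra.
move: zc => /(_ approx); set ra := _ / _; set N := size s; set E := T1%:R * (2 * r) ^+ T1.
move=> zc.
have la0 : 0 <= la by lra.
have tla : la <= t * la by nra.
have Eb : E <= expR (4 * (t * la)).
  have -> : 4 * (t * la) = t * la + t * (3%:R * la) by ring.
  rewrite expRD; apply: ler_pM; rewrite ?exprn_ge0 //; first by lra.
    by rewrite -/t -ela ler_expR ela.
  have -> : 2 * r = expR (ln (2 * r)) by rewrite lnK // posrE; lra.
  rewrite exprn_expR ler_expR ler_wpM2l //.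
  apply: ln_le_pow; [lra|lra|].
  have -> : t ^+ 3 = t * t * t by ring.
  have : 2 * 2 <= t * t by rewrite ler_pM.
  nra.
have E1b : 1 + E <= expR (5 * (t * la)).
  have -> : 5 * (t * la) = t * la + 4 * (t * la) by ring.
  rewrite expRD; have : 2 <= expR (t * la) by apply: le_trans t2 _; rewrite -ela ler_expR ela.
  have : 1 <= expR (4 * (t * la)) by rewrite expR_geq1; lra.
  nra.
have Kb : K <= expR (140 * (t * la)).
  rewrite ler_expR; have : r * ln r <= (5 / 4 * t) * (2 * la) by rewrite ler_pM //; lra.
  lra.
have E0 : 0 <= E by rewrite mulr_ge0 ?exprn_ge0 //; lra.
have KEb : (K * (1 + E)) ^+ T2 <= expR (T2%:R * (145 * (t * la))).
  rewrite -exprn_expR lerXn2r ?nnegrE ?mulr_ge0 ?expR_ge0 ?addr_ge0 //.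
  have -> : 145 * (t * la) = 140 * (t * la) + 5 * (t * la) by ring.
  by rewrite expRD ler_pM ?expR_ge0 ?addr_ge0.
have rab : ra ^+ N <= expR (N%:R * - 2^-1).
  rewrite -exprn_expR; have ra0 : 0 <= ra by rewrite divr_ge0 //; lra.
  rewrite lerXn2r ?nnegrE ?expR_ge0 //; apply: le_trans (_ : 1 + - 2^-1 <= _); last exact: expR_ge1Dx.
  rewrite /ra ler_pdivrMr; last by lra.
  by rewrite /r'; rewrite /r in c5 *; lra.
have Tb : T1%:R * T2%:R <= expR (t * T2%:R) by exact: expR_ge_id.
have r'b : r' ^+ T1 <= expR (t * (4 * la)).
  have -> : r' = expR (ln r') by rewrite lnK // posrE; lra.
  by rewrite exprn_expR ler_expR ler_wpM2l //; lra.
have Ub : U ^+ T2 <= expR (T2%:R * (56 * (30 * (t * la)))).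
  rewrite exprn_expR ler_expR ler_wpM2l // ler_wpM2l //.
  have : r' * ln r' <= (15 / 2 * t) * (4 * la) by rewrite ler_pM // /r'; lra.
  lra.
have : 1 <= expR (T2%:R * (145 * (t * la)) + (N%:R * - 2^-1 + (t * T2%:R + (t * (4 * la) + T2%:R * (56 * (30 * (t * la))))))).
  apply: le_trans zc _; rewrite !expRD.
  have r'0 : 0 <= r' by lra.
  have ra0 : 0 <= ra by rewrite divr_ge0 //; lra.
  have U0 : 0 <= U by lra.
  have K0 : 0 <= K by lra.
  have n1 : 0 <= (K * (1 + E)) ^+ T2 by rewrite exprn_ge0 // mulr_ge0 // addr_ge0.
  have n2 : 0 <= ra ^+ N by rewrite exprn_ge0.
  have n3 : 0 <= T1%:R * T2%:R :> R by rewrite mulr_ge0.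
  have n4 : 0 <= r' ^+ T1 by rewrite exprn_ge0.
  have n5 : 0 <= U ^+ T2 by rewrite exprn_ge0.
  apply: ler_pM => //; first by rewrite !mulr_ge0.
  apply: ler_pM => //; first by rewrite !mulr_ge0.
  by apply: ler_pM; rewrite ?mulr_ge0 // ler_pM.
rewrite expR_geq1 => h.
have tl0 : 0 <= t * la by lra.
have a1 : t * T2%:R <= 2 * (t * T2%:R * la).
  have : 0 <= t * T2%:R by rewrite mulr_ge0 //; lra.
  nra.
have a2 : t * la <= t * T2%:R * la by rewrite mulrAC ler_peMr.
have -> : T1%:R * T2%:R * la = t * T2%:R * la by [].
set Y := t * T2%:R * la in a1 a2 *.
have b1 : T2%:R * (145 * (t * la)) = 145 * Y by rewrite /Y; ring.
have b2 : T2%:R * (56 * (30 * (t * la))) = 1680 * Y by rewrite /Y; ring.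
have b3 : t * (4 * la) = 4 * (t * la) by ring.
rewrite b1 b2 b3 in h; lra.
Qed.

End Final1.

(** * An auxiliary polynomial that vanishes at all the points *)

Section Final2.
Local Open Scope complex_scope.
Variable R : realType.
Notation C := R[i].

(** [q] bounds [(n / rho) ^ S].  The two terms of the bound in [small_polynomial] are at
most fractions of [E ^ (- 2)], the Liouville lower bound. *)
Lemma error_budget (E M B U S q : R) : 1 <= E -> 1 <= M -> M <= E -> 1 <= B -> B <= E ->
  1 <= U -> 0 <= S -> 24 * (S + 1) * U <= E -> 0 <= q -> q <= E ^- 5 ->
  S * (2 * (3 * (U * M * B) / E ^+ 5)) <= E ^- 2 / 4 /\ q * (U * B * M) <= E ^- 2 / 24.
Proof.
move=> E1 M1 ME B1 BE U1 S0 c q0 qE.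
have E0 : 0 < E by lra.
have M0 : 0 <= M by lra.
have B0 : 0 <= B by lra.
have SU : 0 <= S * U by rewrite mulr_ge0 //; lra.
have MB : M * B <= E * E by rewrite ler_pM.
have MB0 : 0 <= M * B by rewrite mulr_ge0.
split.
  have -> : S * (2 * (3 * (U * M * B) / E ^+ 5)) = (24 * (S * U)) * (M * B) / (4 * E ^+ 5).
    by field; rewrite gt_eqF.
  have -> : E ^- 2 / 4 = E * (E * E) / (4 * E ^+ 5) by field; rewrite gt_eqF.
  rewrite ler_wpM2r ?invr_ge0 ?mulr_ge0 ?exprn_ge0 ?(ltW E0) //.
  by rewrite ler_pM //; lra.
have -> : E ^- 2 / 24 = E ^- 5 * ((E / 24) * (E * E)) by field; rewrite gt_eqF.
rewrite -mulrA [B * M]mulrC; apply: ler_pM => //; first by rewrite mulr_ge0 //; lra.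
by rewrite ler_pM //; lra.
Qed.

Lemma budget_contradiction (E v x : R) : 1 <= E -> v <= x + E ^- 2 / 4 ->
  x <= E ^- 2 / 4 + E ^- 2 / 24 -> 1 <= v * E ^+ 2 -> False.
Proof.
move=> E1 vx xE lio; have E2 : 0 < E ^+ 2 by rewrite exprn_gt0 //; lra.
have : v <= 3 / 4 * E ^- 2.
  have : 0 < E ^- 2 by rewrite invr_gt0.
  lra.
rewrite ler_pdivlMr // => h; lra.
Qed.

(** Take [B = 3 ^ om] and [K = E ^ 5].  If [p(z, G(z))] were not zero, it would be at least
[E ^ (- 2)] by [liouville], whereas it is at most [(1/4 + 1/4 + 1/24) E ^ (- 2)]: one
term for the Taylor coefficients, one for the tail and one for the approximation of [G]. *)
Lemma auxiliary_vanishing d n (H y : R) T1 T2 S om (s : seq C) :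
  let rho := n%:R * y in let E : R := 3 ^+ (d * om) in
  (0 < d)%N -> (0 < T1)%N -> (0 < T2)%N -> 1 <= H -> 1 <= y -> 2 <= rho ->
  (forall z, z \in s -> [/\ degQ_le (Qadjoin2 z (G z)) d, height z <= H & height (G z) <= H]) ->
  (forall z, z \in s -> normc z <= n%:R) ->
  (forall z, z \in s -> forall m, z + m%:R != 0) ->
  rho ^+ T1 * expR (56 * (rho * ln rho)) ^+ T2 <= E ->
  (T1%:R * T2%:R * H ^+ (T1 + T2)) ^+ d <= E ->
  24 * (S%:R + 1) * (T1%:R * T2%:R) <= E ->
  E ^+ 5 <= y ^+ S ->
  (10 * (d * S) <= T1 * T2)%N ->
  exists p : nat -> nat -> int,
    (exists i j, [/\ (i < T1)%N, (j < T2)%N & p i j != 0]) /\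
    forall z, z \in s -> bieval T1 T2 p z (G z) = 0.
Proof.
move=> rho E d0 T10 T20 H1 y1 rho2 sH sn sm c1 c2 c3 c4 c5.
have E0 : 0 < E by rewrite exprn_gt0.
have E1 : 1 <= E by rewrite exprn_ege1 // ler1n.
have u1 : 1 <= T1%:R :> R by rewrite ler1n.
have u2 : 1 <= T2%:R :> R by rewrite ler1n.
pose B := (3 ^ om)%N; pose K := (3 ^ (5 * (d * om)))%N.
have KE : K%:R = E ^+ 5 by rewrite /K natrX /E -exprM [(5 * _)%N]mulnC.
have BE : B%:R ^+ d = E by rewrite /B natrX /E -exprM [(om * _)%N]mulnC.
have B1 : 1 <= B%:R :> R by rewrite ler1n expn_gt0.
have B0 : 0 <= B%:R :> R by [].
have BE' : B%:R <= E by rewrite -BE -[leLHS]expr1 ler_weXn2l.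
(* [2 * S] real forms with [K] cells each, against [T1 * T2] coefficients in [0 .. B]. *)
have hK : (K ^ (2 * S) < B.+1 ^ (T1 * T2))%N.
  apply: (@leq_ltn_trans (B ^ (T1 * T2))); last by rewrite ltn_exp2r // muln_gt0 T10.
  rewrite /K /B -!expnM leq_exp2l //.
  have -> : (5 * (d * om) * (2 * S) = om * (10 * (d * S)))%N.
    by rewrite mulnACA (mulnC d) -[(om * d * S)%N]mulnA mulnCA.
  by rewrite leq_mul2l c5 orbT.
clearbody E K B.
pose U := expR (56 * (rho * ln rho)).
have U1 : 1 <= U.
  rewrite /U -[X in X <= _]expR0 ler_expR !mulr_ge0 // ?ln_ge0 //; lra.
set M := rho ^+ T1 * _ in c1.
have M1 : 1 <= M by rewrite mulr_ege1 ?exprn_ege1 //; lra.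
have M0 : 0 <= M by lra.
pose U0 : R := T1%:R * T2%:R; have U01 : 1 <= U0 by rewrite mulr_ege1.
have de0 : 0 < E ^- 2 / 4 by rewrite divr_gt0 // invr_gt0 exprn_gt0.
have [eta eta0 cont] := bieval_continuity_seq T1 T2 B%:Z s (@G R) de0.
have [Q [Qs _ QU _]] := G_polynomial_approximation rho eta0 sm.
pose w : R := 3 * (U0 * M * B%:R) / K%:R.
have K0 : 0 < K%:R :> R by rewrite KE exprn_gt0.
have UMB0 : 0 < U0 * M * B%:R by apply: mulr_gt0; [apply: mulr_gt0|]; lra.
have w0 : 0 < w by apply: divr_gt0 => //; apply: mulr_gt0.
have nrho : n%:R <= rho by rewrite /rho ler_peMr.
have rho1 : 1 <= rho by apply: le_trans rho2; rewrite ler1n.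
have hw : 2 * (T1%:R * T2%:R * (rho ^+ T1 * U ^+ T2) * B%:R) < w * K%:R.
  by rewrite /w divfK ?gt_eqF // -/U0 -/M ltr_pM2r // ltr_nat.
have [p [pn0 pB pz]] := small_polynomial (ler0n _ n) nrho rho1 U1 (QU _ rho2 (lexx _)) w0 hw hK.
exists p; split=> // z zs; apply/eqP; apply: contraT => vn0.
have [dz hz hGz] := sH z zs.
pose L : R := U0 * B%:R.
have L1 : 1 <= L by rewrite mulr_ege1.
have pL : \sum_(i < T1) \sum_(j < T2) `|p i j|%:~R <= L.
  apply: le_trans (_ : \sum_(i < T1) \sum_(j < T2) B%:R <= _).
    apply: ler_sum => i _; apply: ler_sum => j _.
    by rewrite -[B%:R]/((B%:Z)%:~R) ler_int pB.
  by rewrite !sumr_const !card_ord -mulrnA -[leLHS]mulr_natl natrM [T2%:R * _]mulrC.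
have := liouville dz hz hGz H1 L1 pL vn0; set v := normc _.
have -> : (L * H ^+ (T1 + T2)) ^+ d = (U0 * H ^+ (T1 + T2)) ^+ d * E.
  by rewrite -BE -exprMn /L; congr (_ ^+ _); ring.
move=> lio.
have v0 : 0 <= v by exact: normc_ge0.
have {}lio : 1 <= v * E ^+ 2.
  apply: le_trans lio _; rewrite ler_wpM2l // expr2 ler_wpM2r //; exact: ltW.
have cz := cont p (fun z => Q.[z]) pB Qs z zs.
have vle : v <= normc (bieval T1 T2 p z Q.[z]) + E ^- 2 / 4.
  rewrite -lerBlDl; apply: le_trans cz; rewrite normcB; exact: normc_dist.
have := pz z (sn z zs); rewrite -/U0 -/M => pz'.
have q : (n%:R / rho) ^+ S <= E ^- 5.
  have n0 : n%:R != 0 :> R by apply: contraTneq rho2 => n0; rewrite /rho n0 mul0r -ltNge.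
  have -> : n%:R / rho = y^-1 by rewrite /rho invfM mulrA divff // mul1r.
  have y0 : 0 < y by exact: lt_le_trans ltr01 y1.
  by rewrite exprVn lef_pV2 ?posrE ?exprn_gt0.
have q0 : 0 <= (n%:R / rho) ^+ S by rewrite exprn_ge0 // divr_ge0 // (le_trans ler01).
have [h1 h2] := error_budget E1 M1 c1 B1 BE' U01 (ler0n R S) c3 q0 q.
rewrite -KE -/w in h1.
by case: (budget_contradiction E1 vle (le_trans pz' (lerD h1 h2)) lio).
Qed.

End Final2.

(** * Choice of the parameters *)

Section ParameterChoice.
Local Open Scope complex_scope.
Variable R : realType.
Implicit Types (x D l X s T n : R).

(** [exp(1/8) <= 8/7], and [8 ^ 8 < 3 * 7 ^ 8]. *)
Lemma expR1_lt3 : expR 1 < 3 :> R.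
Proof.
have h : expR 8^-1 <= 8 / 7 :> R.
  have e := expR_ge1Dx (- (8^-1 : R)); rewrite -[expR _]invrK -expRN.
  have -> : 8 / 7 = (1 + - 8^-1)^-1 :> R by field.
  by rewrite lef_pV2 ?posrE ?expR_gt0 //; lra.
have -> : (1 : R) = 8%:R * 8^-1 by field.
rewrite expRM_natl; apply: le_lt_trans (_ : (8 / 7) ^+ 8 < _).
  by rewrite lerXn2r ?nnegrE ?expR_ge0 //; lra.
by lra.
Qed.

Lemma ln_ge1 x : 3 <= x -> 1 < ln x.
Proof.
move=> x3; rewrite -[X in X < _](expRK (1 : R)) ltr_ln ?posrE ?expR_gt0 //; last lra.
by apply: lt_le_trans x3; exact: expR1_lt3.
Qed.

Lemma ln3_le2 : ln 3 <= 2 :> R.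
Proof.
rewrite -[leRHS]expRK ler_ln ?posrE ?expR_gt0 //.
by have := expR_ge1Dx (2 : R); lra.
Qed.

(** The left-hand side is the logarithm of [rho ^ T1 * exp(56 rho ln rho) ^ T2] for
[T1 = n T], [T2 = T] and [rho = n y]; it is at most [T1 T2] times [d X] times a constant
because [y] is only of order [sqrt X], with [s ^ 2 = X]. *)
Lemma growth_budget n l s T y la k : 45 ^+ 2 <= k -> y = 4 * s -> la = ln y ->
  1 <= s -> 2^-1 <= l -> 0 <= n -> 0 <= T ->
  n * T * (l + la) + T * (56 * (n * y * (l + la))) <= k * (n * T * (s ^+ 2 * l)).
Proof.
move=> hk yE laE s1 l2 n0 T0.
have las : la <= y by rewrite laE; apply: ltW; apply: ln_sublinear; lra.
have -> : n * T * (l + la) + T * (56 * (n * y * (l + la))) = (n * T) * ((l + la) * (1 + 56 * y)) by ring.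
have -> : k * (n * T * (s ^+ 2 * l)) = (n * T) * (k * (s ^+ 2 * l)) by ring.
rewrite ler_wpM2l ?mulr_ge0 //.
apply: le_trans (_ : (l + y) * (225 * s) <= _).
  have la0 : 0 <= la by rewrite laE ln_ge0 //; lra.
  by apply: ler_pM; lra.
have s2 : 0 <= s ^+ 2 by rewrite sqr_ge0.
apply: le_trans (_ : 45 ^+ 2 * (s ^+ 2 * l) <= _); last by rewrite ler_wpM2r ?mulr_ge0 //; lra.
have h1 : s * l <= s ^+ 2 * l by rewrite expr2 -mulrA ler_peMl // mulr_ge0 //; lra.
have h2 : s ^+ 2 <= 2 * (s ^+ 2 * l).
  have l0 : 0 <= 2 * l - 1 by lra.
  have := mulr_ge0 s2 l0; lra.
have -> : (l + y) * (225 * s) = 225 * (s * l) + 900 * s ^+ 2 by rewrite yE; ring.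
lra.
Qed.

(** Every quantity is compared with [exp(O(V))]; the only lower bound on the degree is
[big], which says that [y ^ S] with [S] about [n T ^ 2 / (10 d)] beats [E ^ 5]. *)
Lemma parameter_check (d n T : nat) (H h l la y X P W V E : R) :
  (1 <= d)%N -> (1 <= n)%N -> (1 <= T)%N -> expR h = H -> 1 <= h -> X = d%:R * h ->
  l = ln n%:R -> la = ln y -> 4 <= y -> P = n%:R * T%:R -> 1 <= W ->
  P * X <= 2 * W -> P <= 2 * W -> 56 * W <= V -> 20 * d%:R <= T%:R :> R ->
  n%:R * T%:R * (l + la) + T%:R * (56 * (n%:R * y * (l + la))) <= V ->
  d%:R * (400 * V) <= P * T%:R * la ->
  (forall x, x <= V -> expR x <= E) -> E <= expR (2 * (2 * V)) ->
  exists S : nat, let rho := n%:R * y in let T1 := (n * T)%N in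
  [/\ rho ^+ T1 * expR (56 * (rho * ln rho)) ^+ T <= E,
      (T1%:R * T%:R * H ^+ (T1 + T)) ^+ d <= E &
      [/\ 24 * (S%:R + 1) * (T1%:R * T%:R) <= E, E ^+ 5 <= y ^+ S &
      (10 * (d * S) <= T1 * T)%N]].
Proof.
move=> d1 n1 T0 hE h1 XE lE laE y4 PE W1 nTX nTW VW T20 growth big Elo Ehi.
have nTP : (n * T)%:R = P by rewrite natrM PE.
have T1 : 1 <= T%:R :> R by rewrite ler1n.
have n0 : 1 <= n%:R :> R by rewrite ler1n.
have P1 : 1 <= P by rewrite PE mulr_ege1.
have Tn : T%:R <= P by rewrite PE ler_peMl //; apply: le_trans T1.
have D1 : 1 <= d%:R :> R by rewrite ler1n.
have XD : d%:R <= X by rewrite XE ler_peMr.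
have P0 : 0 <= P by apply: le_trans P1.
pose S := (n * T * T %/ (10 * d))%N.
exists S; split.
- have y0 : 0 < y by apply: lt_le_trans y4.
  have n00 : 0 < n%:R :> R by rewrite ltr0n.
  have lnyn : ln (n%:R * y) = l + la by rewrite lnM ?posrE -?lE -?laE.
  have ny0 : 0 < n%:R * y by rewrite mulr_gt0.
  rewrite exprn_expR lnyn -[in X in X ^+ _](lnK (_ : n%:R * y \in Num.pos)) ?posrE //.
  by rewrite exprn_expR lnyn natrM -expRD; apply: Elo.
- have W8 : 8 * W <= V by clear -VW W1; lra.
  apply: le_trans (Elo (8 * W) W8).
  rewrite -hE nTP.
  have a1 : P <= expR P by exact: expR_ge_id.
  have a2 : T%:R <= expR P by apply: le_trans Tn _; exact: expR_ge_id.
  have a3 : expR h ^+ (n * T + T) <= expR (2 * P * h).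
    rewrite exprn_expR ler_expR ler_wpM2r //; first by apply: le_trans h1.
    by rewrite natrD nTP; clear -Tn; lra.
  apply: le_trans (_ : (expR P * expR P * expR (2 * P * h)) ^+ d <= _).
    rewrite lerXn2r ?nnegrE ?mulr_ge0 ?expR_ge0 ?exprn_ge0 ?expR_ge0 //.
    by rewrite ler_pM ?mulr_ge0 ?exprn_ge0 ?expR_ge0 // ler_pM.
  rewrite -!expRD exprn_expR ler_expR.
  have -> : d%:R * (P + P + 2 * P * h) = 2 * (P * d%:R) + 2 * (P * X) by rewrite XE; ring.
  have : P * d%:R <= P * X by rewrite ler_wpM2l.
  by clear -nTX; lra.
rewrite nTP.
have SU : (S%:R : R) <= P * T%:R by rewrite -nTP -natrM ler_nat leq_div.
have U1 : 1 <= P * T%:R by rewrite mulr_ege1.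
split.
- have hV : 48 + (2 * P + 2 * P) <= V by clear -nTW VW W1; lra.
  apply: le_trans (Elo _ hV).
  rewrite (expRD 48) (expRD (2 * P)); set U := P * T%:R in SU U1 *.
  have Ub : U <= expR (2 * P).
    have -> : 2 * P = P + P by ring.
    rewrite expRD /U; apply: ler_pM => //; first exact: expR_ge_id.
    by apply: le_trans Tn _; exact: expR_ge_id.
  have U0 : 0 <= U by apply: le_trans U1.
  apply: le_trans (_ : 48 * (U * U) <= _).
    have : (S%:R + 1) * U <= (2 * U) * U by rewrite ler_wpM2r //; clear -SU U1; lra.
    by clear; lra.
  apply: ler_pM; [by rewrite ler0n|exact: mulr_ge0|exact: expR_ge_id|].
  by apply: ler_pM.
- have y0 : 0 < y by apply: lt_le_trans y4.
  have -> : y ^+ S = expR (S%:R * la) by rewrite expRM_natl laE lnK.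
  have E0 : 0 <= E by apply: le_trans (Elo V (lexx _)); rewrite expR_ge0.
  apply: le_trans (_ : expR (2 * (2 * V)) ^+ 5 <= _).
    by rewrite lerXn2r ?nnegrE ?expR_ge0.
  rewrite exprn_expR ler_expR.
  have Slo : P * T%:R <= (S%:R + 1) * (10 * d%:R) :> R.
    rewrite -nTP -[10 * d%:R]natrM -!natrM natr1 -natrM ler_nat.
    by rewrite ltnW // /S ltn_ceil // muln_gt0.
  have T20' : 20 * d%:R <= P * T%:R.
    by apply: le_trans T20 _; rewrite ler_peMl.
  have S2 : P * T%:R <= S%:R * (20 * d%:R) :> R by clear -Slo T20'; lra.
  have la0 : 0 <= la by rewrite laE ln_ge0 // (le_trans _ y4) // ler1n.
  have e2 : P * T%:R * la <= S%:R * (20 * d%:R) * la by rewrite ler_wpM2r.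
  have e3 : d%:R * (400 * V) <= d%:R * (20 * (S%:R * la)).
    have -> : d%:R * (20 * (S%:R * la)) = S%:R * (20 * d%:R) * la by ring.
    exact: le_trans big e2.
  have d0 : 0 < d%:R :> R by rewrite ltr0n.
  by rewrite ler_pM2l // in e3; clear -e3; lra.
- by rewrite mulnA mulnC leq_divM.
Qed.

(** [T] is [400 k d X l / ln y] and [om] is [k n T (ln H) l] with [l = ln n], both rounded up.  Here
[k] absorbs the constant of [growth_budget]. *)
Lemma parameter_choice (k : R) (d n : nat) (H : R) : 45 ^+ 2 <= k ->
  (1 <= d)%N -> (2 <= n)%N -> 3 <= H ->
  let X := d%:R * ln H in let y := 4 * Num.sqrt X in
  exists T S om : nat,
  let rho := n%:R * y in let E : R := 3 ^+ (d * om) in let T1 := (n * T)%N in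
  [/\ (0 < T)%N, T%:R <= 408 * (k * (d%:R * X * ln n%:R / ln y)),
      rho ^+ T1 * expR (56 * (rho * ln rho)) ^+ T <= E,
      (T1%:R * T%:R * H ^+ (T1 + T)) ^+ d <= E &
      [/\ 24 * (S%:R + 1) * (T1%:R * T%:R) <= E, E ^+ 5 <= y ^+ S &
      (10 * (d * S) <= T1 * T)%N]].
Proof.
move=> hk d1 n2 H3 X y; set h := ln H in X y *; set l := ln n%:R; set la := ln y.
have k56 : 56 <= k by lra.
have h1 : 1 < h by exact: ln_ge1.
have D1 : 1 <= d%:R :> R by rewrite ler1n.
have N2 : 2 <= n%:R :> R by rewrite ler_nat.
have l2 : 2^-1 <= l by exact: ln_ge_half.
have XE : X = d%:R * h by [].
have XD : d%:R <= X by rewrite XE ler_peMr //; exact: ltW.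
have X1 : 1 <= X by exact: le_trans XD.
set s := Num.sqrt X in y la *.
have s1 : 1 <= s by rewrite -[X in X <= _]sqrtr1 ler_wsqrtr.
have sX : s ^+ 2 = X by rewrite sqr_sqrtr // (le_trans ler01).
have yE : y = 4 * s by [].
have laE : la = ln y by [].
have hE : expR h = H by rewrite lnK // posrE (lt_le_trans _ H3).
have lE : l = ln n%:R by [].
have growth (T : nat) := @growth_budget n%:R l s T%:R y la k hk yE laE s1 l2 (ler0n _ _) (ler0n _ _).
clear hk.
clearbody y la s X h l.
have y4 : 4 <= y by rewrite yE; clear -s1; lra.
have la1 : 1 <= la by rewrite laE; apply: ltW; apply: ln_ge1; lra.
have lay : la <= y by rewrite laE; apply: ltW; apply: ln_sublinear; lra.
have yX : y <= 4 * X by rewrite yE -sX expr2 ler_wpM2l // ler_peMl //; lra.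
pose Z := d%:R * X * l / la.
have ZE : Z = d%:R * X * l / la by [].
have Zla : Z * la = d%:R * X * l by rewrite divfK // gt_eqF //; lra.
clearbody Z.
(* As [la <= y <= 4 * X] and [l >= 1 / 2]; hence rounding up [T] costs only a constant. *)
have Z8 : d%:R <= 8 * Z.
  have la0 : 0 < la by lra.
  rewrite -(ler_pM2r la0) -mulrA Zla.
  have a1 : d%:R * la <= d%:R * (4 * X) by rewrite ler_wpM2l // (le_trans lay).
  have a2 : d%:R * X * 2^-1 <= d%:R * X * l by rewrite ler_wpM2l // mulr_ge0 // (le_trans _ X1).
  by clear -a1 a2; lra.
have Z0 : 0 <= Z by clear -Z8 D1; lra.
pose Z' := k * Z; have ZZ' : 56 * Z <= Z' by rewrite ler_wpM2r.
have Z'E : Z' = k * Z by [].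
clearbody Z'.
have V0 : 0 <= 400 * Z' by clear -ZZ' Z0; lra.
pose T := (Num.truncn (400 * Z')).+1.
have Tlo : 400 * Z' <= T%:R by apply: ltW; exact: truncnS_gt.
have Thi : T%:R <= 408 * Z'.
  have TE : T%:R = (Num.truncn (400 * Z'))%:R + 1 :> R by rewrite natr1.
  have : (Num.truncn (400 * Z'))%:R <= 400 * Z' by rewrite truncn_le V0.
  by move=> q'; rewrite TE; clear -q' ZZ' Z8 D1; lra.
have T0 : (0 < T)%N by [].
clearbody T.
have T1 : 1 <= T%:R :> R by rewrite ler1n.
pose P := n%:R * T%:R : R; have PE : P = n%:R * T%:R by [].
have P2 : 2 <= P by rewrite -[leLHS]mulr1 ler_pM.
have Tn : T%:R <= P by rewrite ler_peMl //; apply: le_trans N2; rewrite ler1n.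
clearbody P.
have P0 : 0 <= P by apply: le_trans P2.
pose W := P * (X * l); have WE : W = P * (X * l) by [].
clearbody W.
have nTX : P * X <= 2 * W.
  have : P * X * 1 <= P * X * (2 * l).
    by rewrite ler_wpM2l ?mulr_ge0 ?(le_trans _ X1) //; clear -l2; lra.
  by rewrite WE; clear; lra.
have nTW : P <= 2 * W.
  by apply: le_trans nTX; rewrite ler_peMr.
have DW : d%:R <= W.
  have : 2 * X <= P * X by rewrite ler_wpM2r // (le_trans _ X1).
  by clear -nTX XD; lra.
pose V := k * W; have W0 : 0 <= W by apply: le_trans DW.
have VW : 56 * W <= V by rewrite ler_wpM2r.
have VE : V = k * W by [].
clearbody V.
pose u := k * (P * (h * l)).
have uE : d%:R * u = V by rewrite VE WE XE /u; ring.
have u0 : 0 <= u.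
  have k0 : 0 <= k by apply: le_trans k56.
  have h0 : 0 <= h by apply: le_trans (ltW h1).
  have l0 : 0 <= l by apply: le_trans l2; rewrite invr_ge0.
  by rewrite /u !mulr_ge0.
pose om := (Num.truncn u).+1.
have Dom1 : V <= d%:R * om%:R.
  by rewrite -uE ler_wpM2l // ltW // truncnS_gt.
have Dom2 : d%:R * om%:R <= 2 * V.
  have omE : om%:R = (Num.truncn u)%:R + 1 :> R by rewrite natr1.
  have q1 : om%:R <= u + 1 by rewrite omE lerD2r truncn_le u0.
  have d0 : 0 <= d%:R :> R by [].
  have := ler_wpM2l d0 q1; rewrite mulrDr mulr1 uE => q2.
  by apply: le_trans q2 _; clear -DW VW W0; lra.
have l3 : 1 <= ln 3 :> R by apply: ltW; apply: ln_ge1.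
have EE : (3 : R) ^+ (d * om) = expR (d%:R * om%:R * ln 3).
  by rewrite -[X in X ^+ _](lnK (_ : 3 \in Num.pos)) ?posrE // exprn_expR natrM.
clearbody om.
have Elo x : x <= V -> expR x <= 3 ^+ (d * om).
  move=> xW; rewrite EE ler_expR; apply: le_trans xW _; apply: le_trans Dom1 _.
  by rewrite -[leLHS]mulr1 ler_wpM2l // mulr_ge0.
have Ehi : (3 : R) ^+ (d * om) <= expR (2 * (2 * V)).
  rewrite EE ler_expR mulrC; apply: ler_pM; [|exact: mulr_ge0|exact: ln3_le2|exact: Dom2].
  exact: le_trans l3.
have T20 : 20 * d%:R <= T%:R :> R by clear -Tlo ZZ' Z8 Z0; lra.
have big : d%:R * (400 * V) <= P * T%:R * la.
  have -> : d%:R * (400 * V) = P * (400 * Z') * la.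
    have -> : P * (400 * Z') * la = P * (400 * k) * (Z * la) by rewrite Z'E; ring.
    by rewrite Zla VE WE; ring.
  by rewrite ler_wpM2r ?ler_wpM2l // (le_trans _ la1).
have grow : n%:R * T%:R * (l + la) + T%:R * (56 * (n%:R * y * (l + la))) <= V.
  by have := growth T; rewrite sX -PE -WE -VE.
have W1 : 1 <= W by clear -nTW P2; lra.
have [S [c1 c2 [c3 c4 c5]]] := parameter_check d1 (ltnW n2) T0 hE (ltW h1) XE lE laE y4 PE W1
  nTX nTW VW T20 grow big Elo Ehi.
exists T, S, om; split; [exact: T0|by rewrite -ZE -Z'E|exact: c1|exact: c2|by []].
Qed.

End ParameterChoice.

(** * The theorem *)

Section Final4.
Local Open Scope complex_scope.
Variable R : realType.
Notation C := R[i].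

(** [ln x = 2 ln (sqrt x)] and [ln s <= s]. *)
Lemma sqr_ln_le (x : R) : 1 <= x -> ln x ^+ 2 <= 4 * x.
Proof.
move=> x1; have x0 : 0 <= x by apply: le_trans x1.
pose s := Num.sqrt x; have s2 : s ^+ 2 = x by rewrite sqr_sqrtr.
have s1 : 1 <= s by rewrite -[X in X <= _]sqrtr1 ler_wsqrtr.
have s0 : 0 < s by apply: lt_le_trans s1.
have h : ln x <= 2 * s.
  by rewrite -s2 lnXn // -[ln s *+ 2]mulr_natl ler_wpM2l // ltW // ln_sublinear.
have -> : 4 * x = (2 * s) ^+ 2 by rewrite exprMn s2; ring.
by rewrite lerXn2r ?nnegrE ?ln_ge0 // mulr_ge0 // ltW.
Qed.

(** [ln (n T)] is [O(l * ln y)], so that the left-hand side is [O(n l ^ 3 (D X) ^ 2 / ln y)]; one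
then uses [l ^ 2 <= 4 n] and [ln X <= 2 ln y]. *)
Lemma count_bound (q D X l y la n T : R) : 1 <= q -> 1 <= D -> D <= X -> 1 < X -> 2 <= n ->
  l = ln n -> y = 4 * Num.sqrt X -> la = ln y -> 1 <= T -> T <= q * (D * X * l / la) ->
  n * T * T * ln (n * T) <= 8 * (10 + 2 * ln q) * q ^+ 2 * (n ^+ 2 * l * ((D * X) ^+ 2 / ln X)).
Proof.
move=> q1 D1 DX X1 n2 lE yE laE T1 Tq.
have l2 : 2^-1 <= l by rewrite lE; exact: ln_ge_half.
have X0 : 0 < X by apply: lt_trans X1.
have s1 : 1 <= Num.sqrt X by rewrite -[Y in Y <= _]sqrtr1 ler_wsqrtr // ltW.
have sX : Num.sqrt X ^+ 2 = X by rewrite sqr_sqrtr // ltW.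
have y4 : 4 <= y by rewrite yE; clear -s1; lra.
have y0 : 0 < y by apply: lt_le_trans y4.
have la1 : 1 <= la by rewrite laE; apply: ltW; apply: ln_ge1; clear -y4; lra.
have la0 : 0 < la by apply: lt_le_trans la1.
have l0 : 0 < l by apply: lt_le_trans l2; rewrite invr_gt0.
have lX0 : 0 < ln X by rewrite ln_gt0.
have lXla : ln X <= 2%:R * la.
  rewrite laE; apply: ln_le_pow => //; rewrite yE exprMn sX ler_peMl ?ltW //.
  by clear; lra.
have D0 : 0 < D by apply: lt_le_trans D1.
have q0 : 0 < q by apply: lt_le_trans q1.
have T0 : 0 < T by apply: lt_le_trans T1.
have n0 : 0 < n by apply: lt_le_trans n2.
have lq0 : 0 <= ln q by rewrite ln_ge0.
have lnT : ln T <= ln q + 2 * ln X + l.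
  have Z0 : 0 < D * X * l by rewrite !mulr_gt0.
  apply: le_trans (_ : ln (q * (D * X * l)) <= _).
    rewrite ler_ln ?posrE ?mulr_gt0 // (le_trans Tq) // ler_wpM2l ?(ltW q0) //.
    by rewrite ler_pdivrMr // ler_peMr // ltW.
  rewrite !lnM ?posrE ?mulr_gt0 //.
  have h1 : ln D <= ln X by rewrite ler_ln ?posrE.
  have h2 : ln l <= l by apply: ltW; exact: ln_sublinear.
  by clear -h1 h2; lra.
have lnnT : ln (n * T) <= (10 + 2 * ln q) * (l * la).
  rewrite lnM ?posrE // -lE.
  have e1 : l <= l * la by rewrite ler_peMr // ltW.
  have e2 : la <= 2 * (l * la).
    have : 2^-1 * la <= l * la by rewrite ler_wpM2r // ltW.
    by clear; lra.
  have e3 : ln q <= ln q * (2 * (l * la)) by rewrite ler_peMr //; clear -e2 la1; lra.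
  by clear -lnT lXla e1 e2 e3; lra.
have TT : T * T <= (q * (D * X * l / la)) ^+ 2 by rewrite expr2 ler_pM // ltW.
have c0 : 0 <= 10 + 2 * ln q by clear -lq0; lra.
have lnn0 : 0 <= ln (n * T).
  by rewrite ln_ge0 // mulr_ege1 // (le_trans _ n2) // ler1n.
apply: le_trans (_ : n * (q * (D * X * l / la)) ^+ 2 * ((10 + 2 * ln q) * (l * la)) <= _).
  rewrite -(mulrA n) ler_pM ?mulr_ge0 ?(ltW n0) ?(ltW T0) //.
  by rewrite ler_wpM2l ?(ltW n0).
have -> : n * (q * (D * X * l / la)) ^+ 2 * ((10 + 2 * ln q) * (l * la)) =
   ((10 + 2 * ln q) * q ^+ 2 * (n * l * (D * X) ^+ 2)) * (l ^+ 2 * la^-1).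
  by field; rewrite gt_eqF.
have -> : 8 * (10 + 2 * ln q) * q ^+ 2 * (n ^+ 2 * l * ((D * X) ^+ 2 / ln X)) =
   ((10 + 2 * ln q) * q ^+ 2 * (n * l * (D * X) ^+ 2)) * ((4 * n) * (2 / ln X)).
  by field; rewrite gt_eqF.
rewrite ler_wpM2l //.
  apply: mulr_ge0; first by rewrite mulr_ge0 ?sqr_ge0.
  by apply: mulr_ge0; [apply: mulr_ge0; exact: ltW|exact: sqr_ge0].
rewrite ler_pM ?sqr_ge0 ?invr_ge0 ?(ltW la0) //.
  by rewrite lE sqr_ln_le // (le_trans _ n2) // ler1n.
by rewrite -[leLHS]mul1r ler_pdivrMr // mulrAC ler_pdivlMr // mul1r.
Qed.

(** The real part of [z] is at least [n - 1 > 0]. *)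
Lemma points_region n d (H : R) z : (2 <= n)%N -> points n d H z ->
  normc z <= n%:R /\ forall m, z + m%:R != 0.
Proof.
move=> n2 [zn _ _ _]; split.
  have -> : z = (z - (n%:R - 2^-1)) + (n%:R - 2^-1)%:C.
    by rewrite rmorphB rmorph_nat fmorphV rmorph_nat subrK.
  have c0 : 0 <= n%:R - 2^-1 :> R.
    by have : 2 <= n%:R :> R by [rewrite ler_nat]; clear; lra.
  apply: le_trans (normcD _ _) _; rewrite normc_real ger0_norm //.
  by apply: le_trans (lerD zn (lexx _)) _; clear; lra.
move=> m; apply/negP => /eqP zm.
have zE : z = - m%:R by apply/eqP; rewrite -addr_eq0 zm.
move: zn; rewrite zE.
have -> : - m%:R - (n%:R - 2^-1) = (- (m%:R + n%:R - 2^-1))%:C :> C.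
  by rewrite rmorphN !rmorphB rmorphD !rmorph_nat fmorphV rmorph_nat; ring.
rewrite normc_real normrN ger0_norm; have h : 2 <= n%:R :> R by rewrite ler_nat.
  have : 0 <= m%:R :> R by []. clear -h; lra.
have : 0 <= m%:R :> R by []. clear -h; lra.
Qed.

Lemma card_points_le (q : R) (d n : nat) (H : R) (s : seq C) :
  q = 408 * 45 ^+ 2 -> (1 <= d)%N -> (2 <= n)%N -> 3 <= H -> uniq s ->
  (forall z, z \in s -> points n d H z) ->
  (size s)%:R <= 4000 * (8 * (10 + 2 * ln q) * q ^+ 2) * n%:R ^+ 2 * ln n%:R *
          ((d%:R ^+ 2 * ln H) ^+ 2 / ln (d%:R * ln H)).
Proof.
move=> qE d1 n2 H3 us sP.
have [T [S [om [T0 Tq c1 c2 [c3 c4 c5]]]]] := parameter_choice (lexx (45 ^+ 2)) d1 n2 H3.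
set X := d%:R * ln H in Tq c1 c4 *; set y := 4 * Num.sqrt X in Tq c1 c4.
have h1 : 1 < ln H by exact: ln_ge1.
have D1 : 1 <= d%:R :> R by rewrite ler1n.
have DX : d%:R <= X by rewrite ler_peMr //; exact: ltW.
have X1 : 1 < X by apply: (lt_le_trans h1); apply: ler_peMl => //; exact: ltW (lt_trans ltr01 h1).
have s1 : 1 <= Num.sqrt X by rewrite -[Y in Y <= _]sqrtr1; apply: ler_wsqrtr; exact: ltW.
have y1 : 1 <= y by rewrite /y; clear -s1; lra.
have N2 : 2 <= n%:R :> R by rewrite ler_nat.
have T1 : 1 <= T%:R :> R by rewrite ler1n.
have rho2 : 2 <= n%:R * y by rewrite -[leLHS]mulr1 ler_pM.
have T10 : (0 < n * T)%N by rewrite muln_gt0 T0 (ltnW n2).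
have H1 : 1 <= H by rewrite (le_trans _ H3) // ler1n.
have [p [pn0 pz]] := auxiliary_vanishing (s := s) d1 T10 T0 H1 y1 rho2
  (fun z zs => let: And4 _ a b c := sP z zs in And3 a b c)
  (fun z zs => proj1 (points_region n2 (sP z zs))) (fun z zs => proj2 (points_region n2 (sP z zs))) c1 c2 c3 c4 c5.
have nT2 : (2 <= n * T)%N by rewrite (leq_trans n2) // leq_pmulr.
have nnT : (n <= n * T)%N by rewrite leq_pmulr.
have := zero_estimate nT2 T0 nnT us
  (fun z zs => proj1 (points_region n2 (sP z zs))) (fun z zs => proj2 (points_region n2 (sP z zs))) pz pn0.
have q1 : 1 <= q by rewrite qE; clear; lra.
have Tq' : T%:R <= q * (d%:R * X * ln n%:R / ln y) by rewrite qE -mulrA.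
have := count_bound q1 D1 DX X1 N2 erefl erefl erefl T1 Tq'.
have -> : d%:R ^+ 2 * ln H = d%:R * X by rewrite /X expr2 mulrA.
move=> h h'; apply: (le_trans h').
have assoc (a K u v w : R) : a * K * u * v * w = a * (K * (u * v * w)) by ring.
rewrite assoc; apply: ler_wpM2l; first by rewrite ler0n.
by apply: le_trans h; rewrite natrM.
Qed.

End Final4.

Theorem mainTheorem3 (R : realType) :
  exists c : R, 0 < c /\
    forall (d n : nat) (H : R), (1 <= d)%N -> (2 <= n)%N -> 3 <= H ->
      finite_set (points n d H) /\
      (#|` fset_set (points n d H)|)%fset%:R <=
        c * n%:R ^+ 2 * ln n%:R *
          ((d%:R ^+ 2 * ln H) ^+ 2 / ln (d%:R * ln H)).
Proof.
(* [408 * k] is the constant of [parameter_choice] for [k = 45 ^+ 2]. *)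
pose q : R := 408 * 45 ^+ 2; have qE : q = 408 * 45 ^+ 2 by [].
clearbody q; have q1 : 1 <= q by rewrite qE; clear; lra.
exists (4000 * (8 * (10 + 2 * ln q) * q ^+ 2)); split.
  have lq : 0 <= ln q by rewrite ln_ge0.
  apply: mulr_gt0; first by rewrite ltr0n.
  apply: mulr_gt0; last by rewrite exprn_gt0 // (lt_le_trans ltr01).
  by clear -lq; lra.
move=> d n H d1 n2 H3; set bound := _ * (_ / _).
have card (B : {fset R[i]}) : ([set` B] `<=` points n d H)%classic -> #|` B|%:R <= bound.
  move=> BP; apply: (@card_points_le R q d n H (enum_fset B) qE d1 n2 H3 (fset_uniq B)).
  by move=> z zB; apply: BP.
have fin : finite_set (points n d H).
  apply: contrapT => inf.
  have [B BP] := infinite_set_fset (Num.truncn bound).+1 inf.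
  have := card B BP => /le_lt_trans /(_ (truncnS_gt bound)).
  by rewrite ltr_nat ltnS => h1 h2; have := leq_trans h2 h1; rewrite ltnn.
by split=> //; apply: card => z /=; rewrite in_fset_set // => /set_mem.
Qed.
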